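(* Let $N\ge 1$ and let $\phi:\mathbb{B}_N\to\mathbb{B}_N$ be a holomorphic map. The following assertions are equivalent: (1) $C_\phi$ is compact on $H^\psi(\mathbb{B}_N)$ for every Orlicz function $\psi$; (2) there exists $\alpha>-1$ such that $C_\phi$ is compact on $A^\psi_\alpha(\mathbb{B}_N)$ for every Orlicz function $\psi$; (3) $C_\phi$ is compact on $H^\infty(\mathbb{B}_N)$; (4) $\|\phi\|_\infty:=\sup_{z\in\mathbb{B}_N}|\phi(z)|<1$.
   Context: $\mathbb{B}_N=\{z\in\mathbb{C}^N:|z|<1\}$ is the open unit ball of $\mathbb{C}^N$ with boundary sphere $\mathbb{S}_N$; $\sigma_N$ is the normalized rotation-invariant measure on $\mathbb{S}_N$, and for $\alpha>-1$, $dv_\alpha(z)=c_\alpha(1-|z|^2)^\alpha dv(z)$ is the weighted Lebesgue volume measure on $\mathbb{B}_N$ normalized to be a probability measure. For a holomorphic $\phi:\mathbb{B}_N\to\mathbb{B}_N$, the composition operator is $C_\phi f=f\circ\phi$. An Orlicz function is a strictly convex function $\psi:[0,\infty)\to[0,\infty)$ with $\psi(0)=0$, continuous at $0$, and $\psi(x)/x\to\infty$ as $x\to\infty$. For a probability space $(\Omega,\mathbb{P})$, $L^\psi(\Omega)$ is the space of measurable $f$ with $\int_\Omega\psi(|f|/C)\,d\mathbb{P}<\infty$ for some $C>0$, normed by the Luxemburg norm $\|f\|_\psi=\inf\{C>0:\int_\Omega\psi(|f|/C)\,d\mathbb{P}\le 1\}$. The Hardy–Orlicz space $H^\psi(\mathbb{B}_N)$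 is the Banach space of holomorphic $f$ on $\mathbb{B}_N$ with $\|f\|_{H^\psi}:=\sup_{0<r<1}\|f_r\|_{L^\psi(\mathbb{S}_N,\sigma_N)}<\infty$, where $f_r(\zeta)=f(r\zeta)$. The weighted Bergman–Orlicz space $A^\psi_\alpha(\mathbb{B}_N)$ is the space of holomorphic functions on $\mathbb{B}_N$ belonging to $L^\psi(\mathbb{B}_N,v_\alpha)$, with the Luxemburg norm. *)

(* Defs.v *)
From HB Require Import structures.
From mathcomp Require Import all_boot all_order all_algebra.
From mathcomp Require Import all_classical all_reals all_analysis.
From mathcomp Require Import complex.
Set Implicit Arguments. Unset Strict Implicit. Unset Printing Implicit Defensive.
Import Order.TTheory GRing.Theory Num.Theory.
Local Open Scope classical_set_scope.
Local Open Scope ring_scope.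

Section Defs.
Context (R : realType) (N : nat).

Definition cvec := 'I_N -> R[i].

Definition cmod (w : R[i]) : R :=
  Num.sqrt (complex.Re w ^+ 2 + complex.Im w ^+ 2).

Definition vnorm (z : cvec) : R := Num.sqrt (\sum_(i < N) cmod (z i) ^+ 2).

Definition ballN : set cvec := [set z | vnorm z < 1].

Definition vadd (z h : cvec) : cvec := fun i => z i + h i.
Definition vscale (r : R) (z : cvec) : cvec := fun i => Complex r 0 * z i.

Definition holo (f : cvec -> R[i]) : Prop :=
  forall z, vnorm z < 1 ->
  exists a : 'I_N -> R[i], forall eps : R, 0 < eps ->
    exists2 delta : R, 0 < delta &
      forall h : cvec, vnorm h < delta ->
        cmod (f (vadd z h) - f z - \sum_(k < N) a k * h k) <= eps * vnorm h.

Definition holo_self (phi : cvec -> cvec) : Prop :=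
  (forall k : 'I_N, holo (fun z => phi z k)) /\
  (forall z, vnorm z < 1 -> vnorm (phi z) < 1).

Definition Cop (phi : cvec -> cvec) (f : cvec -> R[i]) : cvec -> R[i] :=
  fun z => f (phi z).

Fixpoint iint (k : nat) (G : (nat -> R) -> \bar R) : \bar R :=
  match k with
  | 0 => G (fun _ => 0)
  | k'.+1 => (\int[@lebesgue_measure R]_(t in setT)
                iint k' (fun x => G (fun j => if j == k' then t else x j)))%E
  end.

Definition vec_of (x : nat -> R) : cvec :=
  fun i => Complex (x (2 * i)%N) (x (2 * i + 1)%N).

Definition leb_int (G : cvec -> \bar R) : \bar R :=
  iint (2 * N) (fun x => G (vec_of x)).

Definition wt (alpha : R) (z : cvec) : R :=
  if vnorm z < 1 then powR (1 - vnorm z ^+ 2) alpha else 0.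

Definition bint (alpha : R) (G : cvec -> \bar R) : \bar R :=
  (((fine (leb_int (fun z => (wt alpha z)%:E)))^-1)%:E
     * leb_int (fun z => ((wt alpha z)%:E * G z)%E))%E.

(* integral with respect to sigma_N on S_N: the normalized surface measure,
   realised as the image of normalized volume measure v = v_0 on B_N under
   the radial projection z |-> z/|z|. *)
Definition sint (G : cvec -> \bar R) : \bar R :=
  bint 0 (fun z => G (vscale (vnorm z)^-1 z)).

Definition orlicz (psi : R -> R) : Prop :=
  [/\ psi 0 = 0,
      (forall x, 0 <= x -> 0 <= psi x),
      (forall x y t, 0 <= x -> 0 <= y -> x != y -> 0 < t < 1 ->
         psi (t * x + (1 - t) * y) < t * psi x + (1 - t) * psi y),
      (forall eps, 0 < eps -> exists2 d, 0 < d &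
         forall x, 0 <= x < d -> psi x < eps) &
      (forall M : R, exists A : R, forall x, A < x -> M < psi x / x)].

Definition in_Lpsi (Int : (cvec -> \bar R) -> \bar R) (psi : R -> R)
  (f : cvec -> R[i]) : Prop :=
  exists2 c : R, 0 < c & (Int (fun z => (psi (cmod (f z) / c))%:E) < +oo)%E.

Definition lux (Int : (cvec -> \bar R) -> \bar R) (psi : R -> R)
  (f : cvec -> R[i]) : \bar R :=
  ereal_inf [set c%:E | c in
    [set c : R | 0 < c /\ (Int (fun z => (psi (cmod (f z) / c))%:E) <= 1)%E]].

Definition hardy_norm (psi : R -> R) (f : cvec -> R[i]) : \bar R :=
  ereal_sup [set lux sint psi (fun z => f (vscale r z)) | r in
               [set r : R | 0 < r < 1]].
Definition hardy (psi : R -> R) (f : cvec -> R[i]) : Prop :=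
  holo f /\ (hardy_norm psi f < +oo)%E.

Definition bergman (alpha : R) (psi : R -> R) (f : cvec -> R[i]) : Prop :=
  holo f /\ in_Lpsi (bint alpha) psi f.
Definition bergman_norm (alpha : R) (psi : R -> R) :=
  lux (bint alpha) psi.

Definition hinf (f : cvec -> R[i]) : Prop :=
  holo f /\ exists M : R, forall z, vnorm z < 1 -> cmod (f z) <= M.
Definition hinf_norm (f : cvec -> R[i]) : \bar R :=
  ereal_sup [set (cmod (f z))%:E | z in ballN].

Definition compact_op (S : (cvec -> R[i]) -> Prop)
  (nrm : (cvec -> R[i]) -> \bar R)
  (T : (cvec -> R[i]) -> (cvec -> R[i])) : Prop :=
  (forall f, S f -> S (T f)) /\
  forall (u : nat -> cvec -> R[i]) (M : R),
    (forall n, S (u n) /\ (nrm (u n) <= M%:E)%E) ->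
    exists (s : nat -> nat) (g : cvec -> R[i]),
      [/\ (forall n, (s n < s n.+1)%N), S g &
          forall eps : R, 0 < eps -> exists n0 : nat, forall n, (n0 <= n)%N ->
            (nrm (fun z => (T (u (s n)) z - g z)%R) <= eps%:E)%E].

End Defs.

(* Main.v *)
(* Hardy-Orlicz and Bergman-Orlicz norms are both Luxemburg norms of a family of means: the
   single mean [bint alpha], or the spherical means over the radii [0 < r < 1].  For each of
   these families, [|f p| <= K * A + C * B] as soon as all the means of [(|f| - A)^+] are at
   most [B], where [K] depends on [N] only and [C] stays bounded on compact subsets; this is a
   mean value inequality, obtained from Cauchy's theorem on squares one variable at a time.
   If [sup |phi| < 1], Montel's theorem gives a subsequence converging uniformly on
   [phi(B_N)], hence in norm after composition.
   Otherwise [phi] takes values arbitrarily close to some unit vector [e].  The functions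
   [(k + 1) ((1 + <z, e>) / 2)^m_k], with [m_k] so large that they lie in the unit ball,
   composed with [phi], converge pointwise to 0; but they are at least [(k + 1) / 2] at a point
   [z_k].  If the Orlicz function grows fast enough, compared with the evaluation constants at
   the [z_k], the images cannot tend to 0 in norm, so [C_phi] is not compact. *)

(* The converse conceals a circle: [m_k] is chosen from the value of the Orlicz function at [k + 1],
   [z_k] from [m_k], the evaluation constant from [z_k], and the Orlicz function must beat that
   constant. It is broken by making the three choices for every level [k] and every real value [v]
   before any Orlicz function is fixed. The function is then built level by level, its new slope
   beyond [k + 1] depending only on its value at [k + 1]. A steep slope absorbs the factor [C] of
   the mean, but not the factor of the truncation level [A]. Hence [K] must stay fixed while the
   [z_k] approach the sphere, and the truncations [(|f| - A)^+] are carried through every mean value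
   inequality. Squares replace discs because their sides are parallel to the axes: Fubini's theorem
   selects good sides, and lower bounds of the Cauchy kernel stand in for the value [2 pi]. The
   spherical mean is a volume integral of a radially projected function, so it is reached by
   dilations instead of polar coordinates. *)
Require Import Defs.
From HB Require Import structures.
From mathcomp Require Import all_boot all_order all_algebra.
From mathcomp Require Import all_classical all_reals all_analysis.
From mathcomp Require Import complex ring lra zify measurable_realfun.
Import Order.TTheory GRing.Theory Num.Theory.
Local Open Scope classical_set_scope.
Local Open Scope ring_scope.
Import numFieldNormedType.Exports.
Set Implicit Arguments. Unset Strict Implicit. Unset Printing Implicit Defensive.

(** * Moduli and norms *)

Section ComplexModulus.
Context {R : realType}.
Implicit Types (w z : R[i]) (x y : R).

Lemma cmodE w : cmod w = ComplexField.Normc.normc w.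
Proof. by case: w. Qed.

Lemma cmod_ge0 w : 0 <= cmod w. Proof. exact: sqrtr_ge0. Qed.
Lemma cmodM w z : cmod (w * z) = cmod w * cmod z.
Proof. by rewrite !cmodE ComplexField.Normc.normcM. Qed.
Lemma cmodV w : cmod w^-1 = (cmod w)^-1.
Proof. by rewrite !cmodE ComplexField.Normc.normcV. Qed.
Lemma cmodD w z : cmod (w + z) <= cmod w + cmod z.
Proof. by rewrite !cmodE le_normcD. Qed.
Lemma cmodN w : cmod (- w) = cmod w.
Proof. by rewrite !cmodE normcN. Qed.
Lemma cmod0 : cmod (0 : R[i]) = 0.
Proof. by rewrite cmodE ComplexField.Normc.normc0. Qed.
Lemma cmod1 : cmod (1 : R[i]) = 1.
Proof. by rewrite cmodE ComplexField.Normc.normc1. Qed.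
Lemma cmod_eq0 w : cmod w = 0 -> w = 0.
Proof. by rewrite cmodE; exact: ComplexField.Normc.eq0_normc. Qed.
Lemma cmod_gt0 w : w != 0 -> 0 < cmod w.
Proof.
by move=> w0; rewrite lt_neqAle cmod_ge0 andbT eq_sym; apply: contra w0 => /eqP/cmod_eq0 ->.
Qed.
Lemma cmod_neq0 w : 0 < cmod w -> w != 0.
Proof. by apply: contraTneq => ->; rewrite cmod0 ltxx. Qed.
Lemma cmodB w z : cmod (w - z) = cmod (z - w).
Proof. by rewrite -cmodN opprB. Qed.
Lemma cmodX w n : cmod (w ^+ n) = cmod w ^+ n.
Proof. by elim: n => [|n IH]; rewrite ?expr0 ?cmod1// !exprS cmodM IH. Qed.
Lemma cmodr x : cmod (Complex x 0) = `|x|.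
Proof. by rewrite /cmod /= expr0n /= addr0 sqrtr_sqr. Qed.
Lemma cmod_dist w z : `|cmod w - cmod z| <= cmod (w - z).
Proof.
rewrite ler_norml; apply/andP; split.
  by rewrite lerNl opprB lerBlDr cmodB -{1}(subrK w z) cmodD.
by rewrite lerBlDr -{1}(subrK z w) cmodD.
Qed.
Lemma Re_le_cmod w : `|complex.Re w| <= cmod w.
Proof. by rewrite -sqrtr_sqr ler_wsqrtr // lerDl sqr_ge0. Qed.
Lemma Im_le_cmod w : `|complex.Im w| <= cmod w.
Proof. by rewrite -sqrtr_sqr ler_wsqrtr // lerDr sqr_ge0. Qed.
Lemma cmod_le w : cmod w <= `|complex.Re w| + `|complex.Im w|.
Proof.
rewrite -[leRHS]ger0_norm ?addr_ge0// -sqrtr_sqr ler_wsqrtr //.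
rewrite sqrrD !real_normK ?num_real//.
by rewrite addrAC lerDl mulrn_wge0// mulr_ge0.
Qed.
Lemma cmod_sum (I : Type) (r : seq I) (F : I -> R[i]) :
  cmod (\sum_(i <- r) F i) <= \sum_(i <- r) cmod (F i).
Proof.
elim/big_ind2: _ => //; first by rewrite cmod0.
by move=> a b c d ab cd; rewrite (le_trans (cmodD _ _)) ?lerD.
Qed.
Lemma ReD w z : complex.Re (w + z) = complex.Re w + complex.Re z.
Proof. by case: w z => [? ?] [? ?]. Qed.
Lemma ImD w z : complex.Im (w + z) = complex.Im w + complex.Im z.
Proof. by case: w z => [? ?] [? ?]. Qed.
Lemma ReN w : complex.Re (- w) = - complex.Re w.
Proof. by case: w. Qed.
Lemma ImN w : complex.Im (- w) = - complex.Im w.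
Proof. by case: w. Qed.
Lemma cmod_sqr w : cmod w ^+ 2 = complex.Re w ^+ 2 + complex.Im w ^+ 2.
Proof. by rewrite sqr_sqrtr// addr_ge0 ?sqr_ge0. Qed.
End ComplexModulus.

Section VectorNorm.
Context {R : realType} {N : nat}.
Implicit Types (u v z : cvec R N).

Definition vsub z v : cvec R N := fun i => z i - v i.
Definition vzero : cvec R N := fun=> 0.
Definition cscale (l : R[i]) z : cvec R N := fun i => l * z i.

Lemma vnorm_ge0 z : 0 <= vnorm z. Proof. exact: sqrtr_ge0. Qed.
Lemma vnorm_sqr z : vnorm z ^+ 2 = \sum_(i < N) cmod (z i) ^+ 2.
Proof. by rewrite sqr_sqrtr// sumr_ge0// => i _; rewrite sqr_ge0. Qed.
Lemma cmod_le_vnorm z i : cmod (z i) <= vnorm z.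
Proof.
rewrite -(@ler_pXn2r _ 2)// ?nnegrE ?cmod_ge0 ?vnorm_ge0//.
rewrite vnorm_sqr (bigD1 i)//= lerDl sumr_ge0// => j _; exact: sqr_ge0.
Qed.
Lemma vnorm_eq0 z : vnorm z = 0 -> z = vzero.
Proof.
move=> z0; apply/funext => i; apply: cmod_eq0; apply/eqP.
by rewrite eq_le cmod_ge0 andbT -z0 cmod_le_vnorm.
Qed.
Lemma vnorm_cscale l z : vnorm (cscale l z) = cmod l * vnorm z.
Proof.
rewrite {1}/vnorm (_ : \sum_i _ = cmod l ^+ 2 * \sum_(i < N) cmod (z i) ^+ 2).
  by rewrite sqrtrM ?sqr_ge0// sqrtr_sqr ger0_norm ?cmod_ge0.
by rewrite mulr_sumr; apply: eq_bigr => i _; rewrite cmodM exprMn.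
Qed.
Lemma vscaleE (r : R) z : vscale r z = cscale (Complex r 0) z.
Proof. by []. Qed.
Lemma vnorm_vscale (r : R) z : vnorm (vscale r z) = `|r| * vnorm z.
Proof. by rewrite vscaleE vnorm_cscale cmodr. Qed.
(** Cauchy-Schwarz, by summing the weighted arithmetic-geometric inequality [h] with weights [B / A]
    and [A / B]; if [A] or [B] is 0, all the products vanish. *)
Lemma sum_mul_le (x y : 'I_N -> R) :
  \sum_i x i * y i <= Num.sqrt (\sum_i x i ^+ 2) * Num.sqrt (\sum_i y i ^+ 2).
Proof.
set A := Num.sqrt (\sum_i x i ^+ 2); set B := Num.sqrt (\sum_i y i ^+ 2).
have s0 (f : 'I_N -> R) : 0 <= \sum_i f i ^+ 2.
  by rewrite sumr_ge0// => i _; exact: sqr_ge0.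
have A2 : A ^+ 2 = \sum_i x i ^+ 2 by rewrite sqr_sqrtr.
have B2 : B ^+ 2 = \sum_i y i ^+ 2 by rewrite sqr_sqrtr.
have zero (f g : 'I_N -> R) : Num.sqrt (\sum_i f i ^+ 2) = 0 -> \sum_i f i * g i = 0.
  move/eqP; rewrite sqrtr_eq0 => f0.
  have /eqP : \sum_i f i ^+ 2 = 0 by apply/eqP; rewrite eq_le f0 s0.
  rewrite psumr_eq0; last by move=> i _; exact: sqr_ge0.
  move=> /allP h; rewrite big1// => i _.
  have := h i (mem_index_enum _); rewrite sqrf_eq0 => /eqP ->.
  by rewrite mul0r.
have [A0|A0] := eqVneq A 0; first by rewrite zero// A0 mul0r.
have [B0|B0] := eqVneq B 0.
  under eq_bigr do rewrite mulrC.
  by rewrite zero// B0 mulr0.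
have Ap : 0 < A by rewrite lt_neqAle eq_sym A0 sqrtr_ge0.
have Bp : 0 < B by rewrite lt_neqAle eq_sym B0 sqrtr_ge0.
have h i : x i * y i <= (B / A * x i ^+ 2 + A / B * y i ^+ 2) / 2.
  have := sqr_ge0 (B * x i - A * y i) => h.
  rewrite -(@ler_pM2l _ (2 * A * B)) ?mulr_gt0//.
  have -> : 2 * A * B * ((B / A * x i ^+ 2 + A / B * y i ^+ 2) / 2) =
    (B * x i) ^+ 2 + (A * y i) ^+ 2 by field; rewrite A0 B0.
  nra.
apply: (le_trans (ler_sum _ (fun i _ => h i))).
rewrite -mulr_suml big_split/= -!mulr_sumr -A2 -B2.
by rewrite le_eqVlt; apply/orP; left; apply/eqP; field; rewrite A0 B0.
Qed.
Lemma vnorm_vadd u v : vnorm (vadd u v) <= vnorm u + vnorm v.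
Proof.
rewrite -(@ler_pXn2r _ 2)// ?nnegrE ?addr_ge0 ?vnorm_ge0//.
rewrite sqrrD !vnorm_sqr.
apply: (@le_trans _ _ (\sum_i (cmod (u i) ^+ 2 + cmod (u i) * cmod (v i) *+ 2 + cmod (v i) ^+ 2))).
  apply: ler_sum => i _; rewrite -sqrrD ler_pXn2r ?nnegrE ?addr_ge0 ?cmod_ge0//.
  exact: cmodD.
rewrite big_split/= lerD2r big_split/= lerD2l sumrMnl lerMn2r/=; exact: sum_mul_le.
Qed.
Lemma vnorm_vsubC u v : vnorm (vsub u v) = vnorm (vsub v u).
Proof. by congr Num.sqrt; apply: eq_bigr => i _; rewrite /vsub cmodB. Qed.
Lemma vadd_vsub u v : vadd u (vsub v u) = v.
Proof. by apply/funext => i; rewrite /vadd /vsub addrC subrK. Qed.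
Lemma vsub_vadd u v : vsub (vadd u v) u = v.
Proof. by apply/funext => i; rewrite /vadd /vsub addrAC subrr add0r. Qed.
Lemma vnorm_le_vsub u v : vnorm u <= vnorm v + vnorm (vsub u v).
Proof. by rewrite -{1}(vadd_vsub v u) vnorm_vadd. Qed.
Lemma vnorm_dist u v : `|vnorm u - vnorm v| <= vnorm (vsub u v).
Proof.
rewrite ler_norml; apply/andP; split.
  by rewrite lerNl opprB lerBlDr vnorm_vsubC addrC vnorm_le_vsub.
by rewrite lerBlDr addrC vnorm_le_vsub.
Qed.
Lemma vnorm_le_sum z : vnorm z <= \sum_i cmod (z i).
Proof.
have s0 (P : pred 'I_N) : 0 <= \sum_(i | P i) cmod (z i).
  by rewrite sumr_ge0// => i _; exact: cmod_ge0.
rewrite -(@ler_pXn2r _ 2)// ?nnegrE ?vnorm_ge0// vnorm_sqr expr2 mulr_suml.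
apply: ler_sum => i _; rewrite expr2 ler_wpM2l ?cmod_ge0//.
by rewrite (bigD1 i)//= lerDl.
Qed.
Lemma cmod_dot_le (a : 'I_N -> R[i]) z :
  cmod (\sum_k a k * z k) <= (\sum_k cmod (a k)) * vnorm z.
Proof.
apply: (le_trans (cmod_sum _ _)); rewrite mulr_suml; apply: ler_sum => k _.
by rewrite cmodM ler_wpM2l ?cmod_ge0// cmod_le_vnorm.
Qed.
Lemma vnorm_vzero : vnorm vzero = 0.
Proof. by rewrite /vnorm big1 ?sqrtr0// => i _; rewrite cmod0 expr0n. Qed.
End VectorNorm.

(** * Cauchy's theorem on rectangles *)

Section SegmentIntegral.
Context {R : realType}.
Implicit Types (g h : R -> R) (a b c d m x y : R).

Definition seg g a b : R := \int[@lebesgue_measure R]_(x in `[a, b]) g x.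

(** [y] ranges over the whole line, so continuity is two-sided at the endpoints as well. *)
Definition cts_on g a b := forall x, a <= x <= b ->
  forall e, 0 < e -> exists2 d, 0 < d & forall y, `|y - x| < d -> `|g y - g x| < e.

Lemma cts_on_within g a b : cts_on g a b -> {within `[a, b], continuous g}.
Proof.
move=> h; apply: continuous_in_subspaceT => x; rewrite inE/= in_itv/= => xab.
apply/cvgrPdist_lt => e e0; have [d d0 hd] := h x xab e e0.
exists d => //= y yd.
by rewrite distrC; apply: hd; rewrite distrC.
Qed.

Lemma seg_integrable g a b : cts_on g a b ->
  (@lebesgue_measure R).-integrable `[a, b] (EFin \o g).
Proof.
move=> /cts_on_within h; apply: continuous_compact_integrable => //.
exact: segment_compact.
Qed.

Lemma seg_cst r a b : a <= b -> seg (fun=> r) a b = r * (b - a).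
Proof.
move=> ab; rewrite /seg Rintegral_cst//= lebesgue_measure_itv/= lte_fin.
by case: ltP => // ba; rewrite (_ : b = a) ?subrr//; apply/eqP; rewrite eq_le ab ba.
Qed.

Lemma cts_on_cst r a b : cts_on (fun=> r) a b.
Proof. by move=> x _ e e0; exists 1 => // y _; rewrite subrr normr0. Qed.

Lemma cts_onD g h a b : cts_on g a b -> cts_on h a b -> cts_on (fun x => g x + h x) a b.
Proof.
move=> gc hc x xab e e0; have e2 : 0 < e / 2 by lra.
have [d1 d10 h1] := gc x xab _ e2; have [d2 d20 h2] := hc x xab _ e2.
exists (Num.min d1 d2); first by rewrite lt_min d10.
move=> y; rewrite lt_min => /andP[/h1 l1 /h2 l2].
by rewrite opprD addrACA (le_lt_trans (ler_normD _ _))//; lra.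
Qed.

Lemma cts_onN g a b : cts_on g a b -> cts_on (fun x => - g x) a b.
Proof.
move=> gc x xab e e0; have [d d0 h] := gc x xab e e0; exists d => // y /h.
by rewrite -opprD normrN.
Qed.

Lemma cts_onB g h a b : cts_on g a b -> cts_on h a b -> cts_on (fun x => g x - h x) a b.
Proof. by move=> gc hc; apply: cts_onD => //; exact: cts_onN. Qed.

Lemma seg_split g a m b : a <= m <= b -> cts_on g a b ->
  seg g a b = seg g a m + seg g m b.
Proof.
move=> /andP[am mb] gc; rewrite /seg.
have := @Rintegral_itvB R g (BLeft a) (BRight b) m (seg_integrable gc).
rewrite !bnd_simp => /(_ am mb).
rewrite Rintegral_itv_obnd_cbnd; last first.
  apply: integrableS (seg_integrable gc) => //.
  by apply: subset_itvr; rewrite bnd_simp.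
by move=> <-; rewrite addrC subrK.
Qed.

Lemma segD g h a b : cts_on g a b -> cts_on h a b ->
  seg (fun x => g x + h x) a b = seg g a b + seg h a b.
Proof. by move=> gc hc; rewrite /seg RintegralD//; exact: seg_integrable. Qed.

Lemma segB g h a b : cts_on g a b -> cts_on h a b ->
  seg (fun x => g x - h x) a b = seg g a b - seg h a b.
Proof. by move=> gc hc; rewrite /seg RintegralB//; exact: seg_integrable. Qed.

Lemma segZ k g a b : cts_on g a b -> seg (fun x => k * g x) a b = k * seg g a b.
Proof. by move=> gc; rewrite /seg RintegralZl//; exact: seg_integrable. Qed.

Lemma seg_le g h a b : cts_on g a b -> cts_on h a b ->
  (forall x, a <= x <= b -> g x <= h x) -> seg g a b <= seg h a b.
Proof.
move=> gc hc gh; apply: le_Rintegral => //; try exact: seg_integrable.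
Qed.

Lemma eq_seg g h a b : (forall x, a <= x <= b -> g x = h x) -> seg g a b = seg h a b.
Proof.
by move=> gh; apply: eq_Rintegral => x; rewrite inE/= in_itv/=; exact: gh.
Qed.

Lemma seg_abs g a b M : a <= b -> cts_on g a b ->
  (forall x, a <= x <= b -> `|g x| <= M) -> `|seg g a b| <= M * (b - a).
Proof.
move=> ab gc gM; rewrite ler_norml -mulNr -!(seg_cst _ ab).
by apply/andP; split; apply: seg_le => //; try exact: cts_on_cst;
  move=> x /gM; rewrite ler_norml => /andP[].
Qed.
End SegmentIntegral.

Section Rectangles.
Context {R : realType}.
Implicit Types (F G : R[i] -> R[i]) (w z : R[i]) (a b c d m x y : R).

Definition in_rect a b c d w :=
  (a <= complex.Re w <= b) /\ (c <= complex.Im w <= d).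

Definition ccont F z := forall e : R, 0 < e -> exists2 d, 0 < d &
  forall w, cmod (w - z) < d -> cmod (F w - F z) < e.

Definition cdiff F z := exists A : R[i], forall e : R, 0 < e -> exists2 d, 0 < d &
  forall w, cmod (w - z) < d -> cmod (F w - F z - A * (w - z)) <= e * cmod (w - z).

Lemma cdiff_cont F z : cdiff F z -> ccont F z.
Proof.
case=> A hA e e0; have [d d0 h] := hA 1 ltr01.
have k0 : 0 < 1 + cmod A by rewrite ltr_pwDl ?cmod_ge0.
exists (Num.min d (e / (1 + cmod A))); first by rewrite lt_min d0 divr_gt0.
move=> w; rewrite lt_min ltr_pdivlMr// => /andP[/h l1 l2].
have -> : F w - F z = (F w - F z - A * (w - z)) + A * (w - z) by rewrite subrK.
rewrite (le_lt_trans (cmodD _ _))// (le_lt_trans _ l2)// cmodM; lra.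
Qed.

(** [dz] is [dx] on a horizontal side and ['i dy] on a vertical one, so the real part of [F dz] is
    [Re F dx] on the former and [- Im F dy] on the latter. *)
Definition horz F c x := complex.Re (F (Complex x c)).
Definition vert F a y := complex.Im (F (Complex a y)).

(* Real part of the integral of F over the boundary of the rectangle
   [a, b] x [c, d]; the imaginary part is that of [- 'i F]. *)
Definition bdint F a b c d : R :=
  seg (fun x => horz F c x - horz F d x) a b -
  seg (fun y => vert F b y - vert F a y) c d.

Lemma cts_horz F a b c : (forall x, a <= x <= b -> ccont F (Complex x c)) ->
  cts_on (horz F c) a b.
Proof.
move=> h x xab e e0; have [d d0 hd] := h x xab e e0; exists d => // y yd.
have := hd (Complex y c); rewrite /= (_ : _ - _ = Complex (y - x) 0) ?cmodr.
  by move=> /(_ yd); apply: le_lt_trans; rewrite /horz -ReN -ReD Re_le_cmod.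
by congr Complex; rewrite subrr.
Qed.

Lemma cts_vert F a c d : (forall y, c <= y <= d -> ccont F (Complex a y)) ->
  cts_on (vert F a) c d.
Proof.
move=> h x xab e e0; have [r r0 hr] := h x xab e e0; exists r => // y yd.
have := hr (Complex a y); rewrite /= (_ : _ - _ = Complex 0 (y - x)).
  rewrite {1}/cmod/= expr0n add0r sqrtr_sqr => /(_ yd); apply: le_lt_trans.
  by rewrite /vert -ImN -ImD Im_le_cmod.
by congr Complex; rewrite subrr.
Qed.

Definition cont_rect F a b c d := forall z, in_rect a b c d z -> ccont F z.

Lemma cont_rectS F a b c d a' b' c' d' : cont_rect F a b c d ->
  a <= a' -> b' <= b -> c <= c' -> d' <= d -> cont_rect F a' b' c' d'.
Proof. by move=> h ? ? ? ? z [/andP[? ?] /andP[? ?]]; apply: h; split; lra. Qed.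

Lemma cont_horz F a b c d y : cont_rect F a b c d -> c <= y <= d ->
  cts_on (horz F y) a b.
Proof. by move=> h ycd; apply: cts_horz => x xab; apply: h. Qed.

Lemma cont_vert F a b c d x : cont_rect F a b c d -> a <= x <= b ->
  cts_on (vert F x) c d.
Proof. by move=> h xab; apply: cts_vert => y ycd; apply: h. Qed.

Lemma bdint_splitx F a m b c d : a <= m <= b -> c <= d -> cont_rect F a b c d ->
  bdint F a b c d = bdint F a m c d + bdint F m b c d.
Proof.
move=> amb cd Fc; have /andP[am mb] := amb.
have ch y := @cont_horz F a b c d y Fc; have cv x := @cont_vert F a b c d x Fc.
rewrite /bdint (seg_split amb); last by apply: cts_onB; apply: ch; lra.
rewrite !(@segB _ (vert F _)); try (apply: cv; lra).
lra.
Qed.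

Lemma bdint_splity F a b c m d : c <= m <= d -> a <= b -> cont_rect F a b c d ->
  bdint F a b c d = bdint F a b c m + bdint F a b m d.
Proof.
move=> cmd ab Fc; have /andP[cm md] := cmd.
have ch y := @cont_horz F a b c d y Fc; have cv x := @cont_vert F a b c d x Fc.
rewrite /bdint (seg_split cmd); last by apply: cts_onB; apply: cv; lra.
rewrite !(@segB _ (horz F _)); try (apply: ch; lra).
lra.
Qed.

Definition on_bdry a b c d z := in_rect a b c d z /\
  [\/ complex.Re z = a, complex.Re z = b, complex.Im z = c | complex.Im z = d].

Definition cont_bdry F a b c d := forall z, on_bdry a b c d z -> ccont F z.

Lemma cont_rect_bdry F a b c d : cont_rect F a b c d -> cont_bdry F a b c d.
Proof. by move=> h z [zr _]; exact: h. Qed.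

Lemma bdry_sides F a b c d : a <= b -> c <= d -> cont_bdry F a b c d ->
  [/\ cts_on (horz F c) a b, cts_on (horz F d) a b,
      cts_on (vert F a) c d & cts_on (vert F b) c d].
Proof.
move=> ab cd Fc; split.
- by apply: cts_horz => x xab; apply: Fc; split; [split => //=; lra|exact: Or43].
- by apply: cts_horz => x xab; apply: Fc; split; [split => //=; lra|exact: Or44].
- by apply: cts_vert => x xab; apply: Fc; split; [split => //=; lra|exact: Or41].
- by apply: cts_vert => x xab; apply: Fc; split; [split => //=; lra|exact: Or42].
Qed.

Lemma eq_bdint F G a b c d : a <= b -> c <= d ->
  (forall z, on_bdry a b c d z -> F z = G z) -> bdint F a b c d = bdint G a b c d.
Proof.
move=> ab cd FG; congr (_ - _); apply: eq_seg => x xab; rewrite /horz /vert !FG//.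
- by split; [split => //=; lra|exact: Or44].
- by split; [split => //=; lra|exact: Or43].
- by split; [split => //=; lra|exact: Or41].
- by split; [split => //=; lra|exact: Or42].
Qed.

Lemma bdintB F G a b c d : a <= b -> c <= d ->
  cont_bdry F a b c d -> cont_bdry G a b c d ->
  bdint (fun w => F w - G w) a b c d = bdint F a b c d - bdint G a b c d.
Proof.
move=> ab cd Fc Gc.
have [f1 f2 f3 f4] := bdry_sides ab cd Fc; have [g1 g2 g3 g4] := bdry_sides ab cd Gc.
rewrite /bdint.
rewrite (@eq_seg _ _ (fun x => (horz F c x - horz F d x) - (horz G c x - horz G d x))); last first.
  by move=> x _; rewrite /horz !ReD !ReN; ring.
rewrite (@eq_seg _ _ (fun x => (vert F b x - vert F a x) - (vert G b x - vert G a x)) c d); last first.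
  by move=> x _; rewrite /vert !ImD !ImN; ring.
by rewrite segB ?(@segB _ _ (fun y => vert G b y - vert G a y)); first ring;
  apply: cts_onB.
Qed.

Lemma bdintZ F (k : R) a b c d : a <= b -> c <= d -> cont_bdry F a b c d ->
  bdint (fun w => Complex k 0 * F w) a b c d = k * bdint F a b c d.
Proof.
move=> ab cd Fc; have [f1 f2 f3 f4] := bdry_sides ab cd Fc.
rewrite /bdint mulrBr -!segZ; try exact: cts_onB.
congr (_ - _); apply: eq_seg => x _; rewrite /horz /vert.
- by case: (F _) => ? ?; case: (F _) => ? ? /=; ring.
- by case: (F _) => ? ?; case: (F _) => ? ? /=; ring.
Qed.

(** Opposite sides differ by a translation, so both integrands are constant for an affine function,
    and the two contributions cancel. *)
Lemma bdint_affine (A B : R[i]) a b c d : a <= b -> c <= d ->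
  bdint (fun w => A + B * w) a b c d = 0.
Proof.
move=> ab cd; rewrite /bdint.
rewrite (@eq_seg _ _ (fun=> - complex.Im B * (c - d))); last first.
  by move=> x _; rewrite /horz; case: A B => [? ?] [? ?]/=; ring.
rewrite (@eq_seg _ _ (fun=> complex.Im B * (b - a)) c d); last first.
  by move=> x _; rewrite /vert; case: A B => [? ?] [? ?]/=; ring.
by rewrite !seg_cst//; ring.
Qed.

Lemma bdint_bound F a b c d M : a <= b -> c <= d -> cont_bdry F a b c d ->
  (forall z, on_bdry a b c d z -> cmod (F z) <= M) ->
  `|bdint F a b c d| <= 2 * M * ((b - a) + (d - c)).
Proof.
move=> ab cd Fc FM; have [f1 f2 f3 f4] := bdry_sides ab cd Fc.
rewrite mulrDr (le_trans (ler_normB _ _))// lerD//; apply: seg_abs => //.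
- exact: cts_onB.
- move=> x xab; rewrite (le_trans (ler_normB _ _))// mulr2n mulrDl mul1r.
  apply: lerD; rewrite (le_trans (Re_le_cmod _))// FM//; split; try (split => //=; lra).
    exact: Or43.
  exact: Or44.
- exact: cts_onB.
- move=> x xab; rewrite (le_trans (ler_normB _ _))// mulr2n mulrDl mul1r.
  apply: lerD; rewrite (le_trans (Im_le_cmod _))// FM//; split; try (split => //=; lra).
    exact: Or42.
  exact: Or41.
Qed.
End Rectangles.

(** * Goursat's theorem and removable singularities *)

Section Goursat.
Context {R : realType}.
Implicit Types (F G : R[i] -> R[i]) (w z l : R[i]) (a b c d m x y : R).

Lemma exp2_small (L e : R) : 0 < e -> exists n, L / 2 ^+ n < e.
Proof.
move=> e0; have [n hn] : exists n, `|L| / e < n%:R by exists (Num.truncn (`|L| / e)).+1; exact: truncnS_gt.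
exists n; rewrite ltr_pdivrMr ?exprn_gt0// (le_lt_trans (ler_norm L))//.
move: hn; rewrite ltr_pdivrMr// => /lt_le_trans; apply.
rewrite mulrC ler_pM2l// -natrX ler_nat ltnW// ltn_expl//.
Qed.

(* Cousin's lemma for rectangles, by repeated quartering. *)
Lemma rect_cousin (Q : R -> R -> R -> R -> Prop) a0 b0 c0 d0 :
  a0 <= b0 -> c0 <= d0 ->
  (forall a b c d, a0 <= a -> a <= b -> b <= b0 -> c0 <= c -> c <= d -> d <= d0 ->
     Q a ((a + b) / 2) c ((c + d) / 2) -> Q ((a + b) / 2) b c ((c + d) / 2) ->
     Q a ((a + b) / 2) ((c + d) / 2) d -> Q ((a + b) / 2) b ((c + d) / 2) d ->
     Q a b c d) ->
  (forall x y, a0 <= x <= b0 -> c0 <= y <= d0 -> exists2 r, 0 < r &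
     forall a b c d, a0 <= a -> a <= x <= b -> b <= b0 ->
       c0 <= c -> c <= y <= d -> d <= d0 -> b - a < r -> d - c < r -> Q a b c d) ->
  Q a0 b0 c0 d0.
Proof.
move=> ab0 cd0 split local; apply: contrapT => nQ.
pose q (p : R * R * R * R) := let: (a, b, c, d) := p in Q a b c d.
(* The next rectangle is the first quarter on which [Q] fails. If [Q] holds on three quarters, the
   fourth is taken by default, and [split] shows that [Q] fails there. *)
pose nxt (p : R * R * R * R) : R * R * R * R := let: (a, b, c, d) := p in
  if ~~ `[< Q a ((a + b) / 2) c ((c + d) / 2) >] then (a, (a + b) / 2, c, (c + d) / 2)
  else if ~~ `[< Q ((a + b) / 2) b c ((c + d) / 2) >] then ((a + b) / 2, b, c, (c + d) / 2)
  else if ~~ `[< Q a ((a + b) / 2) ((c + d) / 2) d >] then (a, (a + b) / 2, (c + d) / 2, d)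
  else ((a + b) / 2, b, (c + d) / 2, d).
pose p n := iter n nxt (a0, b0, c0, d0).
pose pa n := (p n).1.1.1; pose pb n := (p n).1.1.2.
pose pc n := (p n).1.2; pose pd n := (p n).2.
have pE n : p n = (pa n, pb n, pc n, pd n).
  by rewrite /pa /pb /pc /pd; case: (p n) => [[[? ?] ?] ?].
have mid a b c d : a <= b -> c <= d ->
    [/\ a <= (a + b) / 2, (a + b) / 2 <= b, c <= (c + d) / 2 & (c + d) / 2 <= d].
  by clear => ab cd; split; lra.
have inv n : [/\ a0 <= pa n, pa n <= pb n, pb n <= b0 & [/\ c0 <= pc n, pc n <= pd n, pd n <= d0 & ~ Q (pa n) (pb n) (pc n) (pd n)]].
  elim: n => [|n [h1 h2 h3 [h4 h5 h6 h7]]]; first by [].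
  rewrite /pa /pb /pc /pd /p iterS -/(p n) pE /=.
  move: (pa n) (pb n) (pc n) (pd n) h1 h2 h3 h4 h5 h6 h7 => a b c d h1 h2 h3 h4 h5 h6 h7.
  have [m1 m2 m3 m4] := mid _ _ _ _ h2 h5.
  have [n1 n2] := (le_trans h1 m1, le_trans m2 h3).
  have [n3 n4] := (le_trans h4 m3, le_trans m4 h6).
  case: asboolP => q1 /=; last by split.
  case: asboolP => q2 /=; last by split.
  case: asboolP => q3 /=; last by split.
  by split => //; split => // q4; apply: h7; exact: split.
have half (u v : R) : (u + v) / 2 - u = (v - u) / 2 /\ v - (u + v) / 2 = (v - u) / 2 by clear; split; lra.
have nxtP a b c d : a <= b -> c <= d -> let: (a', b', c', d') := nxt (a, b, c, d) in
    [/\ a <= a', b' <= b, c <= c' & [/\ d' <= d,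
    b' - a' = (b - a) / 2 & d' - c' = (d - c) / 2]].
  move=> ab cd; have [m1 m2 m3 m4] := mid _ _ _ _ ab cd.
  have [[e1 e2] [e3 e4]] := (half a b, half c d).
  rewrite /nxt; case: asboolP => q1 /=; last by split.
  case: asboolP => q2 /=; last by split.
  by case: asboolP => q3 /=; split.
have step n : [/\ pa n <= pa n.+1, pb n.+1 <= pb n, pc n <= pc n.+1 & [/\ pd n.+1 <= pd n,
    pb n.+1 - pa n.+1 = (pb n - pa n) / 2 & pd n.+1 - pc n.+1 = (pd n - pc n) / 2]].
  have [h1 h2 h3 [h4 h5 h6 h7]] := inv n.
  have := nxtP (pa n) (pb n) (pc n) (pd n) h2 h5.
  by rewrite -pE -[nxt (p n)]/(p n.+1) (pE n.+1).
have len n : pb n - pa n = (b0 - a0) / 2 ^+ n /\ pd n - pc n = (d0 - c0) / 2 ^+ n.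
  elim: n => [|n [l1 l2]]; first by rewrite expr0 !divr1.
  have [_ _ _ [_ -> ->]] := step n; rewrite l1 l2 exprS; split; field;
  by rewrite expf_neq0//; lra.
have mono (u : nat -> R) : (forall n, u n <= u n.+1) -> forall i j : nat, (i <= j)%N -> u i <= u j.
  move=> hu i j ij; rewrite -(subnKC ij); elim: (j - i)%N => [|k IH]; first by rewrite addn0.
  by rewrite addnS (le_trans IH).
have lim (u v : nat -> R) : (forall n, u n <= u n.+1) -> (forall n, v n.+1 <= v n) ->
    (forall n, u n <= v n) -> exists x, forall n, u n <= x <= v n.
  move=> hu hv huv; exists (sup (range u)) => n.
  have uv (i k : nat) : u i <= v k.
    apply: (@le_trans _ _ (u (maxn i k))); first by apply: mono => //; exact: leq_maxl.
    apply: (le_trans (huv _)); rewrite -lerN2.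
    apply: (mono (fun n => - v n)); last exact: leq_maxr.
    by move=> j; rewrite lerN2.
  apply/andP; split.
    apply: ub_le_sup; last by exists n.
    by exists (v 0) => _ [k _ <-].
  apply: ge_sup; first by exists (u 0), 0.
  by move=> _ [k _ <-].
have [x hx] := lim pa pb (fun n => let: And4 h _ _ _ := step n in h)
  (fun n => let: And4 _ h _ _ := step n in h) (fun n => let: And4 _ h _ _ := inv n in h).
have [y hy] := lim pc pd (fun n => let: And4 _ _ h _ := step n in h)
  (fun n => let: And4 _ _ _ (And3 h _ _) := step n in h)
  (fun n => let: And4 _ _ _ (And4 _ h _ _) := inv n in h).
have [||r r0 hr] := local x y; [exact: (hx 0%N)|exact: (hy 0%N)|].
have [n hn] := exp2_small ((b0 - a0) + (d0 - c0)) r0.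
have [h1 h2 h3 [h4 h5 h6 h7]] := inv n; have [l1 l2] := len n.
apply: h7; apply: hr => //.
- by rewrite l1 (le_lt_trans _ hn)// ler_pM2r ?invr_gt0 ?exprn_gt0//; lra.
- by rewrite l2 (le_lt_trans _ hn)// ler_pM2r ?invr_gt0 ?exprn_gt0//; lra.
Qed.

Definition diff_rect F a b c d := forall z, in_rect a b c d z -> cdiff F z.

Lemma diff_rect_cont F a b c d : diff_rect F a b c d -> cont_rect F a b c d.
Proof. by move=> h z /h /cdiff_cont. Qed.

Lemma ccont_affine (A B : R[i]) z : ccont (fun w => A + B * w) z.
Proof.
apply: cdiff_cont; exists B => e e0; exists 1 => // w _.
rewrite (_ : _ - _ = 0); last by ring.
by rewrite cmod0 mulr_ge0 ?cmod_ge0 ?ltW.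
Qed.

Lemma ccontB F G z : ccont F z -> ccont G z -> ccont (fun w => F w - G w) z.
Proof.
move=> Fc Gc e e0; have e2 : 0 < e / 2 by lra.
have [d1 d10 h1] := Fc _ e2; have [d2 d20 h2] := Gc _ e2.
exists (Num.min d1 d2); first by rewrite lt_min d10.
move=> w; rewrite lt_min => /andP[/h1 l1 /h2 l2].
have -> : F w - G w - (F z - G z) = (F w - F z) - (G w - G z) by ring.
by rewrite (le_lt_trans (cmodD _ _))// cmodN; lra.
Qed.

(** A bound by a multiple of the squared half perimeter survives quartering, since four quarters
    with half the perimeter add up exactly. On small rectangles it comes from differentiability: the
    affine part integrates to 0, and the remainder is small relative to the diameter. *)
Lemma goursat F a b c d : a <= b -> c <= d -> diff_rect F a b c d ->
  bdint F a b c d = 0.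
Proof.
move=> ab cd Fd; have Fc := diff_rect_cont Fd.
apply/eqP; rewrite -normr_eq0 eq_le normr_ge0 andbT.
apply/ler_addgt0Pl => e e0; rewrite addr0.
(* The [+ 1] keeps [K] positive when the rectangle is a single point. *)
pose K := ((b - a) + (d - c)) ^+ 2 + 1.
have K0 : 0 < K by rewrite /K ltr_wpDl ?sqr_ge0.
suff : `|bdint F a b c d| <= e / K * ((b - a) + (d - c)) ^+ 2.
  move/le_trans; apply; rewrite mulrAC ler_pdivrMr// ler_pM2l//; rewrite /K; lra.
have eK : 0 < e / K by rewrite divr_gt0.
apply: (@rect_cousin (fun a b c d => `|bdint F a b c d| <= e / K * ((b - a) + (d - c)) ^+ 2)) => //.
  move=> a' b' c' d' h1 h2 h3 h4 h5 h6.
  have Fc' : cont_rect F a' b' c' d' by apply: cont_rectS Fc _ _ _ _.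
  rewrite (@bdint_splitx _ F a' ((a' + b') / 2) b')//; [|lra].
  rewrite (@bdint_splity _ F a' ((a' + b') / 2) c' ((c' + d') / 2) d'); [|lra|lra|by apply: cont_rectS Fc' _ _ _ _ => //; lra].
  rewrite (@bdint_splity _ F ((a' + b') / 2) b' c' ((c' + d') / 2) d'); [|lra|lra|by apply: cont_rectS Fc' _ _ _ _ => //; lra].
  set P1 := bdint _ _ _ _ _; set P2 := bdint _ _ _ _ _; set P3 := bdint _ _ _ _ _; set P4 := bdint _ _ _ _ _.
  have e1 : (a' + b') / 2 - a' = (b' - a') / 2 by field.
  have e2 : b' - (a' + b') / 2 = (b' - a') / 2 by field.
  have e3 : (c' + d') / 2 - c' = (d' - c') / 2 by field.
  have e4 : d' - (c' + d') / 2 = (d' - c') / 2 by field.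
  rewrite !(e1, e2, e3, e4) => q1 q2 q3 q4.
  apply: (@le_trans _ _ (`|P1| + `|P2| + (`|P3| + `|P4|))).
    by rewrite addrACA (le_trans (ler_normD _ _))// lerD// ler_normD.
  have -> : e / K * (b' - a' + (d' - c')) ^+ 2 = 4 * (e / K * ((b' - a') / 2 + (d' - c') / 2) ^+ 2) by field; rewrite lt0r_neq0.
  rewrite -/P1 -/P2 -/P3 -/P4 in q1 q2 q3 q4; lra.
move=> x y hx hy; pose z := Complex x y.
have [A hA] := Fd z (conj hx hy); have e2 : 0 < e / K / 2 by lra.
have [r r0 hr] := hA _ e2; exists (r / 2); first lra.
move=> a' b' c' d' h1 h2 h3 h4 h5 h6 h7 h8.
have Fc' : cont_rect F a' b' c' d' by apply: cont_rectS Fc _ _ _ _.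
have -> : bdint F a' b' c' d' = bdint (fun w => F w - ((F z - A * z) + A * w)) a' b' c' d'.
  rewrite bdintB//; try lra; last 2 first.
  - exact: cont_rect_bdry.
  - by move=> w _; exact: ccont_affine.
  by rewrite bdint_affine ?subr0//; lra.
have -> : e / K * (b' - a' + (d' - c')) ^+ 2 = 2 * (e / K / 2 * (b' - a' + (d' - c'))) * (b' - a' + (d' - c')).
  by field; rewrite lt0r_neq0.
apply: bdint_bound; try lra.
  by move=> w [/Fc' Fw _]; apply: ccontB => //; exact: ccont_affine.
move=> w [[/andP[w1 w2] /andP[w3 w4]] _].
have wz : cmod (w - z) <= (b' - a') + (d' - c').
  rewrite (le_trans (cmod_le _))// lerD// ?ReD ?ReN ?ImD ?ImN /= ler_norml; apply/andP; split; lra.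
have -> : F w - (F z - A * z + A * w) = F w - F z - A * (w - z) by ring.
apply: le_trans (hr w _) _; first by rewrite (le_lt_trans wz)//; lra.
by rewrite ler_pM2l.
Qed.

(** Goursat's theorem removes the four strips around a square of side [s] centred at [l]; over the
    square the integral is at most [4 * M * s]. *)
Lemma bdint_puncture F l M r a b c d : 0 < r -> 0 <= M ->
  a < complex.Re l < b -> c < complex.Im l < d ->
  (forall z, in_rect a b c d z -> z != l -> cdiff F z) ->
  (forall z, in_rect a b c d z -> z != l -> cmod (z - l) < r -> cmod (F z) <= M) ->
  ccont F l ->
  bdint F a b c d = 0.
Proof.
move=> r0 M0 al cl Fd FM Flc.
have Fc : cont_rect F a b c d.
  move=> z zr; have [->//|zl] := eqVneq z l; exact/cdiff_cont/Fd.
apply/eqP; rewrite -normr_eq0 eq_le normr_ge0 andbT.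
apply/ler_addgt0Pl => e e0; rewrite addr0.
case: l al cl Fd FM Flc => x y /= al cl Fd FM Flc.
(* Small enough for the square to lie in the rectangle and in the region where [cmod (F z) <= M],
   and for [4 * M * s <= e]. *)
pose s := Num.min (Num.min (r / 4) (e / (16 * (M + 1)))) (Num.min (Num.min (x - a) (b - x)) (Num.min (y - c) (d - y))).
have s0 : 0 < s.
  rewrite !lt_min !subr_gt0 !divr_gt0//=; [lra|nra].
have [s1 s2 s3 s4] : [/\ s <= x - a, s <= b - x, s <= y - c & s <= d - y].
  by rewrite /s !ge_min !lexx !orbT.
have [s5 s6] : s <= r / 4 /\ s <= e / (16 * (M + 1)) by rewrite /s !ge_min !lexx !orbT.
have zero a' b' c' d' : a <= a' -> a' <= b' -> b' <= b -> c <= c' -> c' <= d' -> d' <= d ->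
    (b' < x \/ x < a' \/ d' < y \/ y < c') -> bdint F a' b' c' d' = 0.
  move=> h1 h2 h3 h4 h5 h6 h; apply: goursat => // z [/andP[z1 z2] /andP[z3 z4]].
  apply: Fd; first by split; lra.
  apply/negP => /eqP zl; rewrite zl /= in z1 z2 z3 z4.
  by clear -z1 z2 z3 z4 h; case: h => [|[|[|]]]; lra.
have cS a' b' c' d' : a <= a' -> b' <= b -> c <= c' -> d' <= d -> cont_rect F a' b' c' d'.
  by apply: cont_rectS.
pose s' := s / 2.
have ss : s' = s / 2 by [].
have [x1 x2 x3 x4] : [/\ a <= x - s', x - s' < x, x < x + s' & x + s' <= b].
  by clear -ss s0 s1 s2; split; lra.
have [y1 y2 y3 y4] : [/\ c <= y - s', y - s' < y, y < y + s' & y + s' <= d].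
  by clear -ss s0 s3 s4; split; lra.
have [x5 x6 x7] : [/\ x - s' <= x + s', x - s' <= b & a <= x + s'] by clear -x1 x2 x3 x4; split; lra.
have [y5 y6 y7] : [/\ y - s' <= y + s', y - s' <= d & c <= y + s'] by clear -y1 y2 y3 y4; split; lra.
have cd' : c <= d by exact: le_trans y4.
rewrite (@bdint_splitx _ F a (x - s') b) ?x1//.
rewrite (@zero a (x - s') c d) ?add0r//; last by left.
rewrite (@bdint_splitx _ F (x - s') (x + s') b) ?x5//; last exact: cS.
rewrite (@zero (x + s') b c d) ?addr0//; last by right; left.
rewrite (@bdint_splity _ F (x - s') (x + s') c (y - s') d) ?y1//; last exact: cS.
rewrite (@zero (x - s') (x + s') c (y - s')) ?add0r//; last by right; right; left.
rewrite (@bdint_splity _ F (x - s') (x + s') (y - s') (y + s') d) ?y5//; last exact: cS.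
rewrite (@zero (x - s') (x + s') (y + s') d) ?addr0//; last by right; right; right.
apply: (@le_trans _ _ (2 * M * ((x + s' - (x - s')) + (y + s' - (y - s'))))).
  apply: bdint_bound => //; first by apply: cont_rect_bdry; exact: cS.
  move=> z [[/andP[z1 z2] /andP[z3 z4]] zb]; apply: FM.
  - by split; rewrite ?(le_trans x1 z1) ?(le_trans z2 x4) ?(le_trans y1 z3) ?(le_trans z4 y4).
  - apply/negP => /eqP zl; rewrite zl /= in zb; clear -zb x2 x3 y2 y3; case: zb; lra.
  - rewrite (le_lt_trans (cmod_le _))// ReD ReN ImD ImN/=.
    apply: (@le_lt_trans _ _ (s' + s')); last by clear -ss s5 r0; lra.
    by clear -z1 z2 z3 z4; rewrite lerD// ler_norml; apply/andP; split; lra.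
have M1 : 0 < 16 * (M + 1) by lra.
move: s6; rewrite ler_pdivlMr// => s6; nra.
Qed.

Lemma cdiff_quot F l z (k : R[i]) : z != l -> cdiff F z ->
  cdiff (fun w => k * ((F w - F l) / (w - l))) z.
Proof.
move=> zl [A hA]; have zl0 : z - l != 0 by rewrite subr_eq0.
pose m := cmod (z - l); have m0 : 0 < m by exact: cmod_gt0.
(* [B] is the derivative given by the quotient rule. [C] controls the term coming from the error of
   [F], and [B'] the remaining term, quadratic in [w - z]; both rely on [m / 2 <= cmod (w - l)]. *)
pose B := k * (A * (z - l) - (F z - F l)) / (z - l) ^+ 2.
exists B => e e0.
pose C := (cmod k + 1) * 2 / m.
have C0 : 0 < C by rewrite !divr_gt0 ?mulr_gt0 ?ltr_wpDl ?cmod_ge0.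
pose B' := cmod (A * (z - l) - (F z - F l)) * (cmod k + 1) * 2 / m ^+ 3 + 1.
have B'0 : 0 < B'.
  have k10 : 0 <= cmod k + 1 by rewrite addr_ge0 ?cmod_ge0.
  by rewrite ltr_wpDl// divr_ge0//; [rewrite !mulr_ge0 ?cmod_ge0|rewrite exprn_ge0 ?ltW].
have eC : 0 < e / 2 / C by rewrite divr_gt0// divr_gt0.
have [d d0 hd] := hA _ eC.
exists (Num.min d (Num.min (m / 2) (e / 2 / B'))).
  by rewrite !lt_min d0 divr_gt0//= divr_gt0// divr_gt0.
move=> w; rewrite !lt_min => /and3P[wd wm wB].
have wl : m / 2 <= cmod (w - l).
  have := cmodD (w - l) (z - w); rewrite (_ : w - l + (z - w) = z - l); last by ring.
  rewrite -/m (cmodB z w); lra.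
have wl0 : w - l != 0 by apply: cmod_neq0; lra.
have -> : k * ((F w - F l) / (w - l)) - k * ((F z - F l) / (z - l)) - B * (w - z) =
   k * (F w - F z - A * (w - z)) / (w - l) -
   k * (A * (z - l) - (F z - F l)) * (w - z) ^+ 2 / ((z - l) ^+ 2 * (w - l)).
  by rewrite /B; field; rewrite zl0 wl0.
rewrite (le_trans (cmodD _ _))// cmodN.
have -> : e * cmod (w - z) = e / 2 * cmod (w - z) + e / 2 * cmod (w - z) by field.
have iw : (cmod (w - l))^-1 <= 2 / m.
  by rewrite -[2 / m]invf_div lef_pV2 ?posrE ?divr_gt0//; lra.
have k1 : cmod k <= cmod k + 1 by lra.
apply: lerD.
  rewrite !cmodM cmodV.
  apply: (@le_trans _ _ ((cmod k + 1) * (e / 2 / C * cmod (w - z)) * (2 / m))).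
    apply: ler_pM; rewrite ?mulr_ge0 ?invr_ge0 ?cmod_ge0//.
    by apply: ler_pM; rewrite ?cmod_ge0// hd.
  rewrite le_eqVlt; apply/orP; left; apply/eqP; rewrite /C; field.
  by rewrite !lt0r_neq0// ltr_wpDl ?cmod_ge0.
rewrite !cmodM cmodV !cmodM invfM -/m.
set D := cmod (A * _ - _) in B' B'0 wB *.
apply: (@le_trans _ _ ((cmod k + 1) * D * (cmod (w - z) * (e / 2 / B')) * (m * m)^-1 * (2 / m))).
  have -> : cmod k * D * (cmod (w - z) * cmod (w - z)) * ((m * m)^-1 / cmod (w - l)) =
    cmod k * D * (cmod (w - z) * cmod (w - z)) * (m * m)^-1 / cmod (w - l) by ring.
  apply: ler_pM; rewrite ?mulr_ge0 ?invr_ge0 ?mulr_ge0 ?cmod_ge0//.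
  rewrite ler_wpM2r ?invr_ge0 ?mulr_ge0 ?cmod_ge0//; apply: ler_pM; rewrite ?mulr_ge0 ?cmod_ge0//.
    by rewrite ler_wpM2r ?cmod_ge0.
  by rewrite ler_wpM2l ?cmod_ge0// ltW.
have -> : (cmod k + 1) * D * (cmod (w - z) * (e / 2 / B')) * (m * m)^-1 * (2 / m) =
  (e / 2 * cmod (w - z)) * ((B' - 1) / B').
  have -> : B' - 1 = D * (cmod k + 1) * 2 / m ^+ 3 by rewrite /B' addrK.
  move: (lt0r_neq0 m0) (lt0r_neq0 B'0); generalize B' => b'; generalize m => m' m1 B1.
  by field; rewrite m1 B1.
rewrite ler_piMr// ?mulr_ge0 ?cmod_ge0//; first lra.
by rewrite ler_pdivrMr//; lra.
Qed.
End Goursat.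

(** * Cauchy's integral formula and bounds for its kernel *)

Section CauchyEstimates.
Context {R : realType}.
Implicit Types (F G : R[i] -> R[i]) (w z l k : R[i]) (a b c d x y : R).

Lemma ccont_cst k z : ccont (fun=> k) z.
Proof. by move=> e e0; exists 1 => // w _; rewrite subrr cmod0. Qed.

Lemma ccont_id z : ccont id z.
Proof. by move=> e e0; exists e. Qed.

Lemma ccontM F G z : ccont F z -> ccont G z -> ccont (fun w => F w * G w) z.
Proof.
move=> Fc Gc e e0.
have f0 : 0 < cmod (F z) + 1 by rewrite ltr_wpDl ?cmod_ge0.
have g0 : 0 < cmod (G z) + 1 by rewrite ltr_wpDl ?cmod_ge0.
have e1 : 0 < e / 2 / (cmod (G z) + 1) by rewrite divr_gt0// divr_gt0.
have e2 : 0 < Num.min 1 (e / 2 / (cmod (F z) + 1)) by rewrite lt_min ltr01 divr_gt0// divr_gt0.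
have [d1 d10 h1] := Fc _ e1; have [d2 d20 h2] := Gc _ e2.
exists (Num.min d1 d2); first by rewrite lt_min d10.
move=> w; rewrite lt_min => /andP[/h1 l1 /h2]; rewrite lt_min => /andP[l2 l3].
have -> : F w * G w - F z * G z = (F w - F z) * G w + F z * (G w - G z) by ring.
rewrite (le_lt_trans (cmodD _ _))// !cmodM.
have gw : cmod (G w) <= cmod (G z) + 1.
  by rewrite -(subrK (G z) (G w)) (le_trans (cmodD _ _))// addrC lerD2l ltW.
move: l1 l3; rewrite !ltr_pdivlMr// => l1 l3.
have := cmod_ge0 (F w - F z); have := cmod_ge0 (G w - G z); have := cmod_ge0 (F z).
nra.
Qed.

Lemma ccontV G z : ccont G z -> G z != 0 -> ccont (fun w => (G w)^-1) z.
Proof.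
move=> Gc Gz e e0; have m0 := cmod_gt0 Gz; set m := cmod (G z) in m0.
have e1 : 0 < Num.min (m / 2) (e * m ^+ 2 / 2).
  by rewrite lt_min !divr_gt0 ?mulr_gt0 ?exprn_gt0.
have [d d0 h] := Gc _ e1; exists d => // w /h; rewrite lt_min => /andP[l1 l2].
have gw : m / 2 < cmod (G w).
  have := cmodD (G w) (G z - G w); rewrite subrKC -/m cmodB; lra.
have Gw : G w != 0 by apply: cmod_neq0; lra.
have -> : (G w)^-1 - (G z)^-1 = - (G w - G z) / (G w * G z) by field; rewrite Gw Gz.
rewrite cmodM cmodN cmodV cmodM -/m ltr_pdivrMr; last by rewrite mulr_gt0//; lra.
apply: (lt_trans l2).
have -> : e * m ^+ 2 / 2 = e * m * (m / 2) by field.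
by rewrite [ltRHS](_ : _ = e * m * cmod (G w)) ?ltr_pM2l ?mulr_gt0//; ring.
Qed.

Lemma ccont_subl l z : ccont (fun w => w - l) z.
Proof. by apply: ccontB; [exact: ccont_id|exact: ccont_cst]. Qed.

Lemma ccont_div_subl F l z : z != l -> ccont F z -> ccont (fun w => F w / (w - l)) z.
Proof.
move=> zl Fc; apply: ccontM => //; apply: (@ccontV (fun w => w - l)).
  exact: ccont_subl.
by rewrite subr_eq0.
Qed.

Lemma cdiff_near F G z r : 0 < r -> (forall w, cmod (w - z) < r -> F w = G w) ->
  cdiff F z -> cdiff G z.
Proof.
move=> r0 FG [A hA]; exists A => e e0; have [d d0 h] := hA e e0.
exists (Num.min r d); first by rewrite lt_min r0.
by move=> w; rewrite lt_min => /andP[wr wd]; rewrite -!FG ?subrr ?cmod0//; apply: h.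
Qed.

Definition interior_pt a b c d l :=
  a < complex.Re l < b /\ c < complex.Im l < d.

Lemma interior_neq_bdry a b c d l z :
  interior_pt a b c d l -> on_bdry a b c d z -> z != l.
Proof.
move=> [l1 l2] [[z1 z2] zb]; apply/negP => /eqP zl; rewrite zl in zb.
by case: zb => e; rewrite e !ltxx ?andbF in l1 l2.
Qed.

(** Extended by [k * A] at [l], with [A] the derivative, the quotient is continuous there, so the
    singularity is removable. The factor [k] permits a rotation before the real part is taken;
    [- 'i] yields the imaginary part. *)
Lemma cauchy_bdint F a b c d l k : interior_pt a b c d l -> diff_rect F a b c d ->
  bdint (fun w => k * ((F w - F l) / (w - l))) a b c d = 0.
Proof.
move=> li Fd; have [/andP[al lb] /andP[cl ld]] := li.
have ab := ltW (lt_trans al lb); have cd := ltW (lt_trans cl ld).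
have [A hA] : cdiff F l by apply: Fd; split; apply/andP; split; exact: ltW.
pose G w := if w == l then k * A else k * ((F w - F l) / (w - l)).
rewrite (@eq_bdint _ _ G)//; last first.
  by move=> z /(interior_neq_bdry li) zl; rewrite /G (negbTE zl).
have quotE w : w != l -> k * ((F w - F l) / (w - l)) - k * A =
    k * ((F w - F l - A * (w - l)) / (w - l)).
  by rewrite -subr_eq0 => wl; field.
have near e : 0 < e -> exists2 r, 0 < r & forall w, w != l -> cmod (w - l) < r ->
    cmod (k * ((F w - F l) / (w - l)) - k * A) <= cmod k * e.
  move=> e0; have [r r0 hr] := hA e e0; exists r => // w wl wr.
  have w0 : 0 < cmod (w - l) by rewrite cmod_gt0// subr_eq0.
  by rewrite quotE// cmodM ler_wpM2l ?cmod_ge0// cmodM cmodV ler_pdivrMr// hr.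
have [r r0 hr] := near 1 ltr01.
apply: (@bdint_puncture _ G l (cmod (k * A) + cmod k) r) => //; try by case: li.
- by rewrite addr_ge0 ?cmod_ge0.
- move=> z zr zl; have z0 : 0 < cmod (z - l) by rewrite cmod_gt0// subr_eq0.
  apply: (cdiff_near z0 _ (cdiff_quot k zl (Fd z zr))) => w wz.
  rewrite /G; case: eqP => // wl; move: wz; rewrite wl cmodB ltxx //.
- move=> z zr zl zlr; rewrite /G (negbTE zl).
  have := hr z zl zlr; rewrite mulr1 => h.
  rewrite -[X in cmod X](subrK (k * A)) (le_trans (cmodD _ _))//; lra.
- move=> e e0; have k0 : 0 < cmod k + 1 by rewrite ltr_wpDl ?cmod_ge0.
  have [d' d'0 h] := near (e / (cmod k + 1)) (divr_gt0 e0 k0).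
  exists d' => // w wd; rewrite /G eqxx; case: eqP => [_|/eqP wl]; first by rewrite subrr cmod0.
  apply: (le_lt_trans (h w wl wd)); rewrite mulrCA gtr_pMr// ltr_pdivrMr//; lra.
Qed.

Lemma bdint_ext F G a b c d : (forall w, F w = G w) ->
  bdint F a b c d = bdint G a b c d.
Proof. by move=> /funext ->. Qed.

Definition cint F a b c d : R[i] :=
  Complex (bdint F a b c d) (bdint (fun w => Complex 0 (-1) * F w) a b c d).

Lemma cont_bdryM F G a b c d : cont_bdry F a b c d -> cont_bdry G a b c d ->
  cont_bdry (fun w => F w * G w) a b c d.
Proof. by move=> Fc Gc z zb; apply: ccontM; [exact: Fc|exact: Gc]. Qed.

Lemma cont_bdry_cst k a b c d : cont_bdry (fun=> k) a b c d.
Proof. by move=> z _; exact: ccont_cst. Qed.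

Lemma bdint_scale F k a b c d : a <= b -> c <= d -> cont_bdry F a b c d ->
  bdint (fun w => k * F w) a b c d = complex.Re (k * cint F a b c d).
Proof.
move=> ab cd Fc; case: k => x y.
have iF : cont_bdry (fun w => Complex 0 (-1) * F w) a b c d.
  by apply: cont_bdryM => //; exact: cont_bdry_cst.
rewrite /cint /= -!bdintZ// -bdintB//; try (apply: cont_bdryM => //; exact: cont_bdry_cst).
apply: bdint_ext => w; rewrite !mulrA -mulrBl; congr (_ * _).
by congr Complex => /=; ring.
Qed.

Lemma cintZ F k a b c d : a <= b -> c <= d -> cont_bdry F a b c d ->
  cint (fun w => k * F w) a b c d = k * cint F a b c d.
Proof.
move=> ab cd Fc; rewrite {1}/cint bdint_scale//.
have -> : (fun w => Complex 0 (-1) * (k * F w)) = (fun w => (Complex 0 (-1) * k) * F w).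
  by apply/funext => w; rewrite mulrA.
rewrite bdint_scale//; case: (cint F a b c d) => u v; case: k => x y.
by congr Complex => /=; ring.
Qed.

Lemma cintB F G a b c d : a <= b -> c <= d ->
  cont_bdry F a b c d -> cont_bdry G a b c d ->
  cint (fun w => F w - G w) a b c d = cint F a b c d - cint G a b c d.
Proof.
move=> ab cd Fc Gc; rewrite /cint bdintB//.
have -> : (fun w => Complex 0 (-1) * (F w - G w)) =
  (fun w => Complex 0 (-1) * F w - Complex 0 (-1) * G w).
  by apply/funext => w; rewrite mulrBr.
by rewrite bdintB//; apply: cont_bdryM => //; exact: cont_bdry_cst.
Qed.

Lemma eq_cint F G a b c d : a <= b -> c <= d ->
  (forall z, on_bdry a b c d z -> F z = G z) -> cint F a b c d = cint G a b c d.
Proof.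
by move=> ab cd FG; congr Complex; apply: eq_bdint => // z zb; rewrite FG.
Qed.

Lemma cint_bound F a b c d M : a <= b -> c <= d -> cont_bdry F a b c d ->
  (forall z, on_bdry a b c d z -> cmod (F z) <= M) ->
  cmod (cint F a b c d) <= 4 * M * ((b - a) + (d - c)).
Proof.
move=> ab cd Fc FM; rewrite (le_trans (cmod_le _))//.
rewrite (_ : 4 * M * _ = 2 * M * (b - a + (d - c)) + 2 * M * (b - a + (d - c))); last by ring.
apply: lerD; apply: bdint_bound => //.
  by apply: cont_bdryM => //; exact: cont_bdry_cst.
move=> z /FM; apply: le_trans; rewrite cmodM.
by rewrite [X in X * _](_ : _ = 1) ?mul1r// /cmod/= expr0n add0r sqrtr_sqr normrN1.
Qed.

Lemma cauchy_cint F a b c d l : interior_pt a b c d l -> diff_rect F a b c d ->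
  cint (fun w => (F w - F l) / (w - l)) a b c d = 0.
Proof.
move=> li Fd; rewrite /cint cauchy_bdint//.
congr Complex; rewrite -[RHS](@cauchy_bdint F a b c d l 1 li Fd).
by apply: bdint_ext => w; rewrite mul1r.
Qed.

(** For a side at distance [v] from the pole and a point at offset [u] along it,
    [u ^+ 2 + v ^+ 2 <= 2 * s ^+ 2] while [v >= s / 2]. *)
Lemma kernel_ge (r s u v : R) : 0 < s -> 0 <= r -> - s <= u <= s -> s / 2 <= v <= s ->
  r / (2 * s) / 2 <= r * v / (u ^+ 2 + v ^+ 2).
Proof.
move=> s0 r0 us vs.
have p : 0 < u ^+ 2 + v ^+ 2 by rewrite ltr_wpDl ?sqr_ge0// exprn_gt0//; lra.
have u2 : u ^+ 2 <= s ^+ 2 by nra.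
have v2 : v ^+ 2 <= s ^+ 2 by nra.
have -> : r / (2 * s) / 2 = r / (4 * s) by field; rewrite lt0r_neq0.
rewrite ler_pdivrMr ?mulr_gt0// mulrAC ler_pdivlMr//.
have -> : r * v * (4 * s) = r * (4 * s * v) by ring.
rewrite ler_wpM2l//; apply: (@le_trans _ _ (2 * s ^+ 2)); nra.
Qed.

(** The exact value is [2 * pi * r], but later estimates only ask for a lower bound. All four sides
    contribute with the same sign, at least [r / 4] each, because every side has length at least
    [s]. *)
Lemma bdint_inv_ge z0 (r s : R) a b c d : 0 < s -> 0 <= r ->
  complex.Re z0 - s <= a <= complex.Re z0 - s / 2 ->
  complex.Re z0 + s / 2 <= b <= complex.Re z0 + s ->
  complex.Im z0 - s <= c <= complex.Im z0 - s / 2 ->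
  complex.Im z0 + s / 2 <= d <= complex.Im z0 + s ->
  r <= bdint (fun w => Complex 0 (- r) / (w - z0)) a b c d.
Proof.
case: z0 => x0 y0 /= s0 r0 ha hb hc hd.
have ab : a <= b by lra. have cd : c <= d by lra.
have zi : interior_pt a b c d (Complex x0 y0) by split => /=; lra.
have Fc : cont_bdry (fun w => Complex 0 (- r) / (w - Complex x0 y0)) a b c d.
  by move=> z zb; apply: ccont_div_subl; [exact: (interior_neq_bdry zi)|exact: ccont_cst].
have [f1 f2 f3 f4] := bdry_sides ab cd Fc.
have HE y x : horz (fun w => Complex 0 (- r) / (w - Complex x0 y0)) y x =
    - (r * (y - y0) / ((x - x0) ^+ 2 + (y - y0) ^+ 2)).
  by rewrite /horz/=; ring.
have VE y x : vert (fun w => Complex 0 (- r) / (w - Complex x0 y0)) x y =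
    - (r * (x - x0) / ((y - y0) ^+ 2 + (x - x0) ^+ 2)).
  by rewrite /vert/= (addrC ((y - y0) ^+ 2)); ring.
have I1 : r / 2 <= seg (fun x => horz (fun w => Complex 0 (- r) / (w - Complex x0 y0)) c x - horz (fun w => Complex 0 (- r) / (w - Complex x0 y0)) d x) a b.
  apply: (@le_trans _ _ (seg (fun=> r / (2 * s)) a b)).
    rewrite seg_cst// mulrAC ler_pdivlMr ?mulr_gt0//; nra.
  apply: seg_le => //; [exact: cts_on_cst|exact: cts_onB|].
  move=> x xab; rewrite !HE opprK.
  have := @kernel_ge r s (x - x0) (y0 - c) s0 r0 ltac:(lra) ltac:(lra).
  have := @kernel_ge r s (x - x0) (d - y0) s0 r0 ltac:(lra) ltac:(lra).
  rewrite -(sqrrN (y0 - c)) opprB => k1 k2.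
  have -> : r * (c - y0) / ((x - x0) ^+ 2 + (c - y0) ^+ 2) = - (r * (y0 - c) / ((x - x0) ^+ 2 + (c - y0) ^+ 2)) by ring.
  lra.
have I2 : seg (fun y => vert (fun w => Complex 0 (- r) / (w - Complex x0 y0)) b y - vert (fun w => Complex 0 (- r) / (w - Complex x0 y0)) a y) c d <= - (r / 2).
  apply: (@le_trans _ _ (seg (fun=> - (r / (2 * s))) c d)); last first.
    rewrite seg_cst// mulNr lerN2 mulrAC ler_pdivlMr ?mulr_gt0//; nra.
  apply: seg_le => //; [exact: cts_onB|exact: cts_on_cst|].
  move=> x xab; rewrite !VE opprK.
  have := @kernel_ge r s (x - y0) (x0 - a) s0 r0 ltac:(lra) ltac:(lra).
  have := @kernel_ge r s (x - y0) (b - x0) s0 r0 ltac:(lra) ltac:(lra).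
  rewrite -(sqrrN (x0 - a)) opprB => k1 k2.
  have -> : r * (a - x0) / ((x - y0) ^+ 2 + (a - x0) ^+ 2) = - (r * (x0 - a) / ((x - y0) ^+ 2 + (a - x0) ^+ 2)) by ring.
  lra.
rewrite /bdint; lra.
Qed.
End CauchyEstimates.

(** * Iterated Lebesgue integrals *)

Section LowerIntegral.
Context d (T : measurableType d) {R : realType} (mu : {measure set T -> \bar R}).
Local Open Scope ereal_scope.

(* No measurability: the integral of a nonnegative function is a supremum over
   simple functions below it. *)
Lemma ge0_le_integralT (f g : T -> \bar R) : (forall x, 0 <= f x) ->
  (forall x, f x <= g x) -> \int[mu]_x f x <= \int[mu]_x g x.
Proof.
move=> f0 fg; rewrite !ge0_integralTE//; last by move=> x; exact: le_trans (fg x).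
apply: le_ereal_sup => _ [h /= hf <-]; exists h => // x; exact: le_trans (hf x) (fg x).
Qed.
End LowerIntegral.

(** * Measurability along coordinate maps *)

Section CoordinateMeasurability.
Context {R : realType}.
Implicit Types (x y : nat -> R).

Definition near_coord n x (r : R) y := forall i, (i < n)%N -> `|y i - x i| < r.

(** Measurability of sets and functions on [nat -> R] is tested by pulling them back along such maps
    [g], instead of through a sigma-algebra on sequences. *)
Definition coord_measurable d (T : measurableType d) (g : T -> nat -> R) :=
  forall i, measurable_fun setT (fun t => g t i).

Lemma measurable_coord_ball d (T : measurableType d) (g : T -> nat -> R) n x r :
  coord_measurable g -> measurable [set t | near_coord n x r (g t)].
Proof.
move=> mg.
have -> : [set t | near_coord n x r (g t)] =
    \bigcap_(i in [set: 'I_n]) [set t | `|g t i - x i| < r].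
  apply/seteqP; split => t /= h; first by move=> i _; exact: h.
  by move=> i ilt; exact: (h (Ordinal ilt)).
apply: fin_bigcap_measurable; first exact: finite_finset.
move=> i _; rewrite -[X in measurable X]setTI.
have -> : [set t | `|g t i - x i| < r] = (fun t => g t i) @^-1` `](x i - r), (x i + r)[.
  by apply/seteqP; split => t /=; rewrite in_itv/= ltr_distl.
exact: mg.
Qed.

(** An open set is the union of the balls with rational centre and radius [1 / (m + 1)] that it
    contains, and there are countably many of these. *)
Lemma measurable_coord_open d (T : measurableType d) (g : T -> nat -> R) n
    (U : set (nat -> R)) : coord_measurable g ->
  (forall x, U x -> exists2 r, 0 < r & near_coord n x r `<=` U) ->
  measurable [set t | U (g t)].
Proof.
move=> mg openU.
pose q_ (k : {ffun 'I_n -> rat} * nat) (i : nat) : R :=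
  if insub i is Some j then ratr (k.1 j) else 0.
pose B k := near_coord n (q_ k) (k.2.+1%:R^-1).
pose F k := if `[< B k `<=` U >] then [set t | B k (g t)] else set0.
have -> : [set t | U (g t)] = \bigcup_k F k.
  apply/seteqP; split => t /=; last first.
    by move=> [k _]; rewrite /F; case: asboolP => // BU /BU.
  move=> Ut; have [r r0 hr] := openU _ Ut.
  have [m hm] : exists m : nat, m.+1%:R^-1 < r / 2.
    exists (Num.truncn (r / 2)^-1); rewrite -[ltRHS]invrK ltf_pV2 ?posrE ?invr_gt0 ?divr_gt0//.
    exact: truncnS_gt.
  have /choice[q hq] : forall i : 'I_n, exists q : rat, `|g t i - ratr q| < m.+1%:R^-1.
    move=> i.
    have lt : g t i - m.+1%:R^-1 < g t i + m.+1%:R^-1 by rewrite ltrD2l gtrN// invr_gt0.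
    have [q] := rat_in_itvoo lt.
    by rewrite in_itv/= -ltr_distl distrC => ?; exists q.
  have qE i (ilt : (i < n)%N) : q_ ([ffun i => q i], m) i = ratr (q (Ordinal ilt)).
    by rewrite /q_ insubT/= ffunE.
  exists ([ffun i => q i], m) => //; rewrite /F asboolT; last first.
    move=> y By; apply: hr => i ilt.
    have := By i ilt; have := hq (Ordinal ilt); rewrite /= qE => h1 h2.
    rewrite -(subrK (ratr (q (Ordinal ilt))) (y i)) -addrA.
    move: h1; rewrite distrC => h1.
    have := le_lt_trans (ler_normD _ _) (ltrD h2 h1) => /lt_le_trans; apply.
    by rewrite [leRHS](splitr r) lerD// ltW.
  by move=> i ilt; rewrite qE; exact: (hq (Ordinal ilt)).
apply: countable_bigcupT_measurable => // k; rewrite /F; case: asboolP => // _.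
exact: measurable_coord_ball.
Qed.

(** Superlevel sets of a continuous function on an open set are open; for a negative level, the
    default value 0 adds the complement of [U]. *)
Lemma measurable_coord_fun d (T : measurableType d) (g : T -> nat -> R) n
    (U : set (nat -> R)) (psi : (nat -> R) -> R) : coord_measurable g ->
  (forall x, U x -> forall e, 0 < e -> exists2 r, 0 < r &
     forall y, near_coord n x r y -> U y /\ `|psi y - psi x| < e) ->
  measurable_fun setT (fun t => if `[< U (g t) >] then psi (g t) else 0).
Proof.
move=> mg hU.
have oU x : U x -> exists2 r, 0 < r & near_coord n x r `<=` U.
  by move=> /hU /(_ 1 ltr01)[r r0 h]; exists r => // y /h[].
have mU := measurable_coord_open mg oU.
apply: (measurability _ (RGenOInfty.measurableE R)) => // _ [_ [c ->] <-].
rewrite setTI.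
have mV : measurable [set t | U (g t) /\ c < psi (g t)].
  apply: (measurable_coord_open (n := n) (U := [set x | U x /\ c < psi x])) => //.
  move=> x [Ux cx]; have e0 : 0 < psi x - c by rewrite subr_gt0.
  have [r r0 h] := hU x Ux _ e0; exists r => // y /h[Uy].
  by rewrite ltr_distl subKr => /andP[? _]; split.
have [c0|c0] := ltP c 0; last first.
  rewrite (_ : _ @^-1` _ = [set t | U (g t) /\ c < psi (g t)])//.
  apply/seteqP; split => t /=; rewrite in_itv/= andbT; case: asboolP => //.
    by move=> _ /(le_lt_trans c0); rewrite ltxx.
  - by move=> nU [].
  - by move=> ? [].
rewrite (_ : _ @^-1` _ = [set t | U (g t) /\ c < psi (g t)] `|` ~` [set t | U (g t)]).
  by apply: measurableU => //; exact: measurableC.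
apply/seteqP; split => t /=; rewrite in_itv/= andbT; case: asboolP => //.
- by move=> Ut ct; left.
- by move=> nU _; right.
- by move=> Ut [[]|].
Qed.

(** Inversion is continuous off 0, and the convention [0^-1 = 0] agrees with the default value of
    [measurable_coord_fun]. *)
Lemma measurable_inv d (T : measurableType d) (f : T -> R) :
  measurable_fun setT f -> measurable_fun setT (fun t => (f t)^-1).
Proof.
move=> mf.
have := @measurable_coord_fun _ T (fun t _ => f t) 1 [set x | x 0%N != 0] (fun x => (x 0%N)^-1).
set h := (X in measurable_fun _ X) => mh.
have -> : (fun t => (f t)^-1) = h.
  by apply/funext => t; rewrite /h/=; case: asboolP => // /negP; rewrite negbK => /eqP ->; rewrite invr0.
apply: mh => // x /= x0 e e0; set a := x 0%N in x0 *.
have a0 : 0 < `|a| by rewrite normr_gt0.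
exists (Num.min (`|a| / 2) (e * `|a| ^+ 2 / 2)).
  by rewrite lt_min !divr_gt0// ?mulr_gt0 ?exprn_gt0.
move=> y /(_ 0%N isT); set b := y 0%N; rewrite -/a lt_min => /andP[l1 l2].
have b2 : `|a| / 2 < `|b|.
  have := ler_normD b (a - b); rewrite subrKC distrC; lra.
have b0 : b != 0 by rewrite -normr_gt0; lra.
split => //.
have -> : b^-1 - a^-1 = - (b - a) / (a * b) by field; rewrite b0 x0.
rewrite normrM normrN normfV normrM ltr_pdivrMr ?mulr_gt0 ?normr_gt0//.
apply: (lt_trans l2).
have -> : e * `|a| ^+ 2 / 2 = e * `|a| * (`|a| / 2) by field.
by rewrite [ltRHS](_ : _ = e * `|a| * `|b|) ?ltr_pM2l ?mulr_gt0//; ring.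
Qed.
End CoordinateMeasurability.

Section VectorMeasurability.
Context {R : realType} {N : nat}.

Definition cont_at (F : cvec R N -> R) z := forall e, 0 < e -> exists2 r, 0 < r &
  forall w, vnorm (vsub w z) < r -> `|F w - F z| < e.

Definition vopen (U : set (cvec R N)) := forall z, U z -> exists2 r, 0 < r &
  forall w, vnorm (vsub w z) < r -> U w.

Lemma vec_of_near (x y : nat -> R) r : 0 < r -> near_coord (2 * N) x r y ->
  vnorm (vsub (vec_of y) (vec_of x : cvec R N)) <= (2 * N)%:R * r.
Proof.
move=> r0 xy; rewrite (le_trans (vnorm_le_sum _))//.
apply: (@le_trans _ _ (\sum_(i < N) (r + r))).
  apply: ler_sum => i _; rewrite (le_trans (cmod_le _))// /vsub ReD ReN ImD ImN/=.
  have := ltn_ord i => iN.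
  by apply: lerD; apply: ltW; apply: xy; lia.
by rewrite sumr_const card_ord -mulr2n -!mulrnA mulr_natl.
Qed.

Lemma measurable_vec d (T : measurableType d) (g : T -> nat -> R)
    (U : set (cvec R N)) (F : cvec R N -> R) :
  coord_measurable g -> vopen U -> (forall z, U z -> cont_at F z) ->
  measurable_fun setT (fun t => if `[< U (vec_of (g t)) >] then F (vec_of (g t)) else 0).
Proof.
move=> mg oU cF.
apply: (@measurable_coord_fun R _ T g (2 * N) [set x | U (vec_of x)] (fun x => F (vec_of x))) => //.
move=> x /= Ux e e0; have [r1 r10 h1] := oU _ Ux; have [r2 r20 h2] := cF _ Ux e e0.
have N0 : 0 < (2 * N)%:R + 1 :> R by rewrite ltr_wpDl.
have r0 : 0 < Num.min r1 r2 by rewrite lt_min r10.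
exists (Num.min r1 r2 / ((2 * N)%:R + 1)); first by rewrite divr_gt0.
move=> y xy; have := vec_of_near (divr_gt0 r0 N0) xy => le.
have : vnorm (vsub (vec_of y) (vec_of x : cvec R N)) < Num.min r1 r2.
  rewrite (le_lt_trans le)// mulrA ltr_pdivrMr// mulrC ltr_pM2l//; lra.
by rewrite lt_min => /andP[/h1 ? /h2 ?].
Qed.

Lemma cont_vnorm z : cont_at (@vnorm R N) z.
Proof. by move=> e e0; exists e => // w; apply: le_lt_trans; exact: vnorm_dist. Qed.

Lemma measurable_vnorm d (T : measurableType d) (g : T -> nat -> R) :
  coord_measurable g -> measurable_fun setT (fun t => vnorm (vec_of (g t) : cvec R N)).
Proof.
move=> mg; have := @measurable_vec _ T g setT (@vnorm R N) mg.
under [X in _ -> _ -> measurable_fun _ X]eq_fun do rewrite asboolT//.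
by apply; [move=> z _; exists 1|move=> z _; exact: cont_vnorm].
Qed.
End VectorMeasurability.

Section IteratedIntegral.
Context {R : realType}.
Local Open Scope ereal_scope.
Notation mu := (@lebesgue_measure R).

Definition upd (x : nat -> R) k (s : R) : nat -> R := fun j => if j == k then s else x j.

(** Joint measurability in a parameter and a point, along all measurable reparametrisations. This
    form is stable under moving a coordinate of the point into the parameter, which is what
    inductions on [iint] do. *)
Definition jmeas d (T : measurableType d) (G : T -> (nat -> R) -> \bar R) :=
  forall d' (T' : measurableType d') (p : T' -> T) (g : T' -> nat -> R),
    measurable_fun setT p -> coord_measurable g ->
    measurable_fun setT (fun t => G (p t) (g t)).

Definition cmeas (G : (nat -> R) -> \bar R) :=
  forall d (T : measurableType d) (g : T -> nat -> R),
    coord_measurable g -> measurable_fun setT (fun t => G (g t)).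

Lemma iintS k G : iint k.+1 G = \int[mu]_s iint k (fun x => G (upd x k s)).
Proof. by []. Qed.

Lemma coord_measurable_upd d (T : measurableType d) (g : T -> nat -> R) k (s : T -> R) :
  coord_measurable g -> measurable_fun setT s ->
  coord_measurable (fun t => upd (g t) k (s t)).
Proof. by move=> mg ms i; rewrite /upd; case: eqP => _; [exact: ms|exact: mg]. Qed.

Lemma cmeas_upd G k : cmeas G -> jmeas (fun (s : R) x => G (upd x k s)).
Proof. by move=> mG d T p g mp mg; apply: mG; exact: coord_measurable_upd. Qed.

Lemma jmeas_cmeas d (T : measurableType d) (G : T -> (nat -> R) -> \bar R) t :
  jmeas G -> cmeas (G t).
Proof. by move=> mG d' T' g mg; apply: mG => //; exact: measurable_cst. Qed.

Lemma iint_ge0 k (G : (nat -> R) -> \bar R) : (forall x, 0 <= G x) -> 0 <= iint k G.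
Proof.
elim: k G => [|k IH] G G0 //=; apply: integral_ge0 => s _; exact: IH.
Qed.

Lemma le_iint k (G H : (nat -> R) -> \bar R) : (forall x, 0 <= G x) ->
  (forall x, G x <= H x) -> iint k G <= iint k H.
Proof.
elim: k G H => [|k IH] G H G0 GH //=; apply: ge0_le_integralT.
  by move=> s; exact: iint_ge0.
by move=> s; exact: IH.
Qed.

(** The outermost variable is paired with the parameter, so the induction hypothesis is applied over
    [T * R] and Tonelli's theorem integrates that variable out. *)
Lemma jmeas_iint k d (T : measurableType d) (G : T -> (nat -> R) -> \bar R) :
  jmeas G -> (forall t x, 0 <= G t x) -> measurable_fun setT (fun t => iint k (G t)).
Proof.
elim: k d T G => [|k IH] d T G mG G0 /=.
  by apply: (mG _ _ id); [exact: measurable_id|move=> i; exact: measurable_cst].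
pose G2 (ts : T * R) x := G ts.1 (upd x k ts.2).
have mG2 : jmeas G2.
  move=> d' T' p g mp mg; apply: mG; first exact: (measurableT_comp measurable_fst).
  by apply: coord_measurable_upd => //; exact: (measurableT_comp measurable_snd).
apply: (measurable_fun_fubini_tonelli_F (m2 := mu) (fun ts => iint k (G2 ts))).
  by apply: IH => // ts x; exact: G0.
by move=> ts; apply: iint_ge0 => x; exact: G0.
Qed.

Lemma iint_tonelli k d (T : measurableType d) (m : {sigma_finite_measure set T -> \bar R})
    (G : T -> (nat -> R) -> \bar R) :
  jmeas G -> (forall t x, 0 <= G t x) ->
  \int[m]_t iint k (G t) = iint k (fun x => \int[m]_t G t x).
Proof.
elim: k G => [|k IH] G mG G0 //=.
pose G2 (ts : T * R) x := G ts.1 (upd x k ts.2).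
have mG2 : jmeas G2.
  move=> d' T' p g mp mg; apply: mG; first exact: (measurableT_comp measurable_fst).
  by apply: coord_measurable_upd => //; exact: (measurableT_comp measurable_snd).
rewrite (fubini_tonelli (m1 := m) (m2 := mu) (fun ts => iint k (G2 ts))); last 2 first.
- by apply: jmeas_iint => // ts x; exact: G0.
- by move=> ts; apply: iint_ge0 => x; exact: G0.
apply: eq_integral => s _; rewrite /G2/= IH//.
by move=> d' T' p g mp mg; apply: mG => //; apply: coord_measurable_upd => //; exact: measurable_cst.
Qed.

Lemma iintD k G H : cmeas G -> cmeas H -> (forall x, 0 <= G x) -> (forall x, 0 <= H x) ->
  iint k (fun x => G x + H x) = iint k G + iint k H.
Proof.
elim: k G H => [|k IH] G H mG mH G0 H0 //=.
rewrite -ge0_integralD//.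
- apply: eq_integral => s _; rewrite (IH (fun x => G (upd x k s)) (fun x => H (upd x k s)))//.
    exact: (jmeas_cmeas s (cmeas_upd k mG)).
  exact: (jmeas_cmeas s (cmeas_upd k mH)).
- by move=> s _; exact: iint_ge0.
- by apply: (jmeas_iint k (cmeas_upd k mG)).
- by move=> s _; exact: iint_ge0.
- by apply: (jmeas_iint k (cmeas_upd k mH)).
Qed.

Lemma iintZ k (c : R) G : (0 <= c)%R -> cmeas G -> (forall x, 0 <= G x) ->
  iint k (fun x => c%:E * G x) = c%:E * iint k G.
Proof.
move=> c0; elim: k G => [|k IH] G mG G0 //=.
rewrite -ge0_integralZl//.
- by apply: eq_integral => s _; rewrite (IH (fun x => G (upd x k s)))//;
    exact: (jmeas_cmeas s (cmeas_upd k mG)).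
- by apply: (jmeas_iint k (cmeas_upd k mG)).
- by move=> s _; exact: iint_ge0.
Qed.

Lemma iint_monotone_cvg k (G : nat -> (nat -> R) -> \bar R) (H : (nat -> R) -> \bar R) :
  (forall n, cmeas (G n)) -> (forall n x, 0 <= G n x) ->
  (forall x, {homo (fun n => G n x) : n m / (n <= m)%N >-> n <= m}) ->
  (forall x, G n x @[n --> \oo] --> H x) ->
  iint k (G n) @[n --> \oo] --> iint k H.
Proof.
elim: k G H => [|k IH] G H mG G0 ndG GH /=; first exact: GH.
have lim s : iint k (fun x => G n (upd x k s)) @[n --> \oo] --> iint k (fun x => H (upd x k s)).
  apply: IH => //; first by move=> n; exact: (jmeas_cmeas s (cmeas_upd k (mG n))).
rewrite (_ : (\int[mu]_t iint k (fun x => H (fun j => if j == k then t else x j))) =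
   \int[mu]_s (limn (fun n => iint k (fun x => G n (upd x k s))))); last first.
  by apply: eq_integral => s _; apply/esym/cvg_lim => //; exact: lim.
apply: cvg_monotone_convergence => //.
- by move=> n; apply: (jmeas_iint k (cmeas_upd k (mG n))).
- by move=> n s _; exact: iint_ge0.
- by move=> s _ n m nm; apply: le_iint => // x; exact: ndG.
Qed.
End IteratedIntegral.

(** * One-variable estimates *)

Section TaylorEstimate.
Context {R : realType}.
Implicit Types (F G : R[i] -> R[i]) (w z l k : R[i]).

(** The integral is [2 * pi * 'i]; a modulus of at least 1 allows dividing by it. *)
Lemma cint_kernel_center :
  1 <= cmod (cint (fun w : R[i] => w^-1) (-1) 1 (-1) 1).
Proof.
have := @bdint_inv_ge R 0 1 1 (-1) 1 (-1) 1 ltac:(lra) ltac:(lra) ltac:(rewrite /=; lra)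
  ltac:(rewrite /=; lra) ltac:(rewrite /=; lra) ltac:(rewrite /=; lra).
move/le_trans; apply; apply: le_trans (Im_le_cmod _); rewrite /cint [complex.Im _]/=.
rewrite (@bdint_ext _ _ (fun w => Complex 0 (-1) * w^-1)); first exact: ler_norm.
by move=> w; rewrite subr0.
Qed.

Lemma bdry_ge1 z : on_bdry (-1) 1 (-1) 1 z -> 1 <= cmod z.
Proof.
by move=> [_ [] e]; [move: (Re_le_cmod z)|move: (Re_le_cmod z)|move: (Im_le_cmod z)|move: (Im_le_cmod z)];
  rewrite e ?normrN normr1.
Qed.

Section Estimate.
Variables (F : R[i] -> R[i]) (M : R).
Let Q := in_rect (-1) 1 (-1) 1 : R[i] -> Prop.
Hypothesis Fd : diff_rect F (-1) 1 (-1) 1.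
Hypothesis FM : forall z, Q z -> cmod (F z) <= M.

Let N11 : (-1 : R) <= 1. Proof. lra. Qed.
Let H w := F w - F 0.
Let I G := cint G (-1) 1 (-1) 1.
Let int0 : interior_pt (-1) 1 (-1) 1 (0 : R[i]).
Proof. by split => /=; lra. Qed.

Let bdryH z : on_bdry (-1) 1 (-1) 1 z -> ccont H z.
Proof.
move=> zb; apply: ccontB; last exact: ccont_cst.
by apply: cdiff_cont; apply: Fd; case: zb.
Qed.

Let Q0 : Q 0. Proof. by split => /=; lra. Qed.

Let HM z : Q z -> cmod (H z) <= 2 * M.
Proof.
move=> Qz; rewrite (le_trans (cmodD _ _))// cmodN.
have := FM Qz; have := FM Q0; lra.
Qed.

Let M0 : 0 <= M. Proof. exact: le_trans (cmod_ge0 _) (FM Q0). Qed.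

Let interior_small l : cmod l <= 64^-1 -> interior_pt (-1) 1 (-1) 1 l.
Proof.
move=> l1; have := le_trans (Re_le_cmod l) l1; have := le_trans (Im_le_cmod l) l1.
by rewrite !ler_norml => /andP[? ?] /andP[? ?]; split; lra.
Qed.

Let bdry_sub l z : cmod l <= 64^-1 -> on_bdry (-1) 1 (-1) 1 z -> 2^-1 <= cmod (z - l).
Proof.
move=> l1 /bdry_ge1 z1; have := cmodD (z - l) l; rewrite subrK; lra.
Qed.

Let bdry_neq l z : cmod l <= 64^-1 -> on_bdry (-1) 1 (-1) 1 z -> z != 0 /\ z - l != 0.
Proof.
move=> l1 zb; split; apply: cmod_neq0.
  by apply: lt_le_trans (bdry_ge1 zb).
by apply: lt_le_trans (bdry_sub l1 zb).
Qed.

Let bdryV z : on_bdry (-1) 1 (-1) 1 z -> ccont (fun w => w^-1) z.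
Proof.
move=> zb; apply: (@ccontV _ id); first exact: ccont_id.
by apply: cmod_neq0; apply: lt_le_trans (bdry_ge1 zb).
Qed.

Let bdryVl l z : cmod l <= 64^-1 -> on_bdry (-1) 1 (-1) 1 z -> ccont (fun w => (w - l)^-1) z.
Proof.
move=> l1 zb; apply: (@ccontV _ (fun w => w - l)); first exact: ccont_subl.
by case: (bdry_neq l1 zb).
Qed.

Let invz z : on_bdry (-1) 1 (-1) 1 z -> cmod z^-1 <= 1.
Proof.
move=> zb; rewrite cmodV -[leRHS]invr1 lef_pV2 ?posrE ?bdry_ge1//.
exact: lt_le_trans (bdry_ge1 zb).
Qed.

Let invzl l z : cmod l <= 64^-1 -> on_bdry (-1) 1 (-1) 1 z -> cmod (z - l)^-1 <= 2.
Proof.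
move=> l1 zb; rewrite cmodV -[leRHS]invrK lef_pV2 ?posrE ?bdry_sub//.
exact: lt_le_trans (bdry_sub l1 zb).
Qed.

Let Ibound G m : (forall z, on_bdry (-1) 1 (-1) 1 z -> ccont G z) ->
  (forall z, on_bdry (-1) 1 (-1) 1 z -> cmod (G z) <= m) -> cmod (I G) <= 16 * m.
Proof.
move=> Gc Gm; have := @cint_bound R G (-1) 1 (-1) 1 m N11 N11 Gc Gm.
by rewrite opprK (_ : 4 * m * _ = 16 * m)//; ring.
Qed.

Let G1 l w := H w * (w^-1 * (w - l)^-1).

Let cG1 l z : cmod l <= 64^-1 -> on_bdry (-1) 1 (-1) 1 z -> ccont (G1 l) z.
Proof.
move=> l1 zb; apply: ccontM; first exact: bdryH.
by apply: ccontM; [exact: bdryV|exact: bdryVl].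
Qed.

(** Cauchy's formula at [l] and at 0, subtracted: as [H 0 = 0], the integral of [H w / w] vanishes,
    and the difference of the two kernels has the factor [l]. *)
Let key1 l : cmod l <= 64^-1 ->
  H l * I (fun w => (w - l)^-1) = l * I (G1 l).
Proof.
move=> l1; have li := interior_small l1.
have c0 : I (fun w => H w / (w - l)) = H l * I (fun w => (w - l)^-1).
  rewrite /I -cintZ//; last by move=> z zb; exact: bdryVl.
  apply/eqP; rewrite -subr_eq0 -cintB//; first last.
  - by move=> z zb; apply: ccontM; [exact: ccont_cst|exact: bdryVl].
  - by move=> z zb; apply: ccontM; [exact: bdryH|exact: bdryVl].
  apply/eqP; rewrite -[RHS](cauchy_cint li Fd); congr Complex; apply: bdint_ext => w; rewrite /H; ring.
have c1 : I (fun w => H w / w) = 0.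
  rewrite -[RHS](cauchy_cint int0 Fd); congr Complex; apply: bdint_ext => w; rewrite subr0 /H; ring.
rewrite -c0 -[LHS]subr0 -c1 /I -cintB//; first last.
- by move=> z zb; apply: ccontM; [exact: bdryH|exact: bdryV].
- by move=> z zb; apply: ccontM; [exact: bdryH|exact: bdryVl].
rewrite -cintZ//; last by move=> z zb; exact: cG1.
apply: eq_cint => // z zb; have [z0 zl] := bdry_neq l1 zb.
by rewrite /G1; field; rewrite z0 zl.
Qed.

(** Both integrals equal [2 * pi * 'i]; a difference linear in [cmod l] is good enough, since it is
    multiplied by [H l], itself of first order. *)
Let key2 l : cmod l <= 64^-1 ->
  cmod (I (fun w => (w - l)^-1) - I (fun w => w^-1)) <= 32 * cmod l.
Proof.
move=> l1; rewrite /I -cintB//; last by move=> z zb; exact: bdryVl.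
rewrite (@eq_cint _ _ (fun w => l * (w^-1 * (w - l)^-1)))//; last first.
  move=> z zb; have [z0 zl] := bdry_neq l1 zb.
  by field; rewrite z0 zl.
rewrite cintZ//; last first.
  by move=> z zb; apply: ccontM; [exact: bdryV|exact: bdryVl].
rewrite cmodM mulrC ler_wpM2r ?cmod_ge0//.
rewrite (_ : 32 = 16 * 2); last by ring.
apply: Ibound.
  by move=> z zb; apply: ccontM; [exact: bdryV|exact: bdryVl].
move=> z zb; rewrite cmodM -[leRHS]mul1r.
by apply: ler_pM; rewrite ?cmod_ge0 ?invz ?invzl.
Qed.

(** The radius [64^-1] makes [32 * cmod l <= 2^-1], so the kernel integral at [l] still has modulus
    at least [2^-1] and can be divided out of [key1]. *)
Let lip l : cmod l <= 64^-1 -> cmod (H l) <= 128 * M * cmod l.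
Proof.
move=> l1; have k1 := key1 l1; have k2 := key2 l1; have k0 := cint_kernel_center.
have kl : 2^-1 <= cmod (I (fun w => (w - l)^-1)).
  have := cmodD (I (fun w => (w - l)^-1)) (I (fun w => w^-1) - I (fun w => (w - l)^-1)).
  rewrite subrKC -(cmodB (I (fun w => (w - l)^-1))) -/(I _) in k0 *; rewrite -/(I _) in k0; lra.
have b1 : cmod (I (G1 l)) <= 16 * (2 * M * 2).
  apply: Ibound; first by move=> z zb; exact: cG1.
  move=> z zb; rewrite /G1 2!cmodM; apply: ler_pM; rewrite ?mulr_ge0 ?cmod_ge0//.
    by apply: HM; case: zb.
  by rewrite -[leRHS]mul1r; apply: ler_pM; rewrite ?cmod_ge0 ?invz ?invzl.
have := congr1 (@cmod R) k1; rewrite !cmodM => e.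
have : cmod (H l) * 2^-1 <= cmod l * (16 * (2 * M * 2)).
  rewrite (@le_trans _ _ (cmod (H l) * cmod (I (fun w => (w - l)^-1))))//.
    by rewrite ler_wpM2l ?cmod_ge0.
  by rewrite e ler_wpM2l ?cmod_ge0.
lra.
Qed.

(** A Taylor estimate whose constants depend on the bound [M] alone; this uniformity is what lets
    derivatives pass to limits later. *)
Lemma cdiff_taylor : exists2 b : R[i], cmod b <= 32 * M & forall l, cmod l <= 64^-1 ->
  cmod (F l - F 0 - b * l) <= 5000 * M * cmod l ^+ 2.
Proof.
pose I0 := I (fun w => w^-1); have k0 : 1 <= cmod I0 by exact: cint_kernel_center.
have I00 : I0 != 0 by apply: cmod_neq0; lra.
pose G0 w := H w * (w^-1 * w^-1).
have cG0 z : on_bdry (-1) 1 (-1) 1 z -> ccont G0 z.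
  move=> zb; apply: ccontM; first exact: bdryH.
  by apply: ccontM; exact: bdryV.
have Vb (x y : R) : 0 <= x -> x / cmod I0 <= x.
  by move=> x0; rewrite ler_pdivrMr ?ler_peMr//; lra.
(* Cauchy's formula for the derivative at 0, normalised by the kernel integral [I0] in place of
   [2 * pi * 'i]. *)
exists (I G0 / I0).
  rewrite cmodM cmodV (@le_trans _ _ (cmod (I G0)))//; first exact: (Vb _ 0 (cmod_ge0 _)).
  rewrite (_ : 32 * M = 16 * (2 * M)); last by ring.
  apply: Ibound => // z zb; rewrite /G0 2!cmodM -[leRHS]mulr1.
  apply: ler_pM; rewrite ?mulr_ge0 ?cmod_ge0//; first by apply: HM; case: zb.
  by rewrite -[leRHS]mul1r; apply: ler_pM; rewrite ?cmod_ge0 ?invz.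
move=> l l1; have k1 := key1 l1; have k2 := key2 l1; have hl := lip l1.
pose G2 w := H w * (w^-1 * w^-1 * (w - l)^-1).
have cG2 z : on_bdry (-1) 1 (-1) 1 z -> ccont G2 z.
  move=> zb; apply: ccontM; first exact: bdryH.
  by apply: ccontM; [apply: ccontM; exact: bdryV|exact: bdryVl].
have e1 : I (G1 l) - I G0 = l * I G2.
  rewrite /I -cintB//; last by move=> z zb; exact: cG1.
  rewrite -cintZ//; apply: eq_cint => // z zb; have [z0 zl] := bdry_neq l1 zb.
  by rewrite /G1 /G0 /G2; field; rewrite z0 zl.
have b2 : cmod (I G2) <= 16 * (2 * M * 2).
  apply: Ibound => // z zb; rewrite /G2 3!cmodM; apply: ler_pM; rewrite ?mulr_ge0 ?cmod_ge0//.
    by apply: HM; case: zb.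
  rewrite -[leRHS]mul1r; apply: ler_pM; rewrite ?mulr_ge0 ?cmod_ge0 ?invzl//.
  by rewrite -[leRHS]mul1r; apply: ler_pM; rewrite ?cmod_ge0 ?invz.
have -> : F l - F 0 - I G0 / I0 * l =
    (l ^+ 2 * I G2 - H l * (I (fun w => (w - l)^-1) - I0)) / I0.
  have -> : l ^+ 2 * I G2 = l * (l * I G2) by ring.
  rewrite -e1 mulrBr -k1 -/(H l); field; exact: I00.
rewrite cmodM cmodV (le_trans (Vb _ 0 (cmod_ge0 _)))//.
rewrite (le_trans (cmodD _ _))// cmodN.
apply: (@le_trans _ _ (cmod l ^+ 2 * (16 * (2 * M * 2)) + 128 * M * cmod l * (32 * cmod l))).
  apply: lerD; rewrite ?cmodM; last by apply: ler_pM; rewrite ?cmod_ge0.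
  by rewrite -cmodM -expr2 cmodX ler_wpM2l ?exprn_ge0 ?cmod_ge0.
have := mulr_ge0 M0 (sqr_ge0 (cmod l)).
(* 4160 is [64 + 128 * 32]; the statement rounds it up. *)
rewrite (_ : _ + _ = 4160 * (M * cmod l ^+ 2)); last by ring.
rewrite -mulrA; lra.
Qed.
End Estimate.
End TaylorEstimate.

(** * The truncated mean value inequality on squares *)

Section AreaMean.
Context {R : realType}.
Implicit Types (F : R[i] -> R[i]) (phi : R[i] -> R) (w z : R[i]) (a b c d x y : R).

Definition ramp (A r : R) : R := Num.max 0 (r - A).

Lemma ramp_ge0 A r : 0 <= ramp A r. Proof. by rewrite le_max lexx. Qed.
Lemma ramp_ge A r : r - A <= ramp A r. Proof. by rewrite le_max lexx orbT. Qed.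
Lemma ramp_le A r t : 0 <= t -> r - A <= t -> ramp A r <= t.
Proof. by move=> t0 h; rewrite ge_max t0. Qed.
Lemma ramp_dist A r t : `|ramp A r - ramp A t| <= `|r - t|.
Proof.
have h1 := ler_norm (r - t); have h2 := ler_norm (t - r); rewrite distrC in h2.
by rewrite /ramp; case: (leP 0 (r - A)) => ?; case: (leP 0 (t - A)) => ?;
  rewrite ler_norml; apply/andP; split; lra.
Qed.

Definition rcont phi z := forall e, 0 < e -> exists2 r, 0 < r &
  forall w, cmod (w - z) < r -> `|phi w - phi z| < e.

Lemma rcont_cmod F z : ccont F z -> rcont (fun w => cmod (F w)) z.
Proof.
move=> Fc e e0; have [r r0 h] := Fc e e0; exists r => // w /h.
by apply: le_lt_trans; exact: cmod_dist.
Qed.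

Lemma rcont_ramp A phi z : rcont phi z -> rcont (fun w => ramp A (phi w)) z.
Proof.
move=> pc e e0; have [r r0 h] := pc e e0; exists r => // w /h.
by apply: le_lt_trans; exact: ramp_dist.
Qed.

Lemma rcont_horz phi a b c : (forall x, a <= x <= b -> rcont phi (Complex x c)) ->
  cts_on (fun x => phi (Complex x c)) a b.
Proof.
move=> h x xab e e0; have [d d0 hd] := h x xab e e0; exists d => // y yd.
apply: hd; rewrite (_ : _ - _ = Complex (y - x) 0) ?cmodr//.
by congr Complex; rewrite subrr.
Qed.

Lemma rcont_vert phi a c d : (forall y, c <= y <= d -> rcont phi (Complex a y)) ->
  cts_on (fun y => phi (Complex a y)) c d.
Proof.
move=> h x xab e e0; have [r r0 hr] := h x xab e e0; exists r => // y yd.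
apply: hr; rewrite (_ : _ - _ = Complex 0 (y - x)).
  by rewrite /cmod/= expr0n add0r sqrtr_sqr.
by congr Complex; rewrite subrr.
Qed.

(** [bdint] sees only a real part. Rotating the value onto the negative imaginary axis makes the
    Cauchy integral of [k * F] real and positive, so its whole modulus is seen. *)
Lemma rot_to_axis z : exists2 k : R[i], cmod k = 1 & k * z = Complex 0 (- cmod z).
Proof.
have [->|z0] := eqVneq z 0.
  by exists 1; rewrite ?cmod1// mulr0 cmod0 oppr0.
have m0 := cmod_gt0 z0.
have e : cmod (Complex 0 (- cmod z)) = cmod z.
  by rewrite {1}/cmod/= expr0n add0r sqrtr_sqr normrN ger0_norm ?cmod_ge0.
exists (Complex 0 (- cmod z) / z); last by rewrite divfK.
by rewrite cmodM cmodV e mulfV// lt0r_neq0.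
Qed.

(** A rectangle around [z0] with every side at distance between [S / 2] and [S]; the slack in each
    direction is what the choice of good sides exploits. *)
Definition frame (z0 : R[i]) (S a b c d : R) :=
  [/\ complex.Re z0 - S <= a <= complex.Re z0 - S / 2,
  complex.Re z0 + S / 2 <= b <= complex.Re z0 + S,
  complex.Im z0 - S <= c <= complex.Im z0 - S / 2 &
  complex.Im z0 + S / 2 <= d <= complex.Im z0 + S].

Lemma frame_bdry z0 S a b c d z : 0 < S -> frame z0 S a b c d -> on_bdry a b c d z ->
  S / 2 <= cmod (z - z0).
Proof.
move=> S0 [h1 h2 h3 h4] [_ [] e].
- apply: le_trans (Re_le_cmod _); rewrite ReD ReN e ler0_norm; lra.
- apply: le_trans (Re_le_cmod _); rewrite ReD ReN e ger0_norm; lra.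
- apply: le_trans (Im_le_cmod _); rewrite ImD ImN e ler0_norm; lra.
- apply: le_trans (Im_le_cmod _); rewrite ImD ImN e ger0_norm; lra.
Qed.

(** Cauchy's formula for the rotated function: on the boundary the kernel is at most [2 / S], and
    [bdint_inv_ge] bounds the left side from below. *)
Lemma boundary_mean F z0 S a b c d : 0 < S -> frame z0 S a b c d ->
  diff_rect F a b c d ->
  cmod (F z0) <= 2 / S *
   (seg (fun x => cmod (F (Complex x c)) + cmod (F (Complex x d))) a b +
    seg (fun y => cmod (F (Complex a y)) + cmod (F (Complex b y))) c d).
Proof.
move=> S0 fr Fd; have [h1 h2 h3 h4] := fr.
have ab : a <= b by lra. have cd : c <= d by lra.
have zi : interior_pt a b c d z0 by split; lra.
have [k k1 kF] := rot_to_axis (F z0).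
have Fc := diff_rect_cont Fd.
pose G w := k * F w / (w - z0).
have cG : cont_bdry G a b c d.
  move=> z zb; apply: ccont_div_subl; first exact: interior_neq_bdry zb.
  by apply: ccontM; [exact: ccont_cst|apply: Fc; case: zb].
have -> : 2 / S * (seg (fun x => cmod (F (Complex x c)) + cmod (F (Complex x d))) a b +
    seg (fun y => cmod (F (Complex a y)) + cmod (F (Complex b y))) c d) =
    seg (fun x => 2 / S * (cmod (F (Complex x c)) + cmod (F (Complex x d)))) a b -
    seg (fun y => - (2 / S) * (cmod (F (Complex a y)) + cmod (F (Complex b y)))) c d.
  rewrite !segZ; first ring.
    apply: cts_onD; apply: (@rcont_vert (fun w => cmod (F w))) => y ycd;
    by apply/rcont_cmod/Fc; split => //=; lra.
  apply: cts_onD; apply: (@rcont_horz (fun w => cmod (F w))) => y ycd;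
  by apply/rcont_cmod/Fc; split => //=; lra.
have hc y : c <= y <= d -> cts_on (fun x => cmod (F (Complex x y))) a b.
  move=> ycd; apply: (@rcont_horz (fun w => cmod (F w))) => x xab.
  by apply/rcont_cmod/Fc; split => //=; lra.
have vc x : a <= x <= b -> cts_on (fun y => cmod (F (Complex x y))) c d.
  move=> xab; apply: (@rcont_vert (fun w => cmod (F w))) => y ycd.
  by apply/rcont_cmod/Fc; split => //=; lra.
have Zc (g : R -> R) (m : R) a' b' : cts_on g a' b' -> cts_on (fun x => m * g x) a' b'.
  move=> gc x xab e e0; have m0 : 0 < `|m| + 1 by rewrite ltr_wpDl.
  have [r r0 hr] := gc x xab _ (divr_gt0 e0 m0); exists r => // y /hr.
  rewrite ltr_pdivlMr// -mulrBr normrM; apply: le_lt_trans.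
  by rewrite mulrC ler_wpM2l//; lra.
have Gle z : on_bdry a b c d z -> cmod (G z) <= 2 / S * cmod (F z).
  move=> zb; have := frame_bdry S0 fr zb => dz.
  rewrite /G 2!cmodM k1 mul1r cmodV mulrC ler_wpM2r ?cmod_ge0//.
  by rewrite -[leRHS]invf_div lef_pV2 ?posrE ?divr_gt0//; apply: lt_le_trans dz; rewrite divr_gt0.
have := @bdint_inv_ge R z0 (cmod (F z0)) S a b c d S0 (cmod_ge0 _) h1 h2 h3 h4.
have -> : bdint (fun w => Complex 0 (- cmod (F z0)) / (w - z0)) a b c d = bdint G a b c d.
  rewrite -[RHS]subr0 -[X in _ = _ - X](cauchy_bdint k zi Fd) -bdintB//; last first.
    move=> z zb; apply: ccontM; first exact: ccont_cst.
    apply: ccont_div_subl; first exact: interior_neq_bdry zb.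
    by apply: ccontB; [apply: Fc; case: zb|exact: ccont_cst].
  by apply: bdint_ext => w; rewrite -kF /G; ring.
move/le_trans; apply; have [g1 g2 g3 g4] := bdry_sides ab cd cG.
apply: lerB; apply: seg_le.
- exact: cts_onB.
- by apply: Zc; apply: cts_onD; apply: hc; lra.
- move=> x xab; rewrite mulrDr; apply: le_trans (ler_norm _) _.
  apply: le_trans (ler_normB _ _) _; apply: lerD; apply: le_trans (Re_le_cmod _) _; apply: Gle.
    by split; [split => //=; lra|exact: Or43].
  by split; [split => //=; lra|exact: Or44].
- by apply: Zc; apply: cts_onD; apply: vc; lra.
- exact: cts_onB.
- move=> y ycd; rewrite mulNr lerNl mulrDr; apply: le_trans (ler_norm _) _; rewrite normrN.
  rewrite [leRHS]addrC; apply: le_trans (ler_normB _ _) _; apply: lerD; apply: le_trans (Im_le_cmod _) _; apply: Gle.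
    by split; [split => //=; lra|exact: Or42].
  by split; [split => //=; lra|exact: Or41].
Qed.

(** Since [cmod (F w) <= ramp A (cmod (F w)) + A] and the perimeter is at most [8 * S], the level
    contributes [2 / S * (8 * A * S) = 16 * A]. *)
Lemma boundary_mean_ramp F z0 S a b c d A : 0 < S -> 0 <= A -> frame z0 S a b c d ->
  diff_rect F a b c d ->
  cmod (F z0) - 16 * A <= 2 / S *
   (seg (fun x => ramp A (cmod (F (Complex x c))) + ramp A (cmod (F (Complex x d)))) a b +
    seg (fun y => ramp A (cmod (F (Complex a y))) + ramp A (cmod (F (Complex b y)))) c d).
Proof.
move=> S0 A0 fr Fd; have [h1 h2 h3 h4] := fr.
have ab : a <= b by lra. have cd : c <= d by lra.
have Fc := diff_rect_cont Fd.
have hc y : c <= y <= d -> cts_on (fun x => cmod (F (Complex x y))) a b.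
  move=> ycd; apply: (@rcont_horz (fun w => cmod (F w))) => x xab.
  by apply/rcont_cmod/Fc; split => //=; lra.
have vc x : a <= x <= b -> cts_on (fun y => cmod (F (Complex x y))) c d.
  move=> xab; apply: (@rcont_vert (fun w => cmod (F w))) => y ycd.
  by apply/rcont_cmod/Fc; split => //=; lra.
have rc (g : R -> R) a' b' : cts_on g a' b' -> cts_on (fun x => ramp A (g x)) a' b'.
  move=> gc x xab e e0; have [r r0 hr] := gc x xab e e0; exists r => // y /hr.
  by apply: le_lt_trans; exact: ramp_dist.
rewrite lerBlDr (le_trans (boundary_mean S0 fr Fd))//.
set X := seg (fun x => ramp A _ + _) a b; set Y := seg (fun y => ramp A _ + _) c d.
have X1 : seg (fun x => cmod (F (Complex x c)) + cmod (F (Complex x d))) a b <= X + 2 * A * (b - a).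
  rewrite -seg_cst// -segD//; last 2 first.
  - by apply: cts_onD; apply/rc/hc; lra.
  - exact: cts_on_cst.
  apply: seg_le.
  - by apply: cts_onD; apply: hc; lra.
  - by apply: cts_onD; [apply: cts_onD; apply/rc/hc; lra|exact: cts_on_cst].
  - move=> x _; have := ramp_ge A (cmod (F (Complex x c))); have := ramp_ge A (cmod (F (Complex x d))); lra.
have Y1 : seg (fun y => cmod (F (Complex a y)) + cmod (F (Complex b y))) c d <= Y + 2 * A * (d - c).
  rewrite -seg_cst// -segD//; last 2 first.
  - by apply: cts_onD; apply/rc/vc; lra.
  - exact: cts_on_cst.
  apply: seg_le.
  - by apply: cts_onD; apply: vc; lra.
  - by apply: cts_onD; [apply: cts_onD; apply/rc/vc; lra|exact: cts_on_cst].
  - move=> y _; have := ramp_ge A (cmod (F (Complex a y))); have := ramp_ge A (cmod (F (Complex b y))); lra.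
apply: (@le_trans _ _ (2 / S * (X + Y + 8 * A * S))).
  rewrite ler_pM2l ?divr_gt0//; apply: le_trans (lerD X1 Y1) _.
  have : A * (b - a) <= A * (2 * S) by rewrite ler_wpM2l//; lra.
  have : A * (d - c) <= A * (2 * S) by rewrite ler_wpM2l//; lra.
  lra.
rewrite (_ : 2 / S * (X + Y + 8 * A * S) = 2 / S * (X + Y) + 16 * A)//.
by field; rewrite lt0r_neq0.
Qed.

(** A weak maximum principle: the factor 16 is again [2 / S] times the perimeter [8 * S]. *)
Lemma boundary_sup F z0 S M : 0 < S ->
  diff_rect F (complex.Re z0 - S) (complex.Re z0 + S) (complex.Im z0 - S) (complex.Im z0 + S) ->
  (forall z, on_bdry (complex.Re z0 - S) (complex.Re z0 + S) (complex.Im z0 - S) (complex.Im z0 + S) z ->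
    cmod (F z) <= M) ->
  cmod (F z0) <= 16 * M.
Proof.
move=> S0; set a := _ - S; set b := _ + S; set c := _ - S; set d := _ + S => Fd FM.
have fr : frame z0 S a b c d by rewrite /a /b /c /d; split; lra.
have ab : a <= b by rewrite /a /b; lra. have cd : c <= d by rewrite /c /d; lra.
have Fc := diff_rect_cont Fd.
have hc y : c <= y <= d -> cts_on (fun x => cmod (F (Complex x y))) a b.
  move=> ycd; apply: (@rcont_horz (fun w => cmod (F w))) => x xab.
  by apply/rcont_cmod/Fc; split => //=; lra.
have vc x : a <= x <= b -> cts_on (fun y => cmod (F (Complex x y))) c d.
  move=> xab; apply: (@rcont_vert (fun w => cmod (F w))) => y ycd.
  by apply/rcont_cmod/Fc; split => //=; lra.
apply: le_trans (boundary_mean S0 fr Fd) _.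
have X1 : seg (fun x => cmod (F (Complex x c)) + cmod (F (Complex x d))) a b <= (M + M) * (b - a).
  rewrite -seg_cst//; apply: seg_le.
  - by apply: cts_onD; apply: hc; lra.
  - exact: cts_on_cst.
  - by move=> x xab; apply: lerD; apply: FM; (split; [split => //=; lra|]); [exact: Or43|exact: Or44].
have Y1 : seg (fun y => cmod (F (Complex a y)) + cmod (F (Complex b y))) c d <= (M + M) * (d - c).
  rewrite -seg_cst//; apply: seg_le.
  - by apply: cts_onD; apply: vc; lra.
  - exact: cts_on_cst.
  - by move=> x xab; apply: lerD; apply: FM; (split; [split => //=; lra|]); [exact: Or41|exact: Or42].
apply: (@le_trans _ _ (2 / S * (8 * M * S))).
  rewrite ler_pM2l ?divr_gt0//; apply: le_trans (lerD X1 Y1) _.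
  by rewrite le_eqVlt; apply/orP; left; apply/eqP; rewrite /a /b /c /d; ring.
by rewrite le_eqVlt; apply/orP; left; apply/eqP; field; rewrite lt0r_neq0.
Qed.

Notation mu := (@lebesgue_measure R).

Lemma integral_pigeonhole (f : R -> \bar R) p q (J J' : R) : p < q ->
  (forall x, 0 <= f x)%E -> (\int[mu]_x f x <= J%:E)%E -> J < J' ->
  exists2 c, p < c < q & (f c <= (J' / (q - p))%:E)%E.
Proof.
move=> pq f0 fJ JJ'; apply: contrapT => nex.
have h c : p < c < q -> ((J' / (q - p))%:E < f c)%E.
  by move=> cpq; rewrite ltNge; apply/negP => le; apply: nex; exists c.
have J0 : 0 <= J by rewrite -lee_fin (le_trans _ fJ)// integral_ge0.
have qp : 0 < q - p by rewrite subr_gt0.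
have J'0 : 0 <= J' / (q - p) by rewrite divr_ge0 ?ltW// (le_lt_trans J0 JJ').
have : (J'%:E <= \int[mu]_x f x)%E.
  rewrite (_ : J'%:E = \int[mu]_(x in `]p, q[) (J' / (q - p))%:E)%E; last first.
    rewrite integral_cst//= lebesgue_measure_itv/= lte_fin pq -EFinD -EFinM.
    by congr EFin; rewrite divfK// lt0r_neq0.
  rewrite integral_mkcond; apply: ge0_le_integralT.
    by move=> x; rewrite patchE; case: ifP.
  move=> x; rewrite patchE; case: ifPn => [|_]; last exact: f0.
  by rewrite inE/= in_itv/= => /h/ltW.
by move=> /le_trans/(_ fJ); rewrite lee_fin leNgt JJ'.
Qed.

Lemma seg_integral_le (g : R -> R) (f : R -> \bar R) a b : cts_on g a b ->
  (forall x, a <= x <= b -> 0 <= g x) -> (forall x, 0 <= f x)%E ->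
  (forall x, a <= x <= b -> ((g x)%:E <= f x)%E) -> ((seg g a b)%:E <= \int[mu]_x f x)%E.
Proof.
move=> gc g0 f0 gf; rewrite /seg /Rintegral fineK; last first.
  by apply: integrable_fin_num => //; exact: seg_integrable.
rewrite integral_mkcond; apply: ge0_le_integralT.
  by move=> x; rewrite patchE; case: ifPn => //; rewrite inE/= in_itv/= lee_fin; exact: g0.
by move=> x; rewrite patchE; case: ifPn => [|_]; [rewrite inE/= in_itv/=; exact: gf|exact: f0].
Qed.

Definition in_box z0 S (u t : R) :=
  (`|u - complex.Re z0| < S) && (`|t - complex.Im z0| < S).

(** Each side of a frame can be chosen in a strip of width [S / 2] so that its line integral is at
    most about [J / (S / 2)], where [J] is the area integral. Four such sides in
    [boundary_mean_ramp] give [16 * J / S ^+ 2]. *)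
Lemma area_mean_ramp F z0 S A : 0 < S -> 0 <= A ->
  (forall u t, in_box z0 S u t -> cdiff F (Complex u t)) ->
  ((S ^+ 2 / 16 * (cmod (F z0) - 16 * A))%:E <=
   \int[mu]_t \int[mu]_u (if in_box z0 S u t then ramp A (cmod (F (Complex u t))) else 0)%:E)%E.
Proof.
move=> S0 A0 Fd.
pose V t u : R := if in_box z0 S u t then ramp A (cmod (F (Complex u t))) else 0.
rewrite -/(V _ _) -[leRHS]/(\int[mu]_t \int[mu]_u (V t u)%:E)%E.
have V0 t u : 0 <= V t u by rewrite /V; case: ifP => _; rewrite ?ramp_ge0.
have cW u t : in_box z0 S u t -> rcont (fun w => ramp A (cmod (F w))) (Complex u t).
  by move=> /Fd/cdiff_cont Fc; apply/rcont_ramp/rcont_cmod.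
have mV : measurable_fun setT (fun tu : R * R => (V tu.1 tu.2)%:E).
  apply/measurable_EFinP.
  pose g (tu : R * R) (i : nat) := if i == 0%N then tu.2 else tu.1.
  have := @measurable_coord_fun R _ _ g 2 [set x : nat -> R | in_box z0 S (x 0%N) (x 1%N)]
    (fun x : nat -> R => ramp A (cmod (F (Complex (x 0%N) (x 1%N))))).
  set h := (X in measurable_fun _ X) => mh.
  have -> : (fun tu : R * R => V tu.1 tu.2) = h.
    by apply/funext => -[t u]; rewrite /V /h /g/= asboolb.
  apply: mh.
    by move=> i; rewrite /g; case: eqP => _; [exact: measurable_snd|exact: measurable_fst].
  move=> x /= xb e e0; have [r r0 hr] := cW _ _ xb e e0.
  have := xb; rewrite /in_box => /andP[b1 b2].
  pose s := Num.min (r / 2) (Num.min (S - `|x 0%N - complex.Re z0|) (S - `|x 1%N - complex.Im z0|)).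
  have s0 : 0 < s by rewrite /s !lt_min divr_gt0//= !subr_gt0 b1 b2.
  exists s => // y xy; have := xy 0%N isT; have := xy 1%N isT.
  rewrite /s !lt_min => /and3P[y1 _ y2] /and3P[y3 y4 _]; split.
    have t0 := ler_normD (y 0%N - x 0%N) (x 0%N - complex.Re z0).
    have t1 := ler_normD (y 1%N - x 1%N) (x 1%N - complex.Im z0).
    by rewrite addrA subrK in t0; rewrite addrA subrK in t1; apply/andP; split; lra.
  apply: hr; apply: le_lt_trans (cmod_le _) _; rewrite ReD ReN ImD ImN/=; lra.
have JT : (\int[mu]_u \int[mu]_t (V t u)%:E = \int[mu]_t \int[mu]_u (V t u)%:E)%E.
  apply/esym; apply: (fubini_tonelli (m1 := mu) (m2 := mu) (fun tu => (V tu.1 tu.2)%:E)) => //.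
  by move=> x; rewrite lee_fin.
(* Vertical sides are selected with one order of integration and horizontal sides with the other, so
   both iterated integrals are bounded by one [J]. *)
suff h (J : \bar R) : (\int[mu]_t \int[mu]_u (V t u)%:E <= J)%E ->
    (\int[mu]_u \int[mu]_t (V t u)%:E <= J)%E ->
    ((S ^+ 2 / 16 * (cmod (F z0) - 16 * A))%:E <= J)%E.
  by apply: h; rewrite ?JT lexx.
have J00 : (0 <= \int[mu]_t \int[mu]_u (V t u)%:E)%E.
  by apply: integral_ge0 => t _; apply: integral_ge0 => u _; rewrite lee_fin.
case: J => [j JJ JJT|_ _|/(le_trans J00)]; [|exact: leey|by []].
(* The pigeonhole principle asks for a bound strictly above the integral; [e] provides it. *)
rewrite lee_fin; apply/ler_addgt0Pl => e e0.
have je : j < e + j by lra.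
have H0 t : (0 <= \int[mu]_u (V t u)%:E)%E by apply: integral_ge0 => u _; rewrite lee_fin.
have H1 u : (0 <= \int[mu]_t (V t u)%:E)%E by apply: integral_ge0 => t _; rewrite lee_fin.
have S2 : 0 < S / 2 by rewrite divr_gt0.
have [c cr hc] := @integral_pigeonhole _ (complex.Im z0 - S) (complex.Im z0 - S / 2) j (e + j) ltac:(lra) H0 JJ je.
have [d dr hd] := @integral_pigeonhole _ (complex.Im z0 + S / 2) (complex.Im z0 + S) j (e + j) ltac:(lra) H0 JJ je.
have [a ar ha] := @integral_pigeonhole _ (complex.Re z0 - S) (complex.Re z0 - S / 2) j (e + j) ltac:(lra) H1 JJT je.
have [b br hb] := @integral_pigeonhole _ (complex.Re z0 + S / 2) (complex.Re z0 + S) j (e + j) ltac:(lra) H1 JJT je.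
have q1 : complex.Im z0 - S / 2 - (complex.Im z0 - S) = S / 2 by field.
have q2 : complex.Im z0 + S - (complex.Im z0 + S / 2) = S / 2 by field.
have q3 : complex.Re z0 - S / 2 - (complex.Re z0 - S) = S / 2 by field.
have q4 : complex.Re z0 + S - (complex.Re z0 + S / 2) = S / 2 by field.
rewrite q1 in hc; rewrite q2 in hd; rewrite q3 in ha; rewrite q4 in hb.
have inb u t : a <= u <= b -> c <= t <= d -> in_box z0 S u t.
  by move=> ur tr; rewrite /in_box !ltr_distl; clear -ar br cr dr ur tr; apply/andP; split; apply/andP; split; lra.
have fr : frame z0 S a b c d by clear -ar br cr dr; split; lra.
have Fr : diff_rect F a b c d by move=> [u t] [ur tr]; apply: Fd; exact: inb.
have hS y : c <= y <= d -> (\int[mu]_u (V y u)%:E <= ((e + j) / (S / 2))%:E)%E ->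
    cts_on (fun x => ramp A (cmod (F (Complex x y)))) a b /\
    seg (fun x => ramp A (cmod (F (Complex x y)))) a b <= (e + j) / (S / 2).
  move=> ycd hy; have ct : cts_on (fun x => ramp A (cmod (F (Complex x y)))) a b.
    by apply: (@rcont_horz (fun w => ramp A (cmod (F w)))) => x xab; apply/cW/inb.
  split; first exact: ct.
  rewrite -lee_fin; apply: le_trans hy; apply: (seg_integral_le ct).
  - by move=> ? _; exact: ramp_ge0.
  - by move=> ?; rewrite lee_fin; exact: V0.
  - by move=> x xab; rewrite /V inb.
have vS x : a <= x <= b -> (\int[mu]_t (V t x)%:E <= ((e + j) / (S / 2))%:E)%E ->
    cts_on (fun y => ramp A (cmod (F (Complex x y)))) c d /\
    seg (fun y => ramp A (cmod (F (Complex x y)))) c d <= (e + j) / (S / 2).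
  move=> xab hx; have ct : cts_on (fun y => ramp A (cmod (F (Complex x y)))) c d.
    by apply: (@rcont_vert (fun w => ramp A (cmod (F w)))) => y ycd; apply/cW/inb.
  split; first exact: ct.
  rewrite -lee_fin; apply: le_trans hx; apply: (seg_integral_le ct).
  - by move=> ? _; exact: ramp_ge0.
  - by move=> ?; rewrite lee_fin; exact: V0.
  - by move=> y ycd; rewrite /V inb.
have [abr cdr] : a <= b /\ c <= d by clear -ar br cr dr S2; split; lra.
have [c1 c2] := hS c ltac:(by rewrite lexx cdr) hc; have [d1 d2] := hS d ltac:(by rewrite lexx cdr) hd.
have [a1 a2] := vS a ltac:(by rewrite lexx abr) ha; have [b1 b2] := vS b ltac:(by rewrite lexx abr) hb.
clear hS vS hc hd ha hb JJ JJT J00 JT mV H0 H1.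
have := boundary_mean_ramp S0 A0 fr Fr; rewrite (segD c1 d1) (segD a1 b1) => bm.
have : cmod (F z0) - 16 * A <= 2 / S * (4 * ((e + j) / (S / 2))).
  apply: le_trans bm _; clear -c2 d2 a2 b2 S0; rewrite ler_pM2l; last by rewrite divr_gt0.
  have := lerD (lerD c2 d2) (lerD a2 b2); move/le_trans; apply.
  by rewrite le_eqVlt; apply/orP; left; apply/eqP; ring.
clear -S0; move=> bm2; have S2' : 0 < S ^+ 2 / 16 by rewrite divr_gt0// exprn_gt0.
move: bm2; rewrite -(ler_pM2l S2') => /le_trans; apply.
by rewrite le_eqVlt; apply/orP; left; apply/eqP; field; rewrite lt0r_neq0.
Qed.
End AreaMean.

(** * Holomorphic functions on the ball *)

Section Holomorphic.
Context {R : realType} {N : nat}.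
Implicit Types (z v w h : cvec R N) (f g : cvec R N -> R[i]).

Definition vcont f z := forall e : R, 0 < e -> exists2 r, 0 < r &
  forall w, vnorm (vsub w z) < r -> cmod (f w - f z) < e.

Lemma vsubK z w : vadd z (vsub w z) = w.
Proof. by rewrite vadd_vsub. Qed.

Lemma holo_dcont f z (a : 'I_N -> R[i]) (e r : R) :
  0 < e -> (forall h, vnorm h < r -> cmod (f (vadd z h) - f z - \sum_k a k * h k) <= e * vnorm h) ->
  forall w, vnorm (vsub w z) < r ->
    cmod (f w - f z) <= (e + \sum_k cmod (a k)) * vnorm (vsub w z).
Proof.
move=> e0 hr w wr; have := hr _ wr; rewrite vsubK => le.
rewrite -(subrK (\sum_k a k * vsub w z k) (f w - f z)) (le_trans (cmodD _ _))//.
by rewrite mulrDl lerD// cmod_dot_le.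
Qed.

Lemma sum_cmod_ge0 (a : 'I_N -> R[i]) : 0 <= \sum_k cmod (a k).
Proof. by rewrite sumr_ge0// => k _; exact: cmod_ge0. Qed.

Lemma holo_vcont f z : holo f -> vnorm z < 1 -> vcont f z.
Proof.
move=> hf z1 e e0; have [a ha] := hf z z1; have [r r0 hr] := ha 1 ltr01.
have s0 := sum_cmod_ge0 a; set s := \sum_k _ in s0.
have s1 : 0 < 1 + s by lra.
exists (Num.min r (e / (1 + s))); first by rewrite lt_min r0 divr_gt0.
move=> w; rewrite lt_min ltr_pdivlMr// mulrC => /andP[wr we].
by rewrite (le_lt_trans (holo_dcont ltr01 hr wr)).
Qed.

Lemma holo_affine f (b v : cvec R N) (l0 : R[i]) : holo f ->
  vnorm (fun i => b i + l0 * v i) < 1 -> cdiff (fun l => f (fun i => b i + l * v i)) l0.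
Proof.
move=> hf p1; have [a ha] := hf _ p1; exists (\sum_k a k * v k) => e e0.
have v0 : 0 < vnorm v + 1 by rewrite ltr_wpDl ?vnorm_ge0.
have [r r0 hr] := ha _ (divr_gt0 e0 v0).
exists (r / (vnorm v + 1)); first by rewrite divr_gt0.
move=> l lr; pose h := cscale (l - l0) v.
have hn : vnorm h = cmod (l - l0) * vnorm v by exact: vnorm_cscale.
have hlt : vnorm h < r.
  rewrite hn; apply: (@le_lt_trans _ _ (cmod (l - l0) * (vnorm v + 1))).
    by rewrite ler_wpM2l ?cmod_ge0//; lra.
  by rewrite -ltr_pdivlMr.
have := hr h hlt.
have -> : vadd (fun i => b i + l0 * v i) h = (fun i => b i + l * v i).
  by apply/funext => i; rewrite /vadd /h /cscale; ring.
have -> : \sum_k a k * h k = (\sum_k a k * v k) * (l - l0).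
  by rewrite mulr_suml; apply: eq_bigr => k _; rewrite /h /cscale; ring.
move/le_trans; apply; rewrite hn mulrCA -mulrA [leRHS]mulrC ler_wpM2l ?cmod_ge0//.
rewrite ler_piMr; [by []|exact: ltW|by rewrite mulrC ler_pdivrMr//; lra].
Qed.

Lemma holo_cst (k : R[i]) : holo (fun _ : cvec R N => k).
Proof.
move=> z _; exists (fun=> 0) => e e0; exists 1 => // h _.
rewrite subrr sub0r cmodN big1 ?cmod0; first by rewrite mulr_ge0 ?vnorm_ge0// ltW.
by move=> i _; rewrite mul0r.
Qed.

Lemma holo_linear (a : 'I_N -> R[i]) : holo (fun z : cvec R N => \sum_k a k * z k).
Proof.
move=> z _; exists a => e e0; exists 1 => // h _.
rewrite -!sumrB big1 ?cmod0; first by rewrite mulr_ge0 ?vnorm_ge0// ltW.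
by move=> i _; rewrite /vadd; ring.
Qed.

Lemma holoD f g : holo f -> holo g -> holo (fun z => f z + g z).
Proof.
move=> hf hg z z1; have [a ha] := hf z z1; have [b hb] := hg z z1.
exists (fun k => a k + b k) => e e0; have e2 : 0 < e / 2 by lra.
have [r1 r10 h1] := ha _ e2; have [r2 r20 h2] := hb _ e2.
exists (Num.min r1 r2); first by rewrite lt_min r10.
move=> h; rewrite lt_min => /andP[/h1 l1 /h2 l2].
have -> : f (vadd z h) + g (vadd z h) - (f z + g z) - \sum_k (a k + b k) * h k =
   (f (vadd z h) - f z - \sum_k a k * h k) + (g (vadd z h) - g z - \sum_k b k * h k).
  by under eq_bigr do rewrite mulrDl; rewrite big_split/=; ring.
rewrite (le_trans (cmodD _ _))//; lra.
Qed.

Lemma holoM f g : holo f -> holo g -> holo (fun z => f z * g z).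
Proof.
move=> hf hg z z1; have [a ha] := hf z z1; have [b hb] := hg z z1.
exists (fun k => a k * g z + f z * b k) => e e0.
have [r3 r30 h3] := ha 1 ltr01.
have s0 := sum_cmod_ge0 a; set s := \sum_k cmod (a k) in s0.
have G0 := cmod_ge0 (g z); have F0 := cmod_ge0 (f z).
set G := cmod (g z) in G0; set F := cmod (f z) in F0.
have e1 : 0 < e / 3 / (G + 1) by rewrite !divr_gt0//; lra.
have e2 : 0 < e / 3 / (F + 1) by rewrite !divr_gt0//; lra.
have e3 : 0 < e / 3 / (1 + s) by rewrite !divr_gt0//; lra.
have [r1 r10 h1] := ha _ e1; have [r2 r20 h2] := hb _ e2.
have [r4 r40 h4] := holo_vcont hg z1 e3.
exists (Num.min (Num.min r1 r2) (Num.min r3 r4)); first by rewrite !lt_min r10 r20 r30.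
move=> h; rewrite !lt_min => /andP[/andP[/h1 l1 /h2 l2] /andP[l3 l4]].
have hs : vsub (vadd z h) z = h by exact: vsub_vadd.
have l5 := holo_dcont ltr01 h3 (w := vadd z h); rewrite hs -/s in l5; have {}l5 := l5 l3.
have := h4 (vadd z h); rewrite hs => /(_ l4) l6.
have -> : f (vadd z h) * g (vadd z h) - f z * g z - \sum_k (a k * g z + f z * b k) * h k =
   (f (vadd z h) - f z - \sum_k a k * h k) * g z
   + f z * (g (vadd z h) - g z - \sum_k b k * h k)
   + (f (vadd z h) - f z) * (g (vadd z h) - g z).
  under eq_bigr do rewrite mulrDl.
  rewrite big_split/=.
  have -> : \sum_k a k * g z * h k = (\sum_k a k * h k) * g z.
    by rewrite mulr_suml; apply: eq_bigr => k _; ring.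
  have -> : \sum_k f z * b k * h k = f z * (\sum_k b k * h k).
    by rewrite mulr_sumr; apply: eq_bigr => k _; ring.
  ring.
have v0 := vnorm_ge0 h.
have k1 (x y m : R) : 0 <= m -> x <= y / 3 / (m + 1) * vnorm h -> 0 < y -> x * m <= y / 3 * vnorm h.
  move=> m0 xy y0; apply: (@le_trans _ _ (y / 3 / (m + 1) * vnorm h * m)); first by rewrite ler_wpM2r.
  have -> : y / 3 / (m + 1) * vnorm h * m = (y / 3 * vnorm h) * (m / (m + 1)) by ring.
  rewrite ler_piMr ?mulr_ge0//; first lra.
  by rewrite ler_pdivrMr//; lra.
rewrite (le_trans (cmodD _ _))// (_ : e * vnorm h = e / 3 * vnorm h + e / 3 * vnorm h + e / 3 * vnorm h); last by field.
apply: lerD; first rewrite (le_trans (cmodD _ _))//.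
  apply: lerD; rewrite cmodM; first exact: (k1 _ _ _ G0 l1 e0).
  by rewrite mulrC; exact: (k1 _ _ _ F0 l2 e0).
rewrite cmodM; apply: (@le_trans _ _ ((1 + s) * vnorm h * (e / 3 / (1 + s)))).
  by apply: ler_pM; rewrite ?cmod_ge0// ltW.
rewrite le_eqVlt; apply/orP; left; apply/eqP; field; rewrite lt0r_neq0//; lra.
Qed.

Lemma holoX f n : holo f -> holo (fun z => f z ^+ n).
Proof.
move=> hf; elim: n => [|n IH].
  by have -> : (fun z => f z ^+ 0) = (fun=> 1) by []; exact: holo_cst.
have -> : (fun z => f z ^+ n.+1) = (fun z => f z * f z ^+ n) by apply/funext => z; rewrite exprS.
exact: holoM.
Qed.

Lemma holo_comp f (phi : cvec R N -> cvec R N) : holo f -> holo_self phi ->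
  holo (fun z => f (phi z)).
Proof.
move=> hf [hphi phiB] z z1; have [a ha] := hf _ (phiB z z1).
have /choice[b hb] : forall k : 'I_N, exists b : 'I_N -> R[i], forall eps : R, 0 < eps ->
    exists2 delta : R, 0 < delta & forall h : cvec R N, vnorm h < delta ->
      cmod (phi (vadd z h) k - phi z k - \sum_i b i * h i) <= eps * vnorm h.
  by move=> k; exact: hphi.
exists (fun i => \sum_k a k * b k i) => e e0.
pose s := \sum_k cmod (a k); have s0 : 0 <= s := sum_cmod_ge0 a.
pose B := \sum_k (1 + \sum_i cmod (b k i)).
have B0 : 0 <= B by rewrite /B sumr_ge0// => k _; rewrite addr_ge0// sum_cmod_ge0.
have e1 : 0 < e / 2 / (s + 1) by rewrite !divr_gt0//; lra.
have e2 : 0 < e / 2 / (B + 1) by rewrite !divr_gt0//; lra.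
have e1' : 0 < Num.min 1 (e / 2 / (s + 1)) by rewrite lt_min ltr01.
have /choice[d hd] : forall k : 'I_N, exists d, 0 < d /\ forall h : cvec R N, vnorm h < d ->
    cmod (phi (vadd z h) k - phi z k - \sum_i b k i * h i) <= Num.min 1 (e / 2 / (s + 1)) * vnorm h.
  by move=> k; have [d d0 h] := hb k _ e1'; exists d.
have [r r0 hr] := ha _ e2.
pose m := \big[Num.min/1]_(k < N) d k.
have m0 : 0 < m.
  rewrite /m; elim/big_ind: _ => [|x y x0 y0|k _]; [exact: ltr01|by rewrite lt_min x0|].
  by case: (hd k).
exists (Num.min m (r / (B + 1))); first by rewrite lt_min m0 divr_gt0//; lra.
move=> h; rewrite lt_min ltr_pdivlMr; last by lra.
move=> /andP[hm hB]; pose w := vsub (phi (vadd z h)) (phi z).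
have wk k : cmod (w k - \sum_i b k i * h i) <= Num.min 1 (e / 2 / (s + 1)) * vnorm h.
  have [_ hk] := hd k; apply: hk; apply: lt_le_trans hm _; exact: bigmin_le_cond.
have v0 := vnorm_ge0 h.
have wB : vnorm w <= B * vnorm h.
  rewrite (le_trans (vnorm_le_sum _))// /B mulr_suml; apply: ler_sum => k _.
  rewrite -(subrK (\sum_i b k i * h i) (w k)) (le_trans (cmodD _ _))// mulrDl lerD ?cmod_dot_le//.
  by apply: le_trans (wk k) _; rewrite ler_wpM2r// ge_min lexx.
have wr : vnorm w < r by apply: le_lt_trans hB; rewrite (le_trans wB)//; lra.
have := hr w wr; rewrite /w vadd_vsub => l1.
have -> : f (phi (vadd z h)) - f (phi z) - \sum_i (\sum_k a k * b k i) * h i =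
  (f (phi (vadd z h)) - f (phi z) - \sum_k a k * w k) + \sum_k a k * (w k - \sum_i b k i * h i).
  have -> : \sum_i (\sum_k a k * b k i) * h i = \sum_k a k * \sum_i b k i * h i.
    under eq_bigr do rewrite mulr_suml.
    rewrite exchange_big/=; apply: eq_bigr => k _; rewrite mulr_sumr.
    by apply: eq_bigr => i _; rewrite mulrA.
  under [X in _ = _ + X]eq_bigr do rewrite mulrBr.
  by rewrite sumrB; ring.
rewrite (le_trans (cmodD _ _))// (_ : e * vnorm h = e / 2 * vnorm h + e / 2 * vnorm h); last by field.
apply: lerD.
  apply: le_trans l1 _; apply: (@le_trans _ _ (e / 2 / (B + 1) * (B * vnorm h))).
    by rewrite ler_wpM2l// ltW.
  have -> : e / 2 / (B + 1) * (B * vnorm h) = (e / 2 * vnorm h) * (B / (B + 1)) by ring.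
  rewrite ler_piMr ?mulr_ge0//; first lra.
  by rewrite ler_pdivrMr//; lra.
apply: le_trans (cmod_sum _ _) _.
apply: (@le_trans _ _ (\sum_k cmod (a k) * (e / 2 / (s + 1) * vnorm h))).
  apply: ler_sum => k _; rewrite cmodM ler_wpM2l ?cmod_ge0//.
  by apply: le_trans (wk k) _; rewrite ler_wpM2r// ge_min lexx orbT.
rewrite -mulr_suml -/s.
have -> : s * (e / 2 / (s + 1) * vnorm h) = (e / 2 * vnorm h) * (s / (s + 1)) by ring.
rewrite ler_piMr ?mulr_ge0//; first lra.
by rewrite ler_pdivrMr//; lra.
Qed.
End Holomorphic.

(** * The mean value inequality on boxes, one complex variable at a time *)

Section BoxMean.
Context {R : realType} {N : nat}.
Implicit Types (z p : cvec R N) (f : cvec R N -> R[i]).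
Notation mu := (@lebesgue_measure R).

Definition setz z (n : 'I_N) (l : R[i]) : cvec R N := fun i => if i == n then l else z i.

Definition inbox p S z : bool :=
  [forall i, in_box (p i) S (complex.Re (z i)) (complex.Im (z i))].

Definition coords z : nat -> R := fun j =>
  if insub j./2 is Some i then (if odd j then complex.Im (z i) else complex.Re (z i)) else 0.

Lemma coordsK z : vec_of (coords z) = z.
Proof.
apply/funext => i; rewrite /vec_of /coords.
have -> : (2 * i)./2 = i by lia.
have -> : (2 * i + 1)./2 = i by lia.
have -> : insub (nat_of_ord i) = Some i :> option 'I_N by exact: valK.
by rewrite oddD oddM/=; case: (z i).
Qed.

Lemma cdiffZ (F : R[i] -> R[i]) k w : cdiff F w -> cdiff (fun l => k * F l) w.
Proof.
case=> A hA; exists (k * A) => e e0; have k0 : 0 < cmod k + 1 by rewrite ltr_wpDl ?cmod_ge0.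
have [r r0 hr] := hA _ (divr_gt0 e0 k0); exists r => // v /hr h.
have -> : k * F v - k * F w - k * A * (v - w) = k * (F v - F w - A * (v - w)) by ring.
rewrite cmodM; apply: (@le_trans _ _ ((cmod k + 1) * (e / (cmod k + 1) * cmod (v - w)))).
  by apply: ler_pM; rewrite ?cmod_ge0//; lra.
rewrite le_eqVlt; apply/orP; left; apply/eqP; field; exact: lt0r_neq0.
Qed.

Lemma rampZ (c A r : R) : 0 <= c -> c * ramp A r = ramp (c * A) (c * r).
Proof. by move=> c0; rewrite /ramp maxr_pMr// mulr0 mulrBr. Qed.

Section Induction.
Variables (f : cvec R N -> R[i]) (p : cvec R N) (S A : R).
Hypotheses (S0 : 0 < S) (A0 : 0 <= A).
Hypothesis fd : forall z n, inbox p S z -> cdiff (fun l => f (setz z n l)) (z n).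

Let mrg k (x y : nat -> R) : nat -> R := fun j => if (j < 2 * k)%N then x j else y j.
Let c := S ^+ 2 / 16.
(** The quantity carried by the induction: the first [k] complex coordinates are frozen at [p] and
    the others are free. Each frozen coordinate costs a factor [c] outside and a factor 16 in the
    truncation level. *)
Let E k (y : nat -> R) : R :=
  let v := vec_of (mrg k (coords p) y) in
  if inbox p S v then c ^+ k * ramp (16 ^+ k * A) (cmod (f v)) else 0.

Let c0 : 0 < c. Proof. by rewrite /c divr_gt0// exprn_gt0. Qed.

Let E_ge0 k y : 0 <= E k y.
Proof. by rewrite /E; case: ifP => // _; rewrite mulr_ge0 ?ramp_ge0// exprn_ge0// ltW. Qed.

Let mrg_upd k x y s t :
  mrg k.+1 (upd (upd x (2 * k) s) (2 * k).+1 t) y = mrg k x (upd (upd y (2 * k) s) (2 * k).+1 t).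
Proof.
apply/funext => j; rewrite /mrg /upd.
case: (ltnP j (2 * k.+1)) => h1; case: (ltnP j (2 * k)) => h2;
  case: (eqVneq j (2 * k).+1) => h3; case: (eqVneq j (2 * k)%N) => h4 //; lia.
Qed.

Let vec_mrg k (kN : (k < N)%N) y s t :
  vec_of (mrg k (coords p) (upd (upd y (2 * k) s) (2 * k).+1 t)) =
  setz (vec_of (mrg k.+1 (coords p) y)) (Ordinal kN) (Complex s t).
Proof.
apply/funext => i; rewrite /vec_of /setz /mrg /upd.
case: (eqVneq i (Ordinal kN)) => [->/=|ik].
  rewrite ltnn (_ : (2 * k + 1 < 2 * k)%N = false); last by lia.
  rewrite !eqxx (_ : (2 * k == (2 * k).+1)%N = false); last by lia.
  by rewrite (_ : (2 * k + 1 == (2 * k).+1)%N = true) //; lia.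
have ik' : nat_of_ord i != k by [].
have h1 : ((2 * i)%N == (2 * k).+1) = false by lia.
have h2 : ((2 * i)%N == (2 * k)%N) = false by lia.
have h3 : ((2 * i + 1)%N == (2 * k).+1) = false by lia.
have h4 : ((2 * i + 1)%N == (2 * k)%N) = false by lia.
have h5 : (2 * i < 2 * k.+1)%N = (2 * i < 2 * k)%N by lia.
have h6 : (2 * i + 1 < 2 * k.+1)%N = (2 * i + 1 < 2 * k)%N by lia.
by rewrite h1 h2 h3 h4 h5 h6.
Qed.

Let inbox_setz z n l : inbox p S z -> inbox p S (setz z n l) =
  in_box (p n) S (complex.Re l) (complex.Im l).
Proof.
move=> /forallP zb; apply/forallP/idP => [/(_ n)|h i]; first by rewrite /setz eqxx.
by rewrite /setz; case: eqP => [->|_].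
Qed.

Let vec_mrgS k (kN : (k < N)%N) y :
  vec_of (mrg k.+1 (coords p) y) (Ordinal kN) = p (Ordinal kN).
Proof.
rewrite -[in RHS](coordsK p) /vec_of /mrg /=.
rewrite (_ : (2 * k < 2 * k.+1)%N = true); last by lia.
by rewrite (_ : (2 * k + 1 < 2 * k.+1)%N = true) //; lia.
Qed.

(** [area_mean_ramp] in coordinate [k] replaces its frozen value by an integral over a square, to
    whose integrand the induction hypothesis applies. The truncation of the conclusion is free, as
    the integral is nonnegative. *)
Let box_mean_le k y : (k <= N)%N ->
  ((E k y)%:E <= iint (2 * k) (fun x => (E 0 (mrg k x y))%:E))%E.
Proof.
elim: k y => [|k IH] y kN; first by rewrite muln0 /= lee_fin.
rewrite (_ : 2 * k.+1 = (2 * k).+2)%N; last by lia.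
have -> : iint (2 * k).+2 (fun x => (E 0 (mrg k.+1 x y))%:E) = (\int[mu]_t \int[mu]_s
    iint (2 * k) (fun x => (E 0 (mrg k x (upd (upd y (2 * k) s) (2 * k).+1 t)))%:E))%E.
  rewrite iintS; apply: eq_integral => t _; rewrite iintS; apply: eq_integral => s _.
  by congr (iint _ _); apply/funext => x; rewrite mrg_upd.
pose v : cvec R N := vec_of (mrg k.+1 (coords p) y); pose n := Ordinal kN.
apply: (@le_trans _ _ (\int[mu]_t \int[mu]_s (E k (upd (upd y (2 * k) s) (2 * k).+1 t))%:E)%E); last first.
  apply: ge0_le_integralT => t; first by apply: integral_ge0 => s _; rewrite lee_fin.
  apply: ge0_le_integralT => s; first by rewrite lee_fin.
  by apply: IH; exact: ltnW.
have J0 : (0 <= \int[mu]_t \int[mu]_s (E k (upd (upd y (2 * k) s) (2 * k).+1 t))%:E)%E.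
  by apply: integral_ge0 => t _; apply: integral_ge0 => s _; rewrite lee_fin.
rewrite {1}/E -/v; case: ifPn => // vb.
have vn : v n = p n by exact: vec_mrgS.
(* With [c ^+ k] inside [F], the truncation level is scaled along with it, by [rampZ]. *)
pose ck := Complex (c ^+ k) 0.
pose F l := ck * f (setz v n l).
have ckn : cmod ck = c ^+ k by rewrite /ck cmodr ger0_norm// exprn_ge0// ltW.
have := @area_mean_ramp R F (p n) S (c ^+ k * (16 ^+ k * A)) S0.
have -> : (\int[mu]_t \int[mu]_u (if in_box (p n) S u t then ramp (c ^+ k * (16 ^+ k * A)) (cmod (F (Complex u t))) else 0)%:E)%E =
   (\int[mu]_t \int[mu]_s (E k (upd (upd y (2 * k) s) (2 * k).+1 t))%:E)%E.
  apply: eq_integral => t _; apply: eq_integral => u _; congr EFin.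
  rewrite /E (vec_mrg kN) -/v -/n inbox_setz//=; case: ifP => // _.
  by rewrite rampZ ?exprn_ge0 ?ltW// /F cmodM ckn.
move=> h; have {}h := h _ _.
have key : ((c ^+ k.+1 * (cmod (f v) - 16 ^+ k.+1 * A))%:E <= \int[mu]_t \int[mu]_s (E k (upd (upd y (2 * k) s) (2 * k).+1 t))%:E)%E.
  apply: le_trans (h _ _).
  - rewrite lee_fin /F cmodM ckn -vn.
    have -> : setz v n (v n) = v by apply/funext => i; rewrite /setz; case: eqP => [->|].
    by rewrite -/c !exprS le_eqVlt; apply/orP; left; apply/eqP; ring.
  - by rewrite !mulr_ge0// exprn_ge0// ltW.
  - move=> u t ub; apply: cdiffZ.
    have := fd n (_ : inbox p S (setz v n (Complex u t))); rewrite inbox_setz// => /(_ ub).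
    have -> : setz v n (Complex u t) n = Complex u t by rewrite /setz eqxx.
    have -> // : (fun l => f (setz (setz v n (Complex u t)) n l)) = (fun l => f (setz v n l)).
    apply/funext => l; congr f.
    by apply/funext => i; rewrite /setz; case: eqP.
rewrite {1}/ramp; case: (leP 0 (cmod (f v) - 16 ^+ k.+1 * A)) => _; last by rewrite mulr0.
exact: key.
Qed.

Lemma box_mean : ((c ^+ N * (cmod (f p) - 16 ^+ N * A))%:E <=
  leb_int (fun z => (if inbox p S z then ramp A (cmod (f z)) else 0)%:E))%E.
Proof.
have eqv (g h : nat -> R) : (forall j, (j < 2 * N)%N -> g j = h j) ->
    vec_of g = vec_of h :> cvec R N.
  by move=> gh; apply/funext => i; rewrite /vec_of; have := ltn_ord i => iN; rewrite !gh//; lia.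
have pb : inbox p S p by apply/forallP => i; rewrite /in_box !subrr normr0 S0.
have := box_mean_le (fun=> 0) (leqnn N).
rewrite /leb_int {1}/E (eqv _ (coords p)); last by move=> j jN; rewrite /mrg jN.
rewrite coordsK pb.
rewrite (_ : (fun x => (E 0 (mrg N x (fun=> 0)))%:E) = (fun x : nat -> R =>
   (if inbox p S (vec_of x) then ramp A (cmod (f (vec_of x))) else 0)%:E)).
  apply: le_trans; rewrite lee_fin; apply: ler_wpM2l; first by rewrite exprn_ge0// ltW.
  exact: ramp_ge.
apply/funext => x; rewrite /E (eqv _ x); last by move=> j jN; rewrite /mrg ltn0 jN.
by rewrite expr0 !mul1r.
Qed.
End Induction.
End BoxMean.

(** * Montel's theorem by ultrafilter limits *)

Section Montel.
Context {R : realType} {N : nat}.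
Implicit Types (z v w h : cvec R N) (f g : cvec R N -> R[i]).

(* Locked, so that arithmetic tactics do not expand the numeral. *)
Definition taylor_cst : R := locked 5000.

Lemma taylor_cst_ge0 : 0 <= taylor_cst.
Proof. by rewrite /taylor_cst -lock ler0n. Qed.

(** On a complex line through [z0] the derivative [a] becomes a one-variable derivative, for which
    [cdiff_taylor] gives explicit bounds. Points of the square have modulus at most 2, hence the
    room [2 * d]. *)
Lemma holo_line_taylor f (rho' M d : R) (z0 v : cvec R N) (a : 'I_N -> R[i]) :
  holo f -> rho' < 1 -> (forall z, vnorm z <= rho' -> cmod (f z) <= M) ->
  vnorm z0 + 2 * d <= rho' -> vnorm v = d -> 0 < d ->
  (forall eps : R, 0 < eps -> exists2 delta : R, 0 < delta & forall h : cvec R N,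
     vnorm h < delta -> cmod (f (vadd z0 h) - f z0 - \sum_k a k * h k) <= eps * vnorm h) ->
  cmod (\sum_k a k * v k) <= 32 * M /\
  forall l, cmod l <= 64^-1 ->
    cmod (f (vadd z0 (cscale l v)) - f z0 - \sum_k a k * cscale l v k) <= taylor_cst * M * cmod l ^+ 2.
Proof.
move=> hf r1 fM zd vd d0 ha.
pose F l := f (fun i => z0 i + l * v i).
have FE l : F l = f (vadd z0 (cscale l v)) by [].
have inQ l : in_rect (-1) 1 (-1) 1 l -> vnorm (vadd z0 (cscale l v)) <= rho'.
  move=> [l1 l2]; apply: le_trans zd; rewrite (le_trans (vnorm_vadd _ _))// lerD2l.
  rewrite vnorm_cscale vd ler_pM2r// (le_trans (cmod_le _))//.
  by rewrite -[2]/(1 + 1) lerD// ler_norml.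
have Fd : diff_rect F (-1) 1 (-1) 1.
  by move=> l lr; apply: holo_affine => //; apply: le_lt_trans (inQ l lr) _.
have FM l : in_rect (-1) 1 (-1) 1 l -> cmod (F l) <= M by move=> /inQ; exact: fM.
have [b bM] := cdiff_taylor Fd FM; rewrite [5000]lock -/taylor_cst => hb.
have K0 := taylor_cst_ge0.
have F0 : F 0 = f z0 by rewrite /F; congr f; apply/funext => i; rewrite mul0r addr0.
have M0 : 0 <= M by rewrite (le_trans (cmod_ge0 _) (FM 0 _))//; split => /=; lra.
set B := \sum_k a k * v k.
have sumE l : \sum_k a k * cscale l v k = B * l.
  by rewrite /B mulr_suml; apply: eq_bigr => k _; rewrite /cscale; ring.
have bB : b = B.
  (* The two first order expansions are compared at a small real [l], of size [t]: dividing by [t]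
     leaves [cmod (b - B) <= e]. *)
  apply/eqP; rewrite -subr_eq0; apply/eqP/cmod_eq0/eqP; rewrite eq_le cmod_ge0 andbT.
  apply/ler_addgt0Pl => e e0; rewrite addr0.
  have e1 : 0 < e / 2 / d by rewrite !divr_gt0.
  have [r r0 hr] := ha _ e1.
  pose t := Num.min (Num.min 64^-1 (r / d / 2)) (e / 2 / (taylor_cst * M + 1)).
  have M1 : 0 < taylor_cst * M + 1 by rewrite ltr_wpDl// mulr_ge0.
  have t0 : 0 < t by rewrite /t !lt_min invr_gt0 ltr0n /= !divr_gt0.
  have [t1 t2 t3] : [/\ t <= 64^-1, t <= r / d / 2 & t <= e / 2 / (taylor_cst * M + 1)].
    by rewrite /t !ge_min !lexx !orbT.
  pose l := Complex t 0; have lt : cmod l = t by rewrite cmodr gtr0_norm.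
  have hl : vnorm (cscale l v) = t * d by rewrite vnorm_cscale lt vd.
  have := hr (cscale l v); rewrite hl -FE -F0 sumE => h1.
  have {}h1 : cmod (F l - F 0 - B * l) <= e / 2 * t.
    apply: le_trans (h1 _) _.
      have : t * d <= r / d / 2 * d by rewrite ler_pM2r.
      rewrite (_ : r / d / 2 * d = r / 2); last by field; rewrite lt0r_neq0.
      lra.
    rewrite le_eqVlt; apply/orP; left; apply/eqP; field; exact: lt0r_neq0.
  have := hb l; rewrite lt => /(_ t1) h2.
  have : cmod (b - B) * t <= e * t.
    rewrite -[X in _ * X]lt -cmodM.
    have -> : (b - B) * l = (F l - F 0 - B * l) - (F l - F 0 - b * l) by ring.
    rewrite (le_trans (cmodD _ _))// cmodN.
    have h3 : taylor_cst * M * t ^+ 2 <= e / 2 * t.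
      rewrite expr2 mulrA ler_pM2r//.
      apply: (@le_trans _ _ ((taylor_cst * M + 1) * t)); first by rewrite ler_pM2r// lerDl.
      by rewrite mulrC -ler_pdivlMr.
    by apply: le_trans (lerD h1 (le_trans h2 h3)) _; rewrite -mulrDl -splitr.
  by rewrite ler_pM2r.
split; first by rewrite -bB.
by move=> l l1; rewrite -FE -F0 sumE -bB hb.
Qed.

(** The bounds do not depend on [z0] nor on [f] beyond [M]. The increment [h] is written as [l]
    times a vector of length [d], which reduces it to a complex line. *)
Lemma holo_taylor f (rho rho' M : R) : holo f -> 0 <= rho -> rho < rho' -> rho' < 1 ->
  (forall z, vnorm z <= rho' -> cmod (f z) <= M) ->
  let d := (rho' - rho) / 2 in
  forall z0, vnorm z0 <= rho -> exists2 a : cvec R N,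
    (forall k, cmod (a k) <= 32 * M / d) &
    forall h, vnorm h <= d / 64 ->
      cmod (f (vadd z0 h) - f z0 - \sum_k a k * h k) <= taylor_cst * M / d ^+ 2 * vnorm h ^+ 2.
Proof.
move=> hf r0 rr r1 fM d z0 z0r; have d0 : 0 < d by rewrite /d; lra.
have z01 : vnorm z0 < 1 by lra.
have zd : vnorm z0 + 2 * d <= rho' by rewrite /d; lra.
have [a ha] := hf z0 z01; exists a.
  move=> k; pose v : cvec R N := fun i => if i == k then Complex d 0 else 0.
  have vd : vnorm v = d.
    rewrite /vnorm (bigD1 k)//= big1 ?addr0.
      by rewrite /v eqxx cmodr sqrtr_sqr gtr0_norm ?gtr0_norm.
    by move=> i ik; rewrite /v (negbTE ik) cmod0 expr0n.
  have [h _] := holo_line_taylor hf r1 fM zd vd d0 ha.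
  move: h; rewrite (bigD1 k)//= big1 ?addr0; last first.
    by move=> i ik; rewrite /v (negbTE ik) mulr0.
  by rewrite /v eqxx cmodM cmodr gtr0_norm// -ler_pdivlMr.
move=> h hd; have [h0|h0] := eqVneq (vnorm h) 0.
  have := vnorm_eq0 h0 => ->; rewrite vnorm_vzero expr0n mulr0.
  have -> : vadd z0 vzero = z0 by apply/funext => i; rewrite /vadd addr0.
  by rewrite subrr sub0r cmodN big1 ?cmod0// => k _; rewrite mulr0.
have hp : 0 < vnorm h by rewrite lt_neqAle eq_sym h0 vnorm_ge0.
pose v := cscale (Complex (d / vnorm h) 0) h.
have vd : vnorm v = d.
  by rewrite vnorm_cscale cmodr ger0_norm; [rewrite divfK|apply: divr_ge0; exact: ltW].
have [_ ht] := holo_line_taylor hf r1 fM zd vd d0 ha.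
pose l := Complex (vnorm h / d) 0.
have ln : cmod l = vnorm h / d by rewrite cmodr ger0_norm//; apply: divr_ge0; exact: ltW.
have hE : cscale l v = h.
  apply/funext => i; rewrite /cscale mulrA /l.
  have -> : Complex (vnorm h / d) 0 * Complex (d / vnorm h) 0 = 1 :> R[i].
    apply/eqP; rewrite eq_complex /= !mulr0 !mul0r subr0 addr0 eqxx andbT; apply/eqP.
    by field; rewrite h0 lt0r_neq0.
  by rewrite mul1r.
have := ht l; rewrite hE ln; move=> h1; apply: le_trans (h1 _) _.
  by rewrite ler_pdivrMr// mulrC.
by rewrite le_eqVlt; apply/orP; left; apply/eqP; field; rewrite lt0r_neq0.
Qed.

Section UltraLimit.
Variable (U : set_system nat).
Hypotheses (UU : UltraFilter U) (Uoo : \oo `<=` U).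

Let PU : ProperFilter U. Proof. by case: UU. Qed.

Lemma ultra_ex A (m : nat) : U A -> exists2 n, A n & (m <= n)%N.
Proof.
move=> UA; have Um : U [set n | (m <= n)%N] by apply: Uoo; exists m.
by have [n [An mn]] := @filter_ex _ U PU _ (filterI UA Um); exists n.
Qed.

(** The limit is the supremum of those [x] that lie below [u n] for [U]-almost all [n]; an
    ultrafilter contains the complement of every set that it misses. *)
Lemma ultra_lim_real (u : nat -> R) (B : R) : (forall n, `|u n| <= B) ->
  exists l, forall e, 0 < e -> U [set n | `|u n - l| < e].
Proof.
move=> uB; pose S := [set x | U [set n | x <= u n]].
have SB : S (- B).
  by apply: (@filterS _ _ _ setT); [move=> n _ /=; have := uB n; rewrite ler_norml => /andP[]|exact: filterT].
have ubS : ubound S B.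
  move=> x Sx; have [n /= xn] := filter_ex Sx.
  by apply: le_trans xn _; have := uB n; rewrite ler_norml => /andP[].
have hS : has_sup S by split; [exists (- B)|exists B].
exists (sup S) => e e0.
have [x Sx xe] := @sup_adherent _ S e e0 hS.
have nS : ~ S (sup S + e / 2).
  move=> h; have := sup_upper_bound hS h; lra.
have [//|nU] := in_ultra_setVsetC [set n | sup S + e / 2 <= u n] UU.
apply: filterS (filterI Sx nU) => n /= [xn /negP]; rewrite -ltNge => nx.
by rewrite ltr_distl; apply/andP; split; lra.
Qed.

Lemma ultra_lim_vec (u : nat -> cvec R N) (B : R) : (forall n, vnorm (u n) <= B) ->
  exists l : cvec R N, forall e, 0 < e -> U [set n | vnorm (vsub (u n) l) < e].
Proof.
move=> uB.
have /choice[x hx] : forall k, exists x, forall e, 0 < e -> U [set n | `|complex.Re (u n k) - x| < e].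
  move=> k; apply: (@ultra_lim_real _ B) => n.
  by apply: le_trans (Re_le_cmod _) (le_trans (cmod_le_vnorm _ _) (uB n)).
have /choice[y hy] : forall k, exists y, forall e, 0 < e -> U [set n | `|complex.Im (u n k) - y| < e].
  move=> k; apply: (@ultra_lim_real _ B) => n.
  by apply: le_trans (Im_le_cmod _) (le_trans (cmod_le_vnorm _ _) (uB n)).
exists (fun k => Complex (x k) (y k)) => e e0.
have N1 : 0 < 2 * N%:R + 1 :> R by rewrite ltr_wpDl// mulr_ge0.
pose e' := e / (2 * N%:R + 1); have e'0 : 0 < e' by rewrite divr_gt0.
have U1 : U [set n | forall k, `|complex.Re (u n k) - x k| < e'].
  have := @filter_forall _ _ (fun k => [set n | `|complex.Re (u n k) - x k| < e']) U _.
  by apply => k; exact: hx.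
have U2 : U [set n | forall k, `|complex.Im (u n k) - y k| < e'].
  have := @filter_forall _ _ (fun k => [set n | `|complex.Im (u n k) - y k| < e']) U _.
  by apply => k; exact: hy.
apply: filterS (filterI U1 U2) => n /= [n1 n2].
apply: le_lt_trans (vnorm_le_sum _) _.
apply: (@le_lt_trans _ _ (\sum_(k < N) (e' + e'))).
  apply: ler_sum => k _; apply: le_trans (cmod_le _) _.
  by rewrite /vsub ReD ReN ImD ImN/=; apply: lerD; apply: ltW; [exact: n1|exact: n2].
rewrite sumr_const card_ord -mulr2n -mulrnA -mulr_natl /e' mulrA ltr_pdivrMr//.
rewrite mulrC ltr_pM2l// natrM; lra.
Qed.

Lemma ultra_lim_complex (u : nat -> R[i]) (B : R) : (forall n, cmod (u n) <= B) ->
  exists l : R[i], forall e, 0 < e -> U [set n | cmod (u n - l) < e].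
Proof.
move=> uB.
have [x hx] := @ultra_lim_real (fun n => complex.Re (u n)) B (fun n => le_trans (Re_le_cmod _) (uB n)).
have [y hy] := @ultra_lim_real (fun n => complex.Im (u n)) B (fun n => le_trans (Im_le_cmod _) (uB n)).
exists (Complex x y) => e e0; have e2 : 0 < e / 2 by rewrite divr_gt0.
apply: filterS (filterI (hx _ e2) (hy _ e2)) => n /= [n1 n2].
apply: le_lt_trans (cmod_le _) _; rewrite ReD ReN ImD ImN/=; lra.
Qed.

Variables (u : nat -> cvec R N -> R[i]) (g : cvec R N -> R[i]).
Hypothesis hu : forall n, holo (u n).
Hypothesis ub : forall rho, rho < 1 -> exists M, forall n z, vnorm z <= rho -> cmod (u n z) <= M.
Hypothesis ug : forall z, vnorm z < 1 -> forall e, 0 < e -> U [set n | cmod (u n z - g z) < e].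

(** The Taylor bounds are uniform in [n], so the gradients are bounded and have a limit [a'] along
    [U]; the second order estimate then passes to the limit. *)
Lemma ultra_lim_holo : holo g.
Proof.
move=> z0 z01; have z00 := vnorm_ge0 z0.
pose rho := vnorm z0; pose rho' := (1 + rho) / 2.
have [rr r1] : rho < rho' /\ rho' < 1 by rewrite /rho' /rho; split; lra.
have [M hM] := ub r1.
pose d := (rho' - rho) / 2; have d0 : 0 < d by rewrite /d; lra.
have /choice[a ha] : forall n, exists a : cvec R N, (forall k, cmod (a k) <= 32 * M / d) /\
    forall h, vnorm h <= d / 64 ->
      cmod (u n (vadd z0 h) - u n z0 - \sum_k a k * h k) <= taylor_cst * M / d ^+ 2 * vnorm h ^+ 2.
  move=> n; have [b b1 b2] := @holo_taylor (u n) rho rho' M (hu n) z00 rr r1 (hM n) z0 (lexx _).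
  by exists b.
have [a' ha'] := @ultra_lim_vec a (\sum_(k < N) 32 * M / d)
  (fun n => le_trans (vnorm_le_sum _) (ler_sum _ (fun k _ => (ha n).1 k))).
pose C := taylor_cst * M / d ^+ 2.
have key h : vnorm h <= d / 64 -> vnorm (vadd z0 h) < 1 ->
    cmod (g (vadd z0 h) - g z0 - \sum_k a' k * h k) <= C * vnorm h ^+ 2.
  move=> hd h1; apply/ler_addgt0Pl => e e0; have e3 : 0 < e / 3 by lra.
  have v0 : 0 < N%:R * vnorm h + 1 by rewrite ltr_wpDl// mulr_ge0// vnorm_ge0.
  have e4 : 0 < e / 3 / (N%:R * vnorm h + 1) by rewrite divr_gt0.
  have [n /= [[n1 n2] n3]] := filter_ex (filterI (filterI (ug h1 e3) (ug z01 e3)) (ha' _ e4)).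
  have := (ha n).2 h hd; rewrite -/C => n4.
  have -> : g (vadd z0 h) - g z0 - \sum_k a' k * h k =
    (u n (vadd z0 h) - u n z0 - \sum_k a n k * h k) - (u n (vadd z0 h) - g (vadd z0 h))
      + (u n z0 - g z0) + \sum_k vsub (a n) a' k * h k.
    have -> : \sum_k vsub (a n) a' k * h k = \sum_k a n k * h k - \sum_k a' k * h k.
      by rewrite -sumrB; apply: eq_bigr => k _; rewrite /vsub mulrBl.
    ring.
  have n5 : cmod (\sum_k vsub (a n) a' k * h k) <= e / 3.
    apply: le_trans (cmod_dot_le _ _) _.
    apply: (@le_trans _ _ ((\sum_(k < N) e / 3 / (N%:R * vnorm h + 1)) * vnorm h)).
      rewrite ler_wpM2r ?vnorm_ge0//; apply: ler_sum => k _.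
      by apply: le_trans (cmod_le_vnorm _ _) _; exact: ltW.
    rewrite sumr_const card_ord -[_ *+ N]mulr_natl.
    have -> : N%:R * (e / 3 / (N%:R * vnorm h + 1)) * vnorm h =
      (e / 3) * ((N%:R * vnorm h) / (N%:R * vnorm h + 1)) by ring.
    by rewrite ler_piMr ?ler_pdivrMr//; lra.
  apply: le_trans (cmodD _ _) _; apply: le_trans (lerD (cmodD _ _) (lexx _)) _.
  apply: le_trans (lerD (lerD (cmodD _ _) (lexx _)) (lexx _)) _; rewrite cmodN; lra.
have K0 := taylor_cst_ge0.
have C0 : 0 <= C.
  rewrite /C divr_ge0 ?sqr_ge0// mulr_ge0// (le_trans (cmod_ge0 (u 0%N z0)))//.
  by apply: hM; exact: ltW.
exists a' => e e0; exists (Num.min (Num.min (d / 64) (1 - vnorm z0)) (e / (C + 1))).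
  rewrite !lt_min divr_gt0//= subr_gt0 z01/= divr_gt0//; lra.
move=> h; rewrite !lt_min => /andP[/andP[h1 h2] h3].
have z1 : vnorm (vadd z0 h) < 1 by apply: le_lt_trans (vnorm_vadd _ _) _; lra.
apply: le_trans (key h (ltW h1) z1) _; rewrite expr2 mulrA ler_wpM2r ?vnorm_ge0//.
have v0 := vnorm_ge0 h; move: h3; rewrite ltr_pdivlMr; lra.
Qed.

(** If it failed, the bad points [w n] would converge along [U] to some [w']. Pointwise convergence
    at [w'], the Lipschitz bound [L] common to all [u n], and continuity of [g] contradict this. *)
Lemma ultra_lim_uniform rho e : rho < 1 -> 0 < e ->
  U [set n | forall z, vnorm z <= rho -> cmod (u n z - g z) <= e].
Proof.
move=> rho1 e0; have hg := ultra_lim_holo.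
set A := [set n | _]; have [//|nUA] := in_ultra_setVsetC A UU.
have [rho0|rho0] := ltP rho 0.
  apply: (@filterS _ _ _ setT) => [n _ z zr|]; last exact: filterT.
  by have := le_lt_trans (le_trans (vnorm_ge0 z) zr) rho0; rewrite ltxx.
have /choice[w hw] : forall n, exists w : cvec R N, vnorm w <= rho /\ (~ A n -> e < cmod (u n w - g w)).
  move=> n; have [An|nAn] := pselect (A n).
    by exists vzero; split => //; rewrite vnorm_vzero.
  have /existsNP[z /not_implyP[zr /negP]] := nAn.
  by rewrite -ltNge => ez; exists z.
have [w' hw'] := @ultra_lim_vec w rho (fun n => (hw n).1).
have w'r : vnorm w' <= rho.
  apply/ler_addgt0Pl => t t0; have [n /= nt] := filter_ex (hw' _ t0).
  by have := vnorm_le_vsub w' (w n); rewrite vnorm_vsubC; have := (hw n).1; lra.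
have w'1 : vnorm w' < 1 by lra.
pose rho' := (1 + rho) / 2.
have [rr r1] : rho < rho' /\ rho' < 1 by rewrite /rho'; split; lra.
have [M hM] := ub r1.
have M0 : 0 <= M by apply: le_trans (cmod_ge0 (u 0%N w')) (hM _ _ _); lra.
pose d := (rho' - rho) / 2; have d0 : 0 < d by rewrite /d; lra.
pose L := \sum_(k < N) (32 * M / d) + taylor_cst * M / d ^+ 2 * (d / 64).
have K0 := taylor_cst_ge0.
have S0 : 0 <= \sum_(k < N) (32 * M / d).
  by apply: sumr_ge0 => k _; apply: divr_ge0; [exact: mulr_ge0|exact: ltW].
have L0 : 0 <= L.
  apply: addr_ge0 => //; apply: mulr_ge0.
    by apply: divr_ge0; [exact: mulr_ge0|exact: sqr_ge0].
  by apply: divr_ge0; [exact: ltW|].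
have lip n w1 : vnorm (vsub w1 w') <= d / 64 -> cmod (u n w1 - u n w') <= L * vnorm (vsub w1 w').
  move=> wd; have [a a1 a2] := @holo_taylor (u n) rho rho' M (hu n) rho0 rr r1 (hM n) w' w'r.
  have := a2 _ wd; rewrite vadd_vsub => a3.
  rewrite -(subrK (\sum_k a k * vsub w1 w' k) (u n w1 - u n w')).
  apply: le_trans (cmodD _ _) _; rewrite addrC /L mulrDl; apply: lerD.
    apply: le_trans (cmod_dot_le _ _) _; rewrite ler_wpM2r ?vnorm_ge0//.
    by apply: ler_sum => k _; exact: a1.
  apply: le_trans a3 _; rewrite -/d expr2 mulrA ler_wpM2r ?vnorm_ge0// ler_wpM2l//.
  by apply: divr_ge0; [exact: mulr_ge0|exact: mulr_ge0 (ltW d0) (ltW d0)].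
have e3 : 0 < e / 3 by lra.
have [r r0 hr] := holo_vcont hg w'1 e3.
have r'0 : 0 < Num.min (Num.min r (d / 64)) (e / 3 / (L + 1)).
  rewrite !lt_min r0 !divr_gt0//; lra.
have [n /= [[n1 n2] n3]] := filter_ex (filterI (filterI (hw' _ r'0) (ug w'1 e3)) nUA).
move: n1; rewrite !lt_min => /andP[/andP[n4 n5] n6].
have l1 := lip n _ (ltW n5); have l2 := hr _ n4; have := (hw n).2 n3.
have l3 : L * vnorm (vsub (w n) w') <= e / 3.
  apply: (@le_trans _ _ (L * (e / 3 / (L + 1)))); first by rewrite ler_wpM2l// ltW.
  have -> : L * (e / 3 / (L + 1)) = e / 3 * (L / (L + 1)) by ring.
  by rewrite ler_piMr ?ler_pdivrMr//; lra.
have -> : u n (w n) - g (w n) = (u n (w n) - u n w') + (u n w' - g w') - (g (w n) - g w') by ring.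
move=> l4; have := lt_le_trans l4 (cmodD _ _) => l5.
have := lt_le_trans l5 (lerD (cmodD _ _) (lexx _)); rewrite cmodN.
by move=> l6; exfalso; lra.
Qed.
End UltraLimit.

(** One ultrafilter finer than [\oo] gives pointwise limits everywhere at once, instead of a
    diagonal extraction; uniformity on the ball of radius [rho] then yields indices for an actual
    subsequence. *)
Lemma montel (u : nat -> cvec R N -> R[i]) rho : (forall n, holo (u n)) ->
  (forall rho, rho < 1 -> exists M, forall n z, vnorm z <= rho -> cmod (u n z) <= M) ->
  rho < 1 ->
  exists (s : nat -> nat) (g : cvec R N -> R[i]), [/\ (forall n, (s n < s n.+1)%N), holo g &
    forall e, 0 < e -> exists n0 : nat, forall n, (n0 <= n)%N ->
      forall z, vnorm z <= rho -> cmod (u (s n) z - g z) <= e].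
Proof.
move=> hu ub rho1.
have [U [UU Uoo]] := ultraFilterLemma eventually_filter.
have PU : ProperFilter U by case: UU.
have /choice[g hg] : forall z : cvec R N, exists l : R[i], vnorm z < 1 ->
    forall e, 0 < e -> U [set n | cmod (u n z - l) < e].
  move=> z; have [z1|z1] := ltP (vnorm z) 1; last by exists 0.
  have [M hM] := ub _ z1.
  have [l hl] := @ultra_lim_complex U UU (fun n => u n z) M (fun n => hM n z (lexx _)).
  by exists l.
have unif := ultra_lim_uniform UU hu ub hg rho1.
have /choice[nx hnx] : forall jm : nat * nat, exists n, (jm.2 < n)%N /\
    forall z, vnorm z <= rho -> cmod (u n z - g z) <= jm.1.+1%:R^-1.
  move=> [j m] /=; have j0 : 0 < (j.+1%:R^-1 : R) by rewrite invr_gt0.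
  by have [n n1 n2] := ultra_ex UU Uoo m.+1 (unif _ j0); exists n.
(* [nx (j, m)] is an index beyond [m] with error at most [1 / (j + 1)], so [s] increases and the
   error at [s n] is at most [1 / (n + 1)]. *)
pose s := fix s n := if n is m.+1 then nx (m.+1, s m) else nx (0%N, 0%N).
exists s, g; split.
- by move=> n; have [h _] := hnx (n.+1, s n).
- exact: (@ultra_lim_holo U UU u g hu ub hg).
- move=> e e0; exists (Num.truncn e^-1).+1 => n nn z zr.
  have h : cmod (u (s n) z - g z) <= n.+1%:R^-1.
    by case: n nn => [//|n] _ /=; have [_] := hnx (n.+1, s n); apply.
  apply: le_trans h _; rewrite -[leRHS]invrK lef_pV2 ?posrE ?invr_gt0//.
  apply: le_trans (ltW (truncnS_gt _)) _; rewrite ler_nat; exact: leqW.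
Qed.
End Montel.

(** * Weighted means over the ball and the sphere *)

Section PowerIntegral.
Context {R : realType}.
Notation mu := (@lebesgue_measure R).

Lemma derive_powR_affine (k s a x : R) : 0 < s + k * x ->
  is_derive x 1 (fun x : R => powR (s + k * x) a) (a * powR (s + k * x) (a - 1) * k).
Proof.
move=> p; have h1 : is_derive x 1 (fun x : R => s + k * x) k.
  have h := @is_deriveD R R R^o (cst s) (k *: id) x 1 _ _ (is_derive_cst _ _ _) (is_deriveZ k (is_derive_id _ _)).
  have e : 0 + k *: 1 = k :> R by rewrite add0r /GRing.scale/= mulr1.
  by rewrite e in h.
have h2 := @is_derive1_powR R a (s + k * x) p.
by have := @is_derive1_comp R (fun y : R => powR y a) (fun x : R => s + k * x) x _ _ h2 h1.
Qed.

Lemma cts_within_derive (f : R -> R) (f' : R -> R) (p q : R) :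
  (forall x, p <= x <= q -> is_derive x 1 f (f' x)) -> {within `[p, q], continuous f}.
Proof.
move=> h; apply: derivable_within_continuous => x; rewrite in_itv/= => /h d.
exact: ex_derive.
Qed.

Lemma integral_powR_affine (k s a p q : R) : k != 0 -> a != 0 -> p < q ->
  (forall x, p <= x <= q -> 0 < s + k * x) ->
  (\int[mu]_(x in `[p, q]) (powR (s + k * x) (a - 1))%:E =
   ((powR (s + k * q) a - powR (s + k * p) a) / (a * k))%:E)%E.
Proof.
move=> k0 a0 pq pos.
pose F (x : R) := (a * k)^-1 * powR (s + k * x) a.
have dF x : p <= x <= q -> is_derive x 1 F (powR (s + k * x) (a - 1)).
  move=> /pos px; have d := derive_powR_affine a px.
  have := is_deriveZ (a * k)^-1 d.
  by have -> : (a * k)^-1 *: (a * powR (s + k * x) (a - 1) * k) = powR (s + k * x) (a - 1)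
    by rewrite /GRing.scale/=; field; rewrite a0 k0.
have cF : {within `[p, q], continuous F} := cts_within_derive dF.
rewrite (@continuous_FTC2 R (fun x : R => powR (s + k * x) (a - 1)) F p q pq).
- by rewrite -EFinB /F -mulrBr mulrC.
- by apply: cts_within_derive => x /pos px; exact: derive_powR_affine.
- have [_ cp cq] := (continuous_within_itvP F pq).1 cF.
  split => // x; rewrite in_itv/= => /andP[px xq].
  by have := dF x; rewrite !ltW// => /(_ isT) d; exact: ex_derive.
- move=> x; rewrite in_itv/= => /andP[px xq]; rewrite derive1E.
  by have := dF x; rewrite !ltW// => /(_ isT) d; rewrite derive_val.
Qed.

(** [powR] has conventional values at nonpositive arguments; [pw] is 0 there, like the weight off
    the ball. *)
Definition pw (a r : R) : R := if 0 < r then powR r a else 0.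

Lemma pw_ge0 (a r : R) : 0 <= pw a r.
Proof. by rewrite /pw; case: ifP => _ //; exact: powR_ge0. Qed.

Lemma powR_nincr (a x y : R) : a < 0 -> 0 < x -> x <= y -> powR y a <= powR x a.
Proof.
move=> a0 x0 xy; have y0 : 0 < y := lt_le_trans x0 xy.
have h : powR x (- a) <= powR y (- a).
  by apply: ge0_ler_powR => //; rewrite ?nnegrE ?oppr_ge0 ltW.
have e (z : R) : powR z a = (powR z (- a))^-1 by rewrite -powRN opprK.
by rewrite !e lef_pV2 ?posrE ?powR_gt0.
Qed.

Lemma powR_cont (a x : R) : 0 < x -> forall e, 0 < e -> exists2 d, 0 < d &
  forall y, `|y - x| < d -> `|powR y a - powR x a| < e.
Proof.
move=> x0 e e0.
have d := @is_derive1_powR R a x x0.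
have c : {for x, continuous (fun y : R => powR y a)}.
  by apply: differentiable_continuous; apply/derivable1_diffP; exact: ex_derive.
move/cvgrPdist_lt: c => /(_ e e0) [d0 /= d00 h].
exists d0 => // y yd; rewrite distrC; apply: h; by rewrite /= distrC.
Qed.

Lemma measurable_pw d (T : measurableType d) (f : T -> R) (a : R) :
  measurable_fun setT f -> measurable_fun setT (fun t => pw a (f t)).
Proof.
move=> mf.
have := @measurable_coord_fun R _ T (fun t _ => f t) 1 [set x : nat -> R | 0 < x 0%N] (fun x : nat -> R => powR (x 0%N) a).
set h := (X in measurable_fun _ X) => mh.
have -> : (fun t => pw a (f t)) = h.
  by apply/funext => t; rewrite /pw /h/= asboolb.
apply: mh => // x /= x0 e e0; have [r r0 hr] := powR_cont a x0 e0.
exists (Num.min r (x 0%N)); first by rewrite lt_min r0.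
move=> y /(_ 0%N isT); rewrite lt_min => /andP[y1 y2]; split; last exact: hr.
by move: y2; rewrite ltr_distl => /andP[]; rewrite subrr.
Qed.

Lemma measurable_sqr_sub d (T : measurableType d) (f : T -> R) (t : R) :
  measurable_fun setT f -> measurable_fun setT (fun x => t - f x ^+ 2).
Proof.
by move=> mf; apply: measurable_funB => //; exact: measurable_funX.
Qed.

(** [s + k * x] vanishes at one end of the interval, where the integrand may blow up. The
    fundamental theorem is applied on the shorter intervals of half-length [b n], followed by
    monotone convergence. *)
Lemma integral_half_le (k s a : R) : (k = 1 \/ k = -1) -> 0 < s -> 0 < a ->
  (\int[mu]_x (if `|x| < s then powR (s + k * x) (a - 1) else 0)%:E <=
   (powR (2 * s) a / a)%:E)%E.
Proof.
move=> kk s0 a0.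
pose b (n : nat) : R := s - s / n.+2%:R.
pose G (n : nat) (x : R) : R := if `|x| < b n then powR (s + k * x) (a - 1) else 0.
pose H (x : R) : R := if `|x| < s then powR (s + k * x) (a - 1) else 0.
have bs n : 0 < b n < s.
  have n0 : 0 < n.+2%:R :> R by [].
  apply/andP; split; last by rewrite /b gtrBl divr_gt0.
  by rewrite /b subr_gt0 ltr_pdivrMr// ltr_pMr// ltr1n.
have pos (x : R) : `|x| < s -> 0 < s + k * x.
  by rewrite ltr_norml => /andP[? ?]; case: kk => ->; lra.
have mb (r : R) : r <= s -> measurable_fun setT (fun x : R => if `|x| < r then powR (s + k * x) (a - 1) else 0).
  move=> rs.
  have := @measurable_coord_fun R _ _ (fun (t : R) _ => t) 1 [set x : nat -> R | `|x 0%N| < r] (fun x : nat -> R => powR (s + k * x 0%N) (a - 1)).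
  set h := (X in measurable_fun _ X) => mh.
  rewrite (_ : (fun x : R => _) = h); last by apply/funext => t; rewrite /h/= asboolb.
  apply: mh => [i|x /= xr e e0]; first exact: measurable_id.
  have p := pos _ (lt_le_trans xr rs); have [d d0 hd] := powR_cont (a - 1) p e0.
  exists (Num.min d (r - `|x 0%N|)); first by rewrite lt_min d0 subr_gt0.
  move=> y /(_ 0%N isT); rewrite lt_min => /andP[y1 y2]; split.
    have := ler_normD (y 0%N - x 0%N) (x 0%N); rewrite subrK; lra.
  apply: hd; rewrite (_ : _ - _ = k * (y 0%N - x 0%N)); last by ring.
  by rewrite normrM (_ : `|k| = 1) ?mul1r//; case: kk => ->; rewrite ?normrN normr1.
have lim : (\int[mu]_x (G n x)%:E)%E @[n --> \oo] --> (\int[mu]_x (H x)%:E)%E.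
  have HE : (\int[mu]_x (H x)%:E = \int[mu]_x (limn (fun n => (G n x)%:E)))%E.
    apply: eq_integral => x _; apply/esym/cvg_lim => //.
    apply: cvg_near_cst; rewrite /H; case: ltP => xs; last first.
      apply: nearW => n; rewrite /G ltNge (le_trans _ xs)//=.
      by have /andP[_ /ltW] := bs n.
    have xs0 : 0 < s - `|x| by rewrite subr_gt0.
    exists (Num.truncn (s / (s - `|x|))) => // n /= nn.
    rewrite /G ifT// /b ltrBrDr addrC -ltrBrDr ltr_pdivrMr// mulrC -ltr_pdivrMr//.
    by apply: lt_le_trans (truncnS_gt _) _; rewrite ler_nat ltnS leqW.
  rewrite HE; apply: cvg_monotone_convergence => //.
  - by move=> n; apply/measurable_EFinP; apply: mb; have /andP[_ /ltW] := bs n.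
  - by move=> n x _; rewrite lee_fin /G; case: ifP => _ //; exact: powR_ge0.
  - move=> x _ n m nm; rewrite lee_fin /G; case: (ltP `|x| (b n)) => xn; last first.
      by case: ifP => _ //; exact: powR_ge0.
    rewrite ifT//; apply: lt_le_trans xn _; rewrite /b lerD2l lerN2 ler_pM2l//.
    by rewrite lef_pV2 ?posrE// ler_nat.
rewrite -[leLHS]/(\int[mu]_x (H x)%:E)%E.
suff GC n : (\int[mu]_x (G n x)%:E <= (powR (2 * s) a / a)%:E)%E.
  rewrite -(cvg_lim _ lim)//; apply: lime_le; last exact: nearW.
  by apply/cvg_ex; exists (\int[mu]_x (H x)%:E)%E.
have /andP[b0 bs'] := bs n.
have inb (x : R) : - b n <= x <= b n -> `|x| < s.
  by move=> h; rewrite ltr_norml; apply/andP; split; lra.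
apply: (@le_trans _ _ (\int[mu]_(x in `[(- b n)%R, b n]) (powR (s + k * x) (a - 1))%:E)%E).
  rewrite [leRHS]integral_mkcond; apply: ge0_le_integralT => x.
    by rewrite lee_fin /G; case: ifP => _ //; exact: powR_ge0.
  rewrite patchE; case: ifPn => [_|].
    by rewrite /G; case: ifP => _; rewrite lee_fin ?powR_ge0.
  rewrite notin_setE/= in_itv/= => /negP; rewrite /G; case: ifPn => [|_ _]; last by [].
  by rewrite ltr_norml => /andP[/ltW -> /ltW ->].
rewrite integral_powR_affine.
- rewrite lee_fin; case: kk => ->.
    rewrite !mul1r mulr1 ler_pM2r ?invr_gt0// lerBlDr (le_trans (y := powR (2 * s) a))//.
      by apply: ge0_ler_powR; rewrite ?nnegrE ?ltW//; lra.
    by rewrite lerDl powR_ge0.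
  rewrite !mulN1r mulrN1 invrN mulrN -mulNr opprB opprK ler_pM2r ?invr_gt0//.
  rewrite lerBlDr (le_trans (y := powR (2 * s) a))//.
    by apply: ge0_ler_powR; rewrite ?nnegrE ?ltW//; lra.
  by rewrite lerDl powR_ge0.
- by case: kk => ->; rewrite ?oppr_eq0 oner_eq0.
- exact: lt0r_neq0.
- by rewrite -subr_gt0; lra.
- by move=> x /inb/pos.
Qed.

(** With [s = Num.sqrt t], [t - x ^+ 2] is [(s - x) * (s + x)]. The larger factor is at least [s],
    so its negative power is at most [powR s a]; the other is left to [integral_half_le]. One real
    integration raises the exponent by [2^-1]. *)
Lemma integral_pw_le (a : R) : -1 < a -> a < 0 -> exists2 C, 0 <= C & forall t,
  (\int[mu]_x (pw a (t - x ^+ 2))%:E <= (C * pw (a + 2^-1) t)%:E)%E.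
Proof.
move=> a1 a0; have a10 : 0 < a + 1 by lra.
exists (2 * powR 2 (a + 1) / (a + 1)).
  by rewrite divr_ge0 ?mulr_ge0 ?powR_ge0//; lra.
move=> t; have [t0|t0] := leP t 0.
  rewrite /pw [X in (_ <= (_ * X)%:E)%E]ifF ?mulr0; last by apply/negbTE; rewrite -leNgt.
  rewrite [X in (X <= _)%E](_ : _ = 0%E)//; apply: integral0_eq => x _.
  by rewrite ifF//; apply/negbTE; rewrite -leNgt; have := sqr_ge0 x; lra.
pose s := Num.sqrt t; have s0 : 0 < s by rewrite sqrtr_gt0.
have s2 : s ^+ 2 = t by rewrite sqr_sqrtr// ltW.
pose H (k x : R) : R := if `|x| < s then powR (s + k * x) (a + 1 - 1) else 0.
have H0 k x : 0 <= H k x by rewrite /H; case: ifP => _ //; exact: powR_ge0.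
have mH (k : R) : (k = 1 \/ k = -1) -> measurable_fun setT (fun x => (H k x)%:E).
  move=> kk; apply/measurable_EFinP.
  have -> : H k = fun x => if `|x| < s then pw (a + 1 - 1) (s + k * x) else 0.
    apply/funext => x; rewrite /H /pw; case: ifP => //; rewrite ltr_norml => /andP[? ?].
    by rewrite ifT//; case: kk => ->; lra.
  apply: measurable_fun_ifT => //.
    by apply: measurable_fun_ltr => //; exact: measurableT_comp.
  by apply: measurable_pw; apply: measurable_funD => //; exact: measurable_funM.
apply: (@le_trans _ _ (\int[mu]_x ((powR s a)%:E * ((H 1 x)%:E + (H (-1) x)%:E)))%E).
  apply: ge0_le_integralT => x; first by rewrite lee_fin pw_ge0.
  rewrite /pw; case: ifP => [p|_]; last by rewrite -EFinD -EFinM lee_fin mulr_ge0 ?powR_ge0// addr_ge0.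
  rewrite -EFinD -EFinM lee_fin.
  have xs : `|x| < s.
    by rewrite -(@ltr_pXn2r _ 2)// ?nnegrE ?normr_ge0 ?ltW// real_normK ?num_real// s2 -subr_gt0.
  have := xs; rewrite ltr_norml => /andP[x1 x2].
  rewrite /H xs addrK mul1r mulN1r -s2 subr_sqr powRM; [|lra|lra].
  rewrite mulrDr; have [x0|x0] := leP 0 x.
    rewrite mulrC (le_trans (y := powR s a * powR (s - x) a))//.
      by rewrite ler_wpM2r ?powR_ge0// powR_nincr//; lra.
    by rewrite lerDr mulr_ge0 ?powR_ge0.
  rewrite (le_trans (y := powR s a * powR (s + x) a))//.
    by rewrite ler_wpM2r ?powR_ge0// powR_nincr//; lra.
  by rewrite lerDl mulr_ge0 ?powR_ge0.
rewrite ge0_integralZl_EFin//; last 3 first.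
- by move=> x _; rewrite -EFinD lee_fin addr_ge0.
- by apply: emeasurable_funD; apply: mH; [left|right].
- exact: powR_ge0.
rewrite ge0_integralD//; last 4 first.
- by move=> x _; rewrite lee_fin.
- by apply: mH; left.
- by move=> x _; rewrite lee_fin.
- by apply: mH; right.
have h1 := @integral_half_le 1 s (a + 1) (or_introl erefl) s0 a10.
have h2 := @integral_half_le (-1) s (a + 1) (or_intror erefl) s0 a10.
apply: (@le_trans _ _ ((powR s a)%:E * ((powR (2 * s) (a + 1) / (a + 1))%:E + (powR (2 * s) (a + 1) / (a + 1))%:E)))%E.
  apply: lee_wpmul2l; first by rewrite lee_fin powR_ge0.
  exact: (leeD h1 h2).
rewrite -EFinD -EFinM lee_fin /pw t0 powRM; [|by []|exact: ltW].
have -> : powR t (a + 2^-1) = powR s a * powR s (a + 1).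
  rewrite -s2 -powR_mulrn ?ltW// -powRrM -powRD; last by rewrite lt0r_neq0 ?implybT.
  by congr powR; field.
by rewrite le_eqVlt; apply/orP; left; apply/eqP; field; rewrite lt0r_neq0.
Qed.
End PowerIntegral.

(** * Finiteness and positivity of the weighted volume *)

Section Weights.
Context {R : realType} {N : nat}.
Local Notation cv := (cvec R N).
Notation mu := (@lebesgue_measure R).

Lemma wtE (al : R) (z : cv) : wt al z = pw al (1 - vnorm z ^+ 2).
Proof. by rewrite /wt /pw subr_gt0 expr_lt1 ?vnorm_ge0. Qed.

Lemma wt_ge0 (al : R) (z : cv) : 0 <= wt al z.
Proof. by rewrite wtE pw_ge0. Qed.

Lemma measurable_wt (al : R) d (T : measurableType d) (g : T -> nat -> R) :
  coord_measurable g -> measurable_fun setT (fun t => wt al (vec_of (g t) : cv)).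
Proof.
move=> mg; under eq_fun do rewrite wtE.
by apply: measurable_pw; apply: measurable_sqr_sub; exact: measurable_vnorm.
Qed.

Lemma wt_nincr (al be : R) (z : cv) : be <= al -> wt al z <= wt be z.
Proof.
move=> ab; rewrite !wtE /pw; case: ifP => // p.
by apply: ger_powR => //; rewrite p gerBl sqr_ge0.
Qed.

Lemma vnorm_vec_of (x : nat -> R) :
  vnorm (vec_of x : cv) ^+ 2 = \sum_(i < N) (x (2 * i)%N ^+ 2 + x (2 * i + 1)%N ^+ 2).
Proof. by rewrite vnorm_sqr; apply: eq_bigr => i _; rewrite cmod_sqr. Qed.

Lemma iint_cst0 k : iint k (fun=> 0%E) = 0%E :> \bar R.
Proof. by elim: k => [|k IH] //=; under eq_integral do rewrite IH; rewrite integral0. Qed.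

(** Only the two innermost variables need a real computation; each other one is confined to an
    interval of length 2. *)
Lemma iint_cube_le k (G : (nat -> R) -> \bar R) (C : R) : 0 <= C ->
  (forall x, 0 <= G x)%E ->
  (forall y, iint 2 (fun x => G (fun j => if (j < 2)%N then x j else y j)) <= C%:E)%E ->
  (forall x j, (2 <= j < 2 + k)%N -> 1 < `|x j| -> G x = 0%E) ->
  (iint (2 + k) G <= (C * 2 ^+ k)%:E)%E.
Proof.
move=> C0; elim: k G => [|k IH] G G0 GC Gz.
  rewrite expr0 mulr1; apply: le_trans (GC (fun=> 0)) => /=.
  rewrite le_eqVlt; apply/orP; left; apply/eqP.
  apply: eq_integral => t _; apply: eq_integral => u _; congr G.
  by apply/funext => -[|[|j]].
move: IH Gz; rewrite !addnS; have [m mE] : exists m, m = (2 + k)%N by exists (2 + k)%N.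
rewrite -!mE iintS => IH Gz.
apply: (@le_trans _ _ (\int[mu]_(t in `[(-1)%R, 1%R]) (C * 2 ^+ k)%:E)%E).
  rewrite [leRHS]integral_mkcond; apply: ge0_le_integralT => t; first exact: iint_ge0.
  rewrite patchE; case: ifPn => [_|].
    apply: IH => [x|y|x j jk xj]; first exact: G0.
      rewrite [X in iint 2 X](_ : _ = fun x => G (fun j => if (j < 2)%N then x j else upd y m t j)).
        exact: GC.
      apply/funext => x; congr G; apply/funext => j; rewrite /upd.
      by case: (ltnP j 2) => j2 //; case: eqP => // jk; lia.
    apply: (Gz _ j); first lia.
    by rewrite /upd; case: eqP => // jk'; lia.
  rewrite notin_setE => nt.
  have t1 : 1 < `|t| by rewrite ltNge ler_norml; apply/negP => h; apply: nt; rewrite /= in_itv.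
  have -> : (fun x => G (upd x m t)) = (fun=> 0%E).
    by apply/funext => x; apply: (Gz _ m); rewrite /upd ?eqxx//; lia.
  by rewrite iint_cst0.
rewrite integral_cst//= lebesgue_measure_itv/= lte_fin.
rewrite ifT; last lra.
rewrite -EFinD -EFinM lee_fin exprS le_eqVlt; apply/orP; left; apply/eqP; ring.
Qed.

Lemma leb_wt_fin (al : R) : (1 <= N)%N -> -1 < al ->
  (leb_int (fun z : cv => (wt al z)%:E) < +oo)%E.
Proof.
(* Lowering the exponent increases the weight. With [be <= - (3 / 4)], both [be] and [be + 2^-1] lie
   in the range of [integral_pw_le], and after two integrations the exponent [be + 1] is positive,
   which leaves a bounded function. *)
move=> N1 al1; pose be := Num.min al (- (3 / 4)).
have be1 : -1 < be by rewrite /be lt_min al1; lra.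
have be2 : be <= - (3 / 4) by rewrite /be ge_min lexx orbT.
have be0 : be < 0 by apply: le_lt_trans be2 _; lra.
have [C C0 hC] := integral_pw_le be1 be0.
have b1 : -1 < be + 2^-1 by lra.
have b2 : be + 2^-1 < 0 by apply: le_lt_trans (lerD be2 (lexx _)) _; lra.
have [C' C'0 hC'] := integral_pw_le b1 b2.
apply: (@le_lt_trans _ _ (iint (2 + (2 * N - 2)) (fun x => (wt be (vec_of x : cv))%:E))).
  rewrite (_ : 2 + (2 * N - 2) = 2 * N)%N; last lia.
  apply: le_iint => x; rewrite lee_fin ?wt_ge0//; apply: wt_nincr.
  by rewrite /be ge_min lexx.
apply: (@le_lt_trans _ _ ((C * C' * 2 ^+ (2 * N - 2))%:E)); last by rewrite ltey.
apply: iint_cube_le.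
- exact: mulr_ge0.
- by move=> x; rewrite lee_fin wt_ge0.
- move=> y /=.
  pose rho := \sum_(i < N | i != Ordinal N1) (y (2 * i)%N ^+ 2 + y (2 * i + 1)%N ^+ 2).
  have rho0 : 0 <= rho by apply: sumr_ge0 => i _; rewrite addr_ge0 ?sqr_ge0.
  have E t u : wt be (vec_of (fun j => if (j < 2)%N then if j == 1%N then t else if j == 0%N then u else 0 else y j) : cv)
      = pw be ((1 - rho - t ^+ 2) - u ^+ 2).
    rewrite wtE vnorm_vec_of (bigD1 (Ordinal N1))//=; congr pw.
    rewrite (_ : \sum_(i < N | i != Ordinal N1) _ = rho); first ring.
    apply: eq_bigr => i i0; have ip : (0 < i)%N by rewrite lt0n; exact: i0.
    have [h1 h2] : (2 * i < 2)%N = false /\ (2 * i + 1 < 2)%N = false by clear -ip; split; lia.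
    by rewrite h1 h2.
  apply: (@le_trans _ _ (\int[mu]_t (C%:E * (pw (be + 2^-1) ((1 - rho) - t ^+ 2))%:E))%E).
    apply: ge0_le_integralT => t; first by apply: integral_ge0 => u _; rewrite lee_fin wt_ge0.
    by under eq_integral do rewrite E; rewrite -EFinM; exact: hC.
  rewrite ge0_integralZl_EFin//; last 2 first.
  - by move=> t _; rewrite lee_fin pw_ge0.
  - by apply/measurable_EFinP; apply: measurable_pw; exact: measurable_sqr_sub.
  rewrite EFinM; apply: lee_wpmul2l; first by rewrite lee_fin.
  apply: le_trans (hC' _) _; rewrite lee_fin ler_piMr// /pw; case: ifP => // p.
  apply: (@le_trans _ _ (powR 1 (be + 2^-1 + 2^-1))); last by rewrite powR1.
  by apply: ge0_ler_powR; rewrite ?nnegrE ?ler01//; lra.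
- clear C hC C0 C' hC' C'0 => x j /andP[j2 jN] xj; congr EFin; rewrite wtE /pw ifF//; apply/negbTE; rewrite -leNgt.
  have jN' : (j./2 < N)%N by lia.
  rewrite subr_le0 vnorm_vec_of (bigD1 (Ordinal jN'))//=.
  have r0 : 0 <= \sum_(i < N | i != Ordinal jN') (x (2 * i)%N ^+ 2 + x (2 * i + 1)%N ^+ 2).
    by apply: sumr_ge0 => i _; rewrite addr_ge0 ?sqr_ge0.
  have xj2 : 1 <= x j ^+ 2 by rewrite -[x j ^+ 2]real_normK ?num_real// expr_ge1// ltW.
  have := sqr_ge0 (x (2 * j./2)%N); have := sqr_ge0 (x (2 * j./2 + 1)%N).
  have := odd_double_half j; rewrite -mul2n.
  have [jo|je] := boolP (odd j) => jE.
    by rewrite addnC jE; clear -r0 xj2; lra.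
  by rewrite -[(2 * _)%N]add0n jE; clear -r0 xj2; lra.
Qed.

Lemma inbox_vnorm (p : cv) S z : 0 < S -> inbox p S z -> vnorm (vsub z p) <= 2 * N%:R * S.
Proof.
move=> S0 /forallP h; apply: le_trans (vnorm_le_sum _) _.
apply: (@le_trans _ _ (\sum_(i < N) (S + S))); last first.
  by rewrite sumr_const card_ord -mulr2n -mulrnA -[_ *+ _]mulr_natl natrM mulrC mulrA.
apply: ler_sum => i _; apply: le_trans (cmod_le _) _.
by rewrite /vsub ReD ReN ImD ImN; have /andP[/ltW h1 /ltW h2] := h i; exact: lerD.
Qed.

Lemma wt_lower (al rho : R) : rho < 1 -> 0 <= rho -> exists2 w, 0 < w &
  forall z : cv, vnorm z <= rho -> w <= wt al z.
Proof.
move=> r1 r0; have p : 0 < 1 - rho ^+ 2 by rewrite subr_gt0 expr_lt1.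
exists (Num.min 1 (powR (1 - rho ^+ 2) al)); first by rewrite lt_min ltr01 powR_gt0.
move=> z zr; have zr2 : vnorm z ^+ 2 <= rho ^+ 2 by rewrite ler_pXn2r ?nnegrE ?vnorm_ge0.
have z0 := sqr_ge0 (vnorm z); rewrite wtE /pw ifT; last by lra.
have [al0|al0] := leP 0 al; rewrite ge_min.
  by apply/orP; right; apply: ge0_ler_powR => //; rewrite ?nnegrE; lra.
apply/orP; left; apply: (@le_trans _ _ (powR 1 al)); first by rewrite powR1.
by apply: powR_nincr => //; lra.
Qed.

Lemma leb_int_ge0 (G : cv -> \bar R) : (forall z, 0 <= G z)%E -> (0 <= leb_int G)%E.
Proof. by move=> G0; apply: iint_ge0. Qed.

Lemma le_leb_int (G H : cv -> \bar R) : (forall z, 0 <= G z)%E -> (forall z, G z <= H z)%E ->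
  (leb_int G <= leb_int H)%E.
Proof. by move=> G0 GH; apply: le_iint. Qed.

(** The lower bound [w] of the weight is put inside the modulus: [box_mean] is applied to [w * f]
    with level [w * A]. *)
Lemma weighted_box_mean (al rho : R) (f : cv -> R[i]) (p : cv) (S A w : R) :
  0 < S -> 0 <= A -> holo f -> rho < 1 -> (forall z, inbox p S z -> vnorm z <= rho) ->
  0 < w -> (forall z : cv, vnorm z <= rho -> w <= wt al z) ->
  (((S ^+ 2 / 16) ^+ N * w * (cmod (f p) - 16 ^+ N * A))%:E <=
   leb_int (fun z => (wt al z)%:E * (ramp A (cmod (f z)))%:E))%E.
Proof.
move=> S0 A0 hf r1 box w0 hw.
have wA : 0 <= w * A by rewrite mulr_ge0// ltW.
have hg : forall z n, inbox p S z -> cdiff (fun l => Complex w 0 * f (setz z n l)) (z n).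
  move=> z n zb; apply: cdiffZ.
  have E l : setz z n l = fun i => (if i == n then 0 else z i) + l * (if i == n then 1 else 0).
    by apply/funext => i; rewrite /setz; case: eqP; rewrite ?add0r ?mulr1 ?mulr0 ?addr0.
  have -> : (fun l => f (setz z n l)) = (fun l => f (fun i => (if i == n then 0 else z i) + l * (if i == n then 1 else 0))).
    by apply/funext => l; rewrite E.
  apply: holo_affine => //; rewrite -E.
  rewrite (_ : setz z n (z n) = z); first by apply: le_lt_trans r1; exact: box.
  by apply/funext => i; rewrite /setz; case: eqP => [->|].
have := @box_mean R N (fun z => Complex w 0 * f z) p S (w * A) S0 wA hg.
rewrite cmodM cmodr gtr0_norm//.
rewrite (_ : _ * (_ - _) = (S ^+ 2 / 16) ^+ N * w * (cmod (f p) - 16 ^+ N * A)); last by ring.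
move/le_trans; apply; apply: le_leb_int => z.
  by rewrite lee_fin; case: ifP => _ //; exact: ramp_ge0.
rewrite -EFinM lee_fin; case: ifPn => [zb|_]; last by rewrite mulr_ge0 ?wt_ge0 ?ramp_ge0.
rewrite cmodM cmodr gtr0_norm// -rampZ; last exact: ltW.
rewrite ler_wpM2r ?ramp_ge0//.
by apply: hw; exact: box.
Qed.

Lemma box_in_ball (rho : R) : rho < 1 -> exists2 S : R, 0 < S & forall p z : cv,
  vnorm p <= rho -> inbox p S z -> vnorm (vsub z p) <= (1 - rho) / 2.
Proof.
move=> r1; have N0 : 0 < 2 * N%:R + 1 :> R by rewrite ltr_wpDl// mulr_ge0.
have S0 : 0 < (1 - rho) / 2 / (2 * N%:R + 1) by rewrite !divr_gt0// subr_gt0.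
exists ((1 - rho) / 2 / (2 * N%:R + 1)) => // p z pr zb.
apply: le_trans (inbox_vnorm S0 zb) _.
rewrite mulrA ler_pdivrMr// mulrC ler_wpM2l//; lra.
Qed.

(** The mean value inequality for the constant 1 at the origin replaces the computation of a
    volume. *)
Lemma leb_wt_gt0 (al : R) : (0 < leb_int (fun z : cv => (wt al z)%:E))%E.
Proof.
have [S S0 box] := box_in_ball (ltr01 : (0 : R) < 1).
have [w w0 hw] := @wt_lower al (1 / 2) ltac:(lra) ltac:(lra).
have := @weighted_box_mean al (1 / 2) (fun=> 1) vzero S 0 w S0 (lexx 0) (@holo_cst R N 1) ltac:(lra).
move=> h; have {}h := h _ w0 hw.
apply: (@lt_le_trans _ _ (((S ^+ 2 / 16) ^+ N * w * (cmod (1 : R[i]) - 16 ^+ N * 0))%:E)).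
  rewrite lte_fin cmod1 mulr0 subr0 mulr1 mulr_gt0// exprn_gt0// divr_gt0//.
  exact: exprn_gt0.
apply: le_trans (h _) _.
  move=> z zb; apply: le_trans (vnorm_le_vsub z vzero) _; rewrite vnorm_vzero add0r.
  by have := box vzero z _ zb; rewrite vnorm_vzero subr0 => /(_ (lexx 0)).
apply: le_leb_int => z.
  by rewrite -EFinM lee_fin mulr_ge0 ?wt_ge0 ?ramp_ge0.
rewrite -EFinM lee_fin cmod1 ler_piMr ?wt_ge0// ramp_le//; lra.
Qed.
End Weights.

Section NormalizedWeight.
Context {R : realType} {N : nat}.
Local Notation cv := (cvec R N).
Notation mu := (@lebesgue_measure R).
Hypothesis N1 : (1 <= N)%N.

Definition rmeas (F : (nat -> R) -> R) := forall d (T : measurableType d) (g : T -> nat -> R),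
  coord_measurable g -> measurable_fun setT (fun t => F (g t)).

Lemma rmeas_cmeas F : rmeas F -> cmeas (fun x => (F x)%:E).
Proof. by move=> mF d T g mg; apply/measurable_EFinP; exact: mF. Qed.

Variable al : R.
Hypothesis al1 : -1 < al.

Let L := leb_int (fun z : cv => (wt al z)%:E).
Let I := fine L.
Let LE : L = I%:E.
Proof. by rewrite /I fineK// ge0_fin_numE ?leb_wt_fin// ltW// leb_wt_gt0. Qed.
Let I0 : 0 < I. Proof. by rewrite -lte_fin -LE leb_wt_gt0. Qed.

Lemma bintE (G : cv -> \bar R) :
  bint al G = ((I^-1)%:E * leb_int (fun z => (wt al z)%:E * G z))%E.
Proof. by []. Qed.

Lemma bint_le (G : cv -> \bar R) B : (bint al G <= B%:E)%E ->
  (leb_int (fun z => (wt al z)%:E * G z) <= (I * B)%:E)%E.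
Proof.
rewrite bintE EFinM => h.
have := lee_wpmul2l (ltW (_ : 0 < I%:E)%E) h; rewrite lte_fin => /(_ I0).
by rewrite muleA -[(I%:E * (I^-1)%:E)%E]EFinM mulfV ?mul1e// lt0r_neq0.
Qed.

Lemma le_bint (G H : cv -> \bar R) :
  (forall z, vnorm z < 1 -> (0 <= G z)%E) -> (forall z, vnorm z < 1 -> (G z <= H z)%E) ->
  (bint al G <= bint al H)%E.
Proof.
move=> G0 GH; rewrite !bintE; apply: lee_wpmul2l; first by rewrite lee_fin invr_ge0 ltW.
apply: le_leb_int => z; have [z1|z1] := ltP (vnorm z) 1.
- by rewrite mule_ge0 ?lee_fin ?wt_ge0// G0.
- by rewrite /wt ltNge z1/= mul0e.
- by apply: lee_wpmul2l; [rewrite lee_fin wt_ge0|exact: GH].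
- by rewrite /wt ltNge z1/= !mul0e.
Qed.

Lemma bint_cst1 : bint al (fun _ : cv => 1%E) = 1%E.
Proof.
rewrite bintE (_ : leb_int _ = L); last by congr leb_int; apply/funext => z; rewrite mule1.
by rewrite LE -EFinM mulVf// lt0r_neq0.
Qed.

Lemma bint_eval (rho : R) : 0 <= rho -> rho < 1 -> exists2 C, 0 <= C &
  forall (f : cv -> R[i]) A B, holo f -> 0 <= A ->
    (bint al (fun z => (ramp A (cmod (f z)))%:E) <= B%:E)%E ->
    forall p, vnorm p <= rho -> cmod (f p) <= 16 ^+ N * A + C * B.
Proof.
move=> r0 r1; have [S S0 box] := box_in_ball r1 (N := N).
have r2 : (1 + rho) / 2 < 1 by lra.
have [w w0 hw] := @wt_lower R N al ((1 + rho) / 2) r2 ltac:(lra).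
pose c := (S ^+ 2 / 16) ^+ N * w.
have c0 : 0 < c by rewrite /c mulr_gt0// exprn_gt0// divr_gt0// exprn_gt0.
exists (I / c); first by rewrite divr_ge0// ltW.
move=> f A B hf A0 /bint_le h p pr.
have inb z : inbox p S z -> vnorm z <= (1 + rho) / 2.
  by move=> zb; have := box p z pr zb; have := vnorm_le_vsub z p; lra.
have := le_trans (weighted_box_mean S0 A0 hf r2 inb w0 hw) h.
rewrite lee_fin -/c mulrC -ler_pdivlMr// => le.
rewrite -lerBlDl; apply: le_trans le _.
by rewrite le_eqVlt; apply/orP; left; apply/eqP; field; rewrite lt0r_neq0.
Qed.

(** The integrals of [wt al z * (1 - q z ^+ m)] increase to the full mass, because [q] is below 1
    off a null set; hence those of [wt al z * q z ^+ m] tend to 0. *)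
Lemma bint_pow_small (q : cv -> R) : (forall z, 0 <= q z <= 1) ->
  rmeas (fun x => q (vec_of x)) ->
  leb_int (fun z => (if 1 <= q z then wt al z else 0)%:E) = 0%E ->
  forall (v : R) (k : nat), 0 <= v -> exists2 m, (k <= m)%N &
    (bint al (fun z => (v * q z ^+ m)%:E) <= 1)%E.
Proof.
move=> q01 mq null v k v0.
have q0 z : 0 <= q z by case/andP: (q01 z).
have qm z m : 0 <= q z ^+ m <= 1.
  by case/andP: (q01 z) => a b; rewrite exprn_ge0//= exprn_ile1.
pose G m z := wt al z * (1 - q z ^+ m).
pose P m z := wt al z * q z ^+ m.
pose H z := if 1 <= q z then 0 else wt al z.
pose H' z := if 1 <= q z then wt al z else 0.
have G0 m z : 0 <= G m z by rewrite mulr_ge0 ?wt_ge0// subr_ge0; case/andP: (qm z m).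
have P0 m z : 0 <= P m z by rewrite mulr_ge0 ?wt_ge0// exprn_ge0.
have H0 z : 0 <= H z by rewrite /H; case: ifP => // _; exact: wt_ge0.
have H'0 z : 0 <= H' z by rewrite /H'; case: ifP => // _; exact: wt_ge0.
have mqm m : rmeas (fun x => q (vec_of x) ^+ m).
  by move=> d T g mg; apply: measurable_funX; exact: mq.
have mG m : cmeas (fun x => (G m (vec_of x))%:E).
  apply: rmeas_cmeas => d T g mg; apply: measurable_funM; first exact: measurable_wt.
  by apply: measurable_funB => //; exact: mqm.
have mP m : cmeas (fun x => (P m (vec_of x))%:E).
  by apply: rmeas_cmeas => d T g mg; apply: measurable_funM; [exact: measurable_wt|exact: mqm].
have mb : forall d (T : measurableType d) (g : T -> nat -> R), coord_measurable g ->
    measurable_fun setT (fun t => 1 <= q (vec_of (g t))).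
  by move=> d T g mg; apply: measurable_fun_ler => //; exact: mq.
have mH : cmeas (fun x => (H (vec_of x))%:E).
  apply: rmeas_cmeas => d T g mg; apply: measurable_fun_ifT => //; first exact: mb.
  exact: measurable_wt.
have mH' : cmeas (fun x => (H' (vec_of x))%:E).
  apply: rmeas_cmeas => d T g mg; apply: measurable_fun_ifT => //; first exact: mb.
  exact: measurable_wt.
have LH : leb_int (fun z => (H z)%:E) = I%:E.
  rewrite -LE -[LHS]adde0 -null /leb_int -iintD//; last 2 first.
  - by move=> x; rewrite lee_fin.
  - by move=> x; rewrite lee_fin; exact: H'0.
  congr (iint _ _); apply/funext => x; rewrite -EFinD /H; congr EFin.
  by case: ifP => _; rewrite ?add0r ?addr0.
have LGP m : (leb_int (fun z => (G m z)%:E) + leb_int (fun z => (P m z)%:E) = I%:E)%E.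
  rewrite -LE /leb_int -iintD//; last 2 first.
  - by move=> x; rewrite lee_fin.
  - by move=> x; rewrite lee_fin.
  congr (iint _ _); apply/funext => x; rewrite -EFinD /G /P; congr EFin; ring.
have lim : leb_int (fun z => (G m z)%:E) @[m --> \oo] --> I%:E.
  rewrite -LH /leb_int; apply: (@iint_monotone_cvg R (2 * N) (fun m x => (G m (vec_of x))%:E)) => //.
  - by move=> m x; rewrite lee_fin.
  - move=> x m n mn; rewrite lee_fin /G ler_wpM2l ?wt_ge0// lerD2l lerN2.
    by case/andP: (q01 (vec_of x)) => a b; exact: ler_wiXn2l.
  move=> x; apply: cvg_EFin; first exact: nearW.
  rewrite (_ : fine \o _ = (fun m => G m (vec_of x)))//= /H; case: leP => q1.
    have -> : (fun m => G m (vec_of x)) = fun=> 0.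
      apply/funext => m; rewrite /G (_ : q (vec_of x) = 1) ?expr1n ?subrr ?mulr0//.
      by apply/eqP; rewrite eq_le q1 andbT; case/andP: (q01 (vec_of x)).
    exact: cvg_cst.
  rewrite [X in _ --> X](_ : _ = wt al (vec_of x : cv) * (1 - 0)); last by rewrite subr0 mulr1.
  apply: cvgMr; apply: cvgB; first exact: cvg_cst.
  by apply: cvg_expr; rewrite ger0_norm.
(* A remaining mass of at most [I / (v + 1)] gives a mean of at most [v / (v + 1)]; the [+ 1] covers
   [v = 0]. *)
have [m km hm] : exists2 m, (k <= m)%N & ((I - I / (v + 1))%:E < leb_int (fun z => (G m z)%:E))%E.
  apply: contrapT => h.
  have v1 : 0 < v + 1 by rewrite ltr_wpDl.
  have : (I%:E <= (I - I / (v + 1))%:E)%E.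
    rewrite -(cvg_lim _ lim)//; apply: lime_le; first by apply/cvg_ex; exists I%:E.
    exists k => // m /= km; rewrite leNgt; apply/negP => lt; apply: h; by exists m.
  by rewrite lee_fin; rewrite lerBrDl gerDr leNgt divr_gt0.
exists m => //.
have v1 : 0 < v + 1 by rewrite ltr_wpDl.
have Pm : (leb_int (fun z => (P m z)%:E) <= (I / (v + 1))%:E)%E.
  have := LGP m; have := leb_int_ge0 (fun z => P0 m z : (0 <= (P m z)%:E)%E).
  move: hm; case: (leb_int (fun z => (G m z)%:E)) => [g| |] hm; case: (leb_int _) => [p| |] //.
  by move: hm; rewrite lte_fin lee_fin => hm _ [e]; rewrite lee_fin; lra.
rewrite bintE (_ : leb_int _ = (v%:E * leb_int (fun z => (P m z)%:E))%E); last first.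
  rewrite /leb_int -iintZ//; last by move=> x; rewrite lee_fin.
  by congr (iint _ _); apply/funext => x; rewrite -!EFinM /P; congr EFin; ring.
apply: (@le_trans _ _ ((I^-1)%:E * (v%:E * (I / (v + 1))%:E))%E).
  apply: lee_wpmul2l; first by rewrite lee_fin invr_ge0 ltW.
  by apply: lee_wpmul2l; first rewrite lee_fin.
have e : I^-1 * (v * (I / (v + 1))) = v / (v + 1) by field; rewrite !lt0r_neq0.
by rewrite -!EFinM e lee_fin ler_pdivrMr// mul1r lerDl.
Qed.
End NormalizedWeight.

(** * Peak functions and the null sets where they peak *)

Section PeakFunctions.
Context {R : realType} {N : nat}.
Local Notation cv := (cvec R N).
Notation mu := (@lebesgue_measure R).

Definition vdot (e z : cv) : R[i] :=
  \sum_k Complex (complex.Re (e k)) (- complex.Im (e k)) * z k.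

Definition peak (e z : cv) : R[i] := Complex 2^-1 0 * (1 + vdot e z).

Lemma cmod_vdot e z : cmod (vdot e z) <= vnorm e * vnorm z.
Proof.
apply: le_trans (cmod_sum _ _) _; rewrite /vnorm.
apply: le_trans (sum_mul_le (fun i => cmod (e i)) (fun i => cmod (z i))).
by apply: ler_sum => i _; rewrite cmodM /cmod/= sqrrN.
Qed.

Lemma vdotB e z w : vdot e (vsub z w) = vdot e z - vdot e w.
Proof. by rewrite /vdot -sumrB; apply: eq_bigr => k _; rewrite /vsub mulrBr. Qed.

Lemma vdotZ e (r : R) z : vdot e (vscale r z) = Complex r 0 * vdot e z.
Proof. by rewrite /vdot mulr_sumr; apply: eq_bigr => k _; rewrite /vscale mulrCA. Qed.

Lemma Re_vdot_self (e : cv) : complex.Re (vdot e e) = vnorm e ^+ 2.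
Proof.
rewrite vnorm_sqr /vdot; elim/big_ind2: _ => // [a b c d <- <-|k _]; first by rewrite ReD.
by rewrite cmod_sqr; case: (e k) => x y /=; ring.
Qed.

Lemma holo_peak e : holo (peak e).
Proof.
apply: holoM; first exact: holo_cst.
by apply: holoD; [exact: holo_cst|exact: holo_linear].
Qed.

Section Unit.
Variable e : cv.
Hypothesis e1 : vnorm e = 1.

Lemma peak_le z : cmod (peak e z) <= (1 + vnorm z) / 2.
Proof.
rewrite /peak cmodM cmodr gtr0_norm ?invr_gt0// mulrC ler_pM2r ?invr_gt0//.
by apply: le_trans (cmodD _ _) _; rewrite cmod1 lerD2l -[vnorm z]mul1r -e1 cmod_vdot.
Qed.

Lemma peak_near w : vnorm w <= 1 -> 1 - vnorm (vsub w e) / 2 <= cmod (peak e w).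
Proof.
move=> w1; have h1 : cmod (vdot e (vsub w e)) <= vnorm (vsub w e).
  by apply: le_trans (cmod_vdot _ _) _; rewrite e1 mul1r.
have h2 := le_trans (Re_le_cmod _) h1; have h3 := Re_le_cmod (1 + vdot e w).
move: h2; rewrite vdotB ReD ReN Re_vdot_self e1 expr1n ler_norml => /andP[h2 _].
rewrite /peak cmodM cmodr gtr0_norm ?invr_gt0//.
move: h3; rewrite ReD [complex.Re 1]/= => h3; have := ler_norm (1 + complex.Re (vdot e w)); lra.
Qed.

Lemma peak_cont z : cont_at (fun w => cmod (peak e w)) z.
Proof.
move=> ep ep0; exists ep => // w wz; apply: le_lt_trans (cmod_dist _ _) _.
rewrite /peak -mulrBr cmodM cmodr gtr0_norm ?invr_gt0//.
rewrite (_ : 1 + vdot e w - (1 + vdot e z) = vdot e (vsub w z)); last by rewrite vdotB; ring.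
have := cmod_vdot e (vsub w z); rewrite e1 mul1r => h; have := vnorm_ge0 (vsub w z); lra.
Qed.

(** The equality case of Cauchy-Schwarz: a modulus of at least 2 for [1 + vdot e z] forces the real
    part of [vdot e z] to be at least 1, and then the squared distance from [z] to [e] is at most
    0. *)
Lemma peak_max z : vnorm z <= 1 -> 1 <= cmod (peak e z) -> z = e.
Proof.
move=> z1 h; have h2 : 2 <= cmod (1 + vdot e z).
  by move: h; rewrite /peak cmodM cmodr gtr0_norm ?invr_gt0//; lra.
have h3 : cmod (1 + vdot e z) ^+ 2 = 1 + 2 * complex.Re (vdot e z) + cmod (vdot e z) ^+ 2.
  by rewrite !cmod_sqr ReD ImD [complex.Re 1]/= [complex.Im 1]/=; ring.
have h4 : cmod (vdot e z) <= 1.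
  by apply: le_trans (cmod_vdot _ _) _; rewrite e1 mul1r.
have h5 : cmod (vdot e z) ^+ 2 <= 1 by rewrite expr_le1 ?cmod_ge0.
have h6 : 2 ^+ 2 <= cmod (1 + vdot e z) ^+ 2 by rewrite ler_pXn2r ?nnegrE ?cmod_ge0.
have h7 : 1 <= complex.Re (vdot e z) by lra.
have h8 : vnorm (vsub z e) ^+ 2 = vnorm z ^+ 2 + vnorm e ^+ 2 - 2 * complex.Re (vdot e z).
  rewrite !vnorm_sqr /vdot (_ : complex.Re _ = \sum_(k < N) complex.Re (Complex (complex.Re (e k)) (- complex.Im (e k)) * z k)).
    rewrite mulr_sumr -big_split -sumrB; apply: eq_bigr => k _.
    by rewrite !cmod_sqr /vsub; case: (z k) => a b; case: (e k) => c d /=; ring.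
  by elim/big_ind2: _ => // a b c d <- <-; rewrite ReD.
have h9 : vnorm z ^+ 2 <= 1 by rewrite expr_le1 ?vnorm_ge0.
have h10 : vnorm (vsub z e) ^+ 2 <= 0 by rewrite h8 e1; lra.
have h11 : vnorm (vsub z e) = 0.
  by apply/eqP; rewrite -sqrf_eq0 eq_le h10 sqr_ge0.
have := vnorm_eq0 h11 => h12; apply/funext => i; apply/eqP; rewrite -subr_eq0; apply/eqP.
exact: (congr1 (fun u : cv => u i) h12).
Qed.
End Unit.

Lemma integral_single (f : R -> \bar R) a : (forall x, x != a -> f x = 0%E) -> (\int[mu]_x f x = 0)%E.
Proof.
move=> h; transitivity (\int[mu]_(x in [set a]) f x)%E; last exact: integral_set1.
rewrite [RHS]integral_mkcond; apply: eq_integral => x _; rewrite patchE; case: ifPn => //.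
by rewrite notin_setE/= => /eqP xa; rewrite h.
Qed.

(** Made for a ray: its first complex coordinate stays on a real line of the plane, which is the
    graph of [c * x 1] over [x 1], or the axis [x 1 = 0]. *)
Lemma iint_line_null k (G : (nat -> R) -> \bar R) :
  (exists c, forall x, x 0%N != c * x 1%N -> G x = 0%E) \/ (forall x, x 1%N != 0 -> G x = 0%E) ->
  iint k.+2 G = 0%E.
Proof.
elim: k G => [|k IH] G h.
  case: h => [[c h]|h] /=.
    transitivity (\int[mu]_(t in setT) 0)%E; last by rewrite integral0.
    by apply: eq_integral => t _; apply: (@integral_single _ (c * t)) => u ut; exact: h.
  apply: (@integral_single _ 0) => t t0; under eq_integral do rewrite h//.
  by rewrite integral0.
rewrite iintS; under eq_integral => t _.
  rewrite IH; first over.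
  by case: h => [[c h]|h]; [left; exists c|right] => x xx; apply: h.
by rewrite integral0.
Qed.
End PeakFunctions.

(** * Evaluation bounds from spherical means *)

Section HardyEvaluation.
Context {R : realType} {N : nat}.
Local Notation cv := (cvec R N).
Notation mu := (@lebesgue_measure R).

(** Substitution [r = m * t]; the part of [[m, 2 * m]] beyond 1 contributes nothing, as [h] vanishes
    there. *)
Lemma dilated_integral_le (h : R -> R) (m : R) : 0 < m -> continuous h -> (forall x, 0 <= h x) ->
  (forall r, 1 <= r -> h r = 0) ->
  (\int[mu]_(t in `[1%R, 2%R]) (h (m * t))%:E <= (m^-1)%:E * \int[mu]_(r in `]0%R, 1%R[) (h r)%:E)%E.
Proof.
move=> m0 ch h0 h1.
have dF (t : R) : is_derive t (1 : R) ( *%R m : R -> R) m.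
  by apply: is_derive_eq; rewrite /GRing.scale/= mulr1.
have eF : derive1 ( *%R m : R -> R) = cst m.
  by apply/funext => t; rewrite derive1E; have [] := dF t.
have cF : continuous ( *%R m : R -> R) by move=> t; apply: mulrl_continuous.
have cm (x : R) : cst m y @[y --> x] --> m by exact: cvg_cst.
have mh : measurable_fun setT h by exact: continuous_measurable_fun.
have sub : (\int[mu]_(x in `[m, (m * 2)%R]) (h x)%:E =
    \int[mu]_(x in `[1%R, 2%R]) (h (m * x) * m)%:E)%E.
  have := @integration_by_substitution_increasing R ( *%R m) h 1 2.
  rewrite eF mulr1; apply.
  - by rewrite ler1n.
  - by move=> x y _ _ xy; rewrite ltr_pM2l.
  - by move=> t _; exact: cm.
  - by apply/cvg_ex; exists m; exact: cvg_cst.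
  - by apply/cvg_ex; exists m; exact: cvg_cst.
  - split; [by move=> t _; have [] := dF t|exact: cvg_at_right_filter (cF 1)|].
    exact: cvg_at_left_filter (cF 2).
  - exact: continuous_subspaceT.
rewrite (_ : (\int[mu]_(t in `[1%R, 2%R]) _ = \int[mu]_(t in `[1%R, 2%R]) ((m^-1)%:E * (h (m * t) * m)%:E))%E); last first.
  by apply: eq_integral => t _; rewrite -EFinM; congr EFin; field; rewrite lt0r_neq0.
rewrite ge0_integralZl_EFin//; last 3 first.
- by move=> t _; rewrite lee_fin mulr_ge0// ltW.
- apply/measurable_EFinP; apply: measurable_funM => //; exact: measurableT_comp.
- by rewrite invr_ge0 ltW.
apply: lee_wpmul2l; first by rewrite lee_fin invr_ge0 ltW.
rewrite -sub [leLHS]integral_mkcond [leRHS]integral_mkcond; apply: ge0_le_integralT => x.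
  by rewrite patchE; case: ifP => // _; rewrite lee_fin.
rewrite !patchE; case: ifPn => [|_]; last by case: ifP => // _; rewrite lee_fin.
rewrite inE/= in_itv/= => /andP[mx _]; case: ifPn => //.
rewrite notin_setE/= in_itv/= => /negP; rewrite (lt_le_trans m0 mx)/= -leNgt => x1.
by rewrite h1.
Qed.

Lemma measurable_cont_vec (F : cv -> R) d (T : measurableType d) (g : T -> nat -> R) :
  (forall z, cont_at F z) -> coord_measurable g ->
  measurable_fun setT (fun t => F (vec_of (g t))).
Proof.
move=> cF mg; have := @measurable_vec R N _ T g setT F mg.
under [X in _ -> _ -> measurable_fun _ X]eq_fun do rewrite asboolT//.
by apply => //; move=> z _; exists 1.
Qed.

Lemma vscale_vec_of (r : R) (x : nat -> R) :
  vscale r (vec_of x : cv) = vec_of (fun j => r * x j).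
Proof. by apply/funext => i; rewrite /vscale /vec_of; simpc; congr Complex; ring. Qed.

Lemma vscaleM (r s : R) (z : cv) : vscale r (vscale s z) = vscale (r * s) z.
Proof. by apply/funext => i; rewrite /vscale mulrA; simpc. Qed.

Lemma vscale1 (z : cv) : vscale 1 z = z.
Proof. by apply/funext => i; rewrite /vscale mul1r. Qed.

Lemma vscale_dist (r s : R) (z : cv) : vnorm (vsub (vscale r z) (vscale s z)) = `|r - s| * vnorm z.
Proof.
rewrite -vnorm_vscale; congr vnorm; apply/funext => i.
by rewrite /vsub /vscale -mulrBl; congr (_ * _); simpc.
Qed.

Lemma bint_ge0 (al : R) (G : cv -> \bar R) : (forall z, 0 <= G z)%E -> (0 <= bint al G)%E.
Proof.
move=> G0; apply: mule_ge0.
  by rewrite lee_fin invr_ge0 fine_ge0// leb_int_ge0// => z; rewrite lee_fin wt_ge0.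
by apply: leb_int_ge0 => z; rewrite mule_ge0// lee_fin wt_ge0.
Qed.

Lemma sint_ge0 (G : cv -> \bar R) : (forall z, 0 <= G z)%E -> (0 <= sint G)%E.
Proof. by move=> G0; exact: bint_ge0. Qed.

Section Cutoff.
Variables (f : cv -> R[i]) (A r2 : R).
Hypotheses (hf : holo f) (r21 : r2 < 1).

(** The factor [ramp 0 (r2 - vnorm z)] makes the truncation of [f], whose values are controlled only
    in the ball, into a continuous function on the whole space, so that all the integrands are
    measurable. *)
Definition cutoff_ramp (z : cv) : R :=
  if vnorm z < 1 then ramp 0 (r2 - vnorm z) * ramp A (cmod (f z)) else 0.

Lemma cutoff_ramp_ge0 z : 0 <= cutoff_ramp z.
Proof. by rewrite /cutoff_ramp; case: ifP => // _; rewrite mulr_ge0 ?ramp_ge0. Qed.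

Lemma cutoff_ramp_out z : r2 <= vnorm z -> cutoff_ramp z = 0.
Proof.
move=> h; rewrite /cutoff_ramp; case: ifP => // _.
by rewrite (_ : ramp 0 _ = 0) ?mul0r// /ramp max_l// subr0 subr_le0.
Qed.

Lemma cutoff_ramp_le z : cutoff_ramp z <= ramp A (cmod (f z)).
Proof.
rewrite /cutoff_ramp; case: ifP => [_|_]; last exact: ramp_ge0.
by rewrite ler_piMl ?ramp_ge0// ramp_le// subr0 lerBlDr ler_wpDr ?vnorm_ge0// ltW.
Qed.

Lemma cutoff_ramp_cont z : cont_at cutoff_ramp z.
Proof.
have [z1|z1] := ltP (vnorm z) 1; last first.
  move=> e e0; exists (1 - r2); first by rewrite subr_gt0.
  move=> w wz; have wr : r2 <= vnorm w by have := vnorm_le_vsub z w; rewrite vnorm_vsubC; lra.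
  by rewrite !cutoff_ramp_out ?subrr ?normr0//; apply: ltW; exact: lt_le_trans z1.
move=> e e0; pose a := ramp A (cmod (f z)).
have a0 : 0 <= a by exact: ramp_ge0.
have [r r0 hr] := holo_vcont hf z1 (divr_gt0 e0 (ltr0n _ 2)).
pose r' := Num.min (Num.min r (1 - vnorm z)) (e / 2 / (a + 1)).
have a1 : 0 < a + 1 by lra.
exists r'; first by rewrite /r' !lt_min r0 subr_gt0 z1/= !divr_gt0.
move=> w; rewrite /r' !lt_min => /andP[/andP[wr w1] wa].
have {}w1 : vnorm w < 1 by have := vnorm_le_vsub w z; lra.
rewrite /cutoff_ramp w1 z1.
have h1 := le_lt_trans (le_trans (ramp_dist A (cmod (f w)) (cmod (f z))) (cmod_dist _ _)) (hr w wr).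
have h2 : `|ramp 0 (r2 - vnorm w) - ramp 0 (r2 - vnorm z)| <= vnorm (vsub w z).
  apply: le_trans (ramp_dist _ _ _) _; rewrite (_ : _ - _ = - (vnorm w - vnorm z)); last by ring.
  by rewrite normrN; exact: vnorm_dist.
have h3 : ramp 0 (r2 - vnorm w) <= 1 by rewrite ramp_le// subr0 lerBlDr ler_wpDr ?vnorm_ge0// ltW.
have h4 := ramp_ge0 0 (r2 - vnorm w).
rewrite (_ : _ - _ = ramp 0 (r2 - vnorm w) * (ramp A (cmod (f w)) - a) +
   (ramp 0 (r2 - vnorm w) - ramp 0 (r2 - vnorm z)) * a); last by rewrite /a; ring.
apply: le_lt_trans (ler_normD _ _) _; rewrite !normrM (ger0_norm h4) (ger0_norm a0).
have h5 : vnorm (vsub w z) * (a + 1) < e / 2 by rewrite -ltr_pdivlMr.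
have h6 : ramp 0 (r2 - vnorm w) * `|ramp A (cmod (f w)) - a| <= `|ramp A (cmod (f w)) - a|.
  by rewrite ler_piMl.
have h7 : `|ramp 0 (r2 - vnorm w) - ramp 0 (r2 - vnorm z)| * a <= vnorm (vsub w z) * a.
  by rewrite ler_wpM2r.
have h8 := vnorm_ge0 (vsub w z); rewrite -/a in h1.
clear -h1 h5 h6 h7 h8; lra.
Qed.

Lemma cutoff_ramp_ray (z : cv) : vnorm z = 1 -> continuous (fun r => cutoff_ramp (vscale r z)).
Proof.
move=> z1 r; apply/cvgrPdist_lt => e e0.
have [d d0 hd] := cutoff_ramp_cont (vscale r z) e0.
near=> s; rewrite distrC; apply: hd; rewrite vscale_dist z1 mulr1 distrC.
by near: s; apply: cvgr_dist_lt.
Unshelve. all: by end_near. Qed.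
End Cutoff.

Lemma holo_setz (f : cv -> R[i]) (t : R) (z : cv) n : holo f -> vnorm (vscale t z) < 1 ->
  cdiff (fun l => f (vscale t (setz z n l))) (z n).
Proof.
move=> hf tz1; pose b : cv := fun i => if i == n then 0 else Complex t 0 * z i.
pose v : cv := fun i => if i == n then Complex t 0 else 0.
have E l : vscale t (setz z n l) = fun i => b i + l * v i.
  apply/funext => i; rewrite /vscale /setz /b /v; case: eqP => _.
    by rewrite add0r mulrC.
  by rewrite mulr0 addr0.
have -> : (fun l => f (vscale t (setz z n l))) = (fun l => f (fun i => b i + l * v i)).
  by apply/funext => l; rewrite E.
apply: holo_affine => //; rewrite -E (_ : setz z n (z n) = z)//.
by apply/funext => i; rewrite /setz; case: eqP => [->|].
Qed.

Lemma measurable_scaled d (T : measurableType d) (c : T -> R) (g : T -> nat -> R) :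
  measurable_fun setT c -> coord_measurable g -> coord_measurable (fun t j => c t * g t j).
Proof. by move=> mc mg i; apply: measurable_funM. Qed.

Hypothesis N1 : (1 <= N)%N.

(* The box mean value inequality is applied to the dilates [z |-> f (t z)], [1 <= t <= 2];
   averaging over [t] and substituting [r = t |z|] turns the radial integral into an
   integral of spherical means. *)
Lemma sint_eval_away (rho : R) : rho < 1 -> exists2 C, 0 <= C &
  forall (f : cv -> R[i]) A B, holo f -> 0 <= A ->
    (forall r, 0 < r < 1 -> (sint (fun z : cv => (ramp A (cmod (f (vscale r z))))%:E) <= B%:E)%E) ->
    forall p, 1 / 4 <= vnorm p <= rho -> cmod (f p) <= 16 ^+ N * A + C * B.
Proof.
move=> r1.
have N0 : 0 < 2 * N%:R + 1 :> R by rewrite ltr_wpDl// mulr_ge0.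
(* For [1 <= t <= 2], the box around [p / t], once dilated by [t], stays in the ball of radius
   [(1 + rho) / 2], and the box itself stays at distance at least [1 / 16] from the origin. *)
pose S := (1 - rho) / 32 / (2 * N%:R + 1).
have S0 : 0 < S by rewrite /S !divr_gt0// subr_gt0.
have SN : 2 * N%:R * S <= (1 - rho) / 32.
  rewrite /S mulrA ler_pdivrMr// mulrC ler_wpM2l//; lra.
(* [r2] exceeds the radius of the dilated boxes by [d], so the cutoff factor is at least [d] on
   them. *)
pose d := (1 - rho) / 4; have d0 : 0 < d by rewrite /d divr_gt0// subr_gt0.
pose r2 := (1 + rho) / 2 + d; have r21 : r2 < 1 by rewrite /r2 /d; lra.
pose c := (S ^+ 2 / 16) ^+ N.
have c0 : 0 < c by rewrite /c exprn_gt0// divr_gt0// exprn_gt0.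
pose I := fine (leb_int (fun z : cv => (wt 0 z)%:E)).
have I0 : 0 <= I by rewrite fine_ge0// leb_int_ge0// => z; rewrite lee_fin wt_ge0.
have dc : 0 < d * c by rewrite mulr_gt0.
exists (16 * I / (d * c)); first by rewrite divr_ge0 ?(ltW dc)// mulr_ge0.
move=> f A B hf A0 hB p /andP[p4 pr].
have B0 : 0 <= B.
  have h : 0 < (2^-1 : R) < 1 by rewrite invr_gt0 invf_lt1// ltr0n ltr1n.
  by rewrite -lee_fin; apply: le_trans (hB _ h); apply: sint_ge0 => z; rewrite lee_fin ramp_ge0.
pose X := d * c * (cmod (f p) - 16 ^+ N * A).
suff XB : X <= 16 * I * B.
  rewrite -lerBlDl (_ : _ / _ * B = 16 * I * B / (d * c)); last by field; rewrite !lt0r_neq0.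
  by rewrite ler_pdivlMr// mulrC.
have [X0|X0] := leP X 0; first by apply: le_trans X0 _; rewrite !mulr_ge0.
pose Psi := cutoff_ramp f A r2.
have Psi0 z : 0 <= Psi z by exact: cutoff_ramp_ge0.
have cPsi z : cont_at Psi z by exact: cutoff_ramp_cont.
pose chi (z : cv) : R := if (1 / 16 <= vnorm z) && (vnorm z < 1) then 1 else 0.
have chi0 z : 0 <= chi z by rewrite /chi; case: ifP.
have step1 t : 1 <= t <= 2 -> (X%:E <= leb_int (fun z : cv => (chi z * Psi (vscale t z))%:E))%E.
  move=> /andP[t1 t2]; have t0 : 0 < t by lra.
  have tK : vscale t (vscale t^-1 p) = p by rewrite vscaleM divff ?lt0r_neq0// vscale1.
  have ti : 1 / 8 <= vnorm (vscale t^-1 p).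
    rewrite vnorm_vscale gtr0_norm ?invr_gt0// [leRHS]mulrC ler_pdivlMr//; clear -t2 p4; lra.
  have box z : inbox (vscale t^-1 p) S z -> vnorm (vscale t z) <= (1 + rho) / 2 /\ 1 / 16 <= vnorm z.
    move=> /(inbox_vnorm S0) zb; split.
      apply: le_trans (vnorm_le_vsub _ p) _.
      rewrite -[X in vsub _ X]tK (_ : vsub _ _ = vscale t (vsub z (vscale t^-1 p))); last first.
        by apply/funext => i; rewrite /vsub /vscale mulrBr.
      rewrite vnorm_vscale gtr0_norm//.
      have := ler_pM (ltW t0) (vnorm_ge0 _) t2 (le_trans zb SN); lra.
    have := vnorm_le_vsub (vscale t^-1 p) z; rewrite vnorm_vsubC; lra.
  have dA : 0 <= d * A by rewrite mulr_ge0// ltW.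
  have hg z n : inbox (vscale t^-1 p) S z ->
      cdiff (fun l => Complex d 0 * f (vscale t (setz z n l))) (z n).
    move=> /box[zb _]; apply: cdiffZ; apply: holo_setz => //; apply: le_lt_trans zb _; lra.
  have := @box_mean R N (fun z => Complex d 0 * f (vscale t z)) (vscale t^-1 p) S (d * A) S0 dA hg.
  rewrite tK cmodM cmodr gtr0_norm// (_ : _ * (_ - _) = X); last by rewrite /X /c; ring.
  move/le_trans; apply; apply: le_leb_int => z.
    by rewrite lee_fin; case: ifP => _ //; exact: ramp_ge0.
  rewrite lee_fin; case: ifPn => [/box[zb z16]|_]; last by rewrite mulr_ge0.
  have tz1 : vnorm (vscale t z) < 1 by apply: le_lt_trans zb _; lra.
  have z1 : vnorm z < 1.
    apply: le_lt_trans tz1; rewrite vnorm_vscale gtr0_norm//.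
    by rewrite ler_peMl ?vnorm_ge0.
  rewrite /chi z16 z1 mul1r cmodM cmodr gtr0_norm// -rampZ; last exact: ltW.
  rewrite /Psi /cutoff_ramp tz1 ler_wpM2r ?ramp_ge0//.
  apply: le_trans (ramp_ge _ _); rewrite subr0 /r2; clear -zb; lra.
(* [G t] lives on the dilate by [t], [H r] on the sphere of radius [r]. The substitution costs a
   factor [(vnorm z)^-1], at most 16 where [chi] is nonzero; this is why the origin is avoided. *)
pose G (t : R) x := ((if 1 <= t <= 2 then chi (vec_of x) * Psi (vscale t (vec_of x)) else 0)%:E).
pose H (r : R) x := ((if 0 < r < 1 then 16 * (wt 0 (vec_of x : cv) *
  Psi (vscale r (vscale (vnorm (vec_of x : cv))^-1 (vec_of x)))) else 0)%:E).
have G0 t x : (0 <= G t x)%E by rewrite lee_fin; case: ifP => // _; rewrite mulr_ge0.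
have H0 t x : (0 <= H t x)%E.
  by rewrite lee_fin; case: ifP => // _; rewrite mulr_ge0// mulr_ge0// wt_ge0.
have mchi d' (T : measurableType d') (g : T -> nat -> R) : coord_measurable g ->
    measurable_fun setT (fun t => chi (vec_of (g t))).
  move=> mg; have mn := @measurable_vnorm R N _ T g mg.
  apply: measurable_fun_ifT => //; apply: measurable_and; first exact: measurable_fun_ler.
  exact: measurable_fun_ltr.
have mPsi d' (T : measurableType d') (q : T -> R) (g : T -> nat -> R) :
    measurable_fun setT q -> coord_measurable g ->
    measurable_fun setT (fun t => Psi (vscale (q t) (vec_of (g t)))).
  move=> mq mg; under eq_fun do rewrite vscale_vec_of.
  by apply: measurable_cont_vec => //; exact: measurable_scaled.
have mPsi2 d' (T : measurableType d') (q : T -> R) (g : T -> nat -> R) :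
    measurable_fun setT q -> coord_measurable g ->
    measurable_fun setT (fun t => Psi (vscale (q t) (vscale (vnorm (vec_of (g t) : cv))^-1 (vec_of (g t))))).
  move=> mq mg; under eq_fun do rewrite vscaleM.
  by apply: mPsi => //; apply: measurable_funM => //; apply: measurable_inv; exact: measurable_vnorm.
have jG : jmeas G.
  move=> d' T' p' g mp mg; apply/measurable_EFinP; apply: measurable_fun_ifT => //.
    by apply: measurable_and; exact: measurable_fun_ler.
  by apply: measurable_funM; [exact: mchi|exact: mPsi].
have jH : jmeas H.
  move=> d' T' p' g mp mg; apply/measurable_EFinP; apply: measurable_fun_ifT => //.
    by apply: measurable_and; exact: measurable_fun_ltr.
  apply: measurable_funM => //; apply: measurable_funM; [exact: measurable_wt|exact: mPsi2].
have step2 : (X%:E <= \int[mu]_t iint (2 * N) (G t))%E.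
  apply: (@le_trans _ _ (\int[mu]_(t in `[1%R, 2%R]) X%:E)%E).
    rewrite integral_cst//= lebesgue_measure_itv/= lte_fin ltr1n -EFinD -EFinM lee_fin.
    by rewrite le_eqVlt; apply/orP; left; apply/eqP; ring.
  rewrite integral_mkcond; apply: ge0_le_integralT => t; rewrite patchE; case: ifPn => //.
  - by move=> _; rewrite lee_fin ltW.
  - rewrite inE/= in_itv/= => t12; apply: le_trans (step1 t t12) _.
    by apply: le_iint => x; [rewrite lee_fin mulr_ge0|rewrite /G t12].
  - by move=> _; exact: (iint_ge0 _ (G0 t)).
have step3 x : (\int[mu]_t G t x <= \int[mu]_t H t x)%E.
  pose z : cv := vec_of x; have [/andP[z16 z1]|nz] := boolP ((1 / 16 <= vnorm z) && (vnorm z < 1)); last first.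
    rewrite integral0_eq; first exact: integral_ge0.
    by move=> t _; rewrite /G /chi (negbTE nz) mul0r if_same.
  have z0 : 0 < vnorm z by lra.
  pose h r := Psi (vscale r (vscale (vnorm z)^-1 z)).
  have ch : continuous h.
    apply: cutoff_ramp_ray => //.
    by rewrite vnorm_vscale ger0_norm ?invr_ge0 ?vnorm_ge0// mulVf ?lt0r_neq0.
  have h0 r : 0 <= h r by exact: Psi0.
  have h1 r : 1 <= r -> h r = 0.
    move=> r1'; apply: cutoff_ramp_out; rewrite !vnorm_vscale (ger0_norm (_ : 0 <= (vnorm z)^-1)) ?invr_ge0 ?vnorm_ge0//.
    rewrite mulVf ?lt0r_neq0// mulr1 ger0_norm; last exact: le_trans ler01 r1'.
    by apply: ltW; exact: lt_le_trans r1'.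
  have := dilated_integral_le z0 ch h0 h1.
  have -> : (\int[mu]_t G t x = \int[mu]_(t in `[1%R, 2%R]) (h (vnorm z * t))%:E)%E.
    rewrite [RHS]integral_mkcond; apply: eq_integral => t _; rewrite patchE.
    rewrite (_ : (t \in _) = (1 <= t <= 2)); last by rewrite mem_setE in_itv.
    rewrite /G /chi -/z z16 z1 mul1r /h vscaleM mulrAC divff ?lt0r_neq0// mul1r.
    by case: ifP.
  move/le_trans; apply; rewrite -ge0_integralZl_EFin//; last first.
  - by rewrite invr_ge0 ltW.
  - by apply/measurable_EFinP; apply: measurable_funTS; exact: continuous_measurable_fun.
  - by move=> r _; rewrite lee_fin.
  rewrite [leLHS]integral_mkcond; apply: ge0_le_integralT => r; rewrite patchE.
    by case: ifP => // _; rewrite -EFinM lee_fin mulr_ge0// invr_ge0 ltW.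
  rewrite (_ : (r \in _) = (0 < r < 1)); last by rewrite mem_setE in_itv.
  rewrite /H -/z (_ : wt 0 z = 1); last by rewrite /wt z1 powRr0.
  case: ifP => // _; rewrite mul1r -EFinM lee_fin ler_wpM2r//.
  by rewrite -[leRHS]invrK lef_pV2 ?posrE ?invr_gt0//; lra.
have step4 r : (iint (2 * N) (H r) <= (if (0 < r < 1)%R then 16 * I * B else 0)%:E)%E.
  rewrite /H; case: ifP => r01; last by rewrite iint_cst0.
  under [X in iint _ X]eq_fun do rewrite EFinM.
  rewrite iintZ//; last 2 first.
  - move=> d' T g mg; apply/measurable_EFinP; apply: measurable_funM; first exact: measurable_wt.
    exact: mPsi2.
  - by move=> x; rewrite lee_fin mulr_ge0 ?wt_ge0.
  rewrite -mulrA [leRHS]EFinM; apply: lee_wpmul2l => //.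
  apply: le_trans (bint_le N1 (ltrN10 R) (hB r r01)).
  apply: le_iint => x; first by rewrite lee_fin mulr_ge0 ?wt_ge0.
  by rewrite -EFinM lee_fin ler_wpM2l ?wt_ge0//; exact: cutoff_ramp_le.
rewrite -lee_fin; apply: le_trans step2 _; rewrite iint_tonelli//.
apply: (@le_trans _ _ (\int[mu]_t iint (2 * N) (H t))%E).
  rewrite iint_tonelli//; apply: le_iint => // x; exact: integral_ge0.
apply: (@le_trans _ _ (\int[mu]_(r in `]0%R, 1%R[) (16 * I * B)%:E)%E).
  rewrite [leRHS]integral_mkcond; apply: ge0_le_integralT => r; first exact: iint_ge0.
  apply: le_trans (step4 r) _; rewrite patchE (_ : (r \in _) = (0 < r < 1)); last by rewrite mem_setE in_itv.
  by case: ifP.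
by rewrite integral_cst//= lebesgue_measure_itv/= lte_fin ltr01 oppr0 adde0 mule1.
Qed.

(** Near the origin, [boundary_sup] in the first coordinate transfers the bound from the boundary of
    a square of half-side [2^-1]. As [vnorm p < 1 / 4], its points have norm at least [1 / 4], and
    at most [1 / 4 + 71 / 100 = 24 / 25], where [71 / 100] exceeds half the diagonal. The extra
    factor 16 comes from there. *)
Lemma sint_eval (rho : R) : rho < 1 -> exists2 C, 0 <= C &
  forall (f : cv -> R[i]) A B, holo f -> 0 <= A ->
    (forall r, 0 < r < 1 -> (sint (fun z : cv => (ramp A (cmod (f (vscale r z))))%:E) <= B%:E)%E) ->
    forall p, vnorm p <= rho -> cmod (f p) <= 16 ^+ N.+1 * A + C * B.
Proof.
move=> r1; pose rho' := Num.max rho (24 / 25).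
have r'1 : rho' < 1 by rewrite /rho' gt_max r1/=; lra.
have [C C0 hC] := sint_eval_away r'1; exists (16 * C); first by rewrite mulr_ge0.
move=> f A B hf A0 hB p pr.
have B0 : 0 <= B.
  have h : 0 < (2^-1 : R) < 1 by rewrite invr_gt0 invf_lt1// ltr0n ltr1n.
  by rewrite -lee_fin; apply: le_trans (hB _ h); apply: sint_ge0 => z; rewrite lee_fin ramp_ge0.
pose M := 16 ^+ N * A + C * B.
have M0 : 0 <= M by rewrite addr_ge0// mulr_ge0// exprn_ge0.
rewrite (_ : _ + _ = 16 * M); last by rewrite /M exprS; ring.
have away q : 1 / 4 <= vnorm q <= rho' -> cmod (f q) <= M by exact: hC.
have [p4|p4] := leP (1 / 4) (vnorm p).
  apply: le_trans (away p _) _; first by rewrite p4/= /rho' le_max pr.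
  by rewrite ler_peMl// ler1n.
pose i0 := Ordinal N1; pose F l := f (setz p i0 l).
have -> : f p = F (p i0).
  by congr f; apply/funext => i; rewrite /setz; case: eqP => [->|].
have near l : vnorm (setz p i0 l) <= vnorm p + cmod (l - p i0).
  apply: le_trans (vnorm_le_vsub _ p) _; rewrite lerD2l; apply: le_trans (vnorm_le_sum _) _.
  rewrite (bigD1 i0)//= big1 ?addr0; first by rewrite /vsub /setz eqxx.
  by move=> i ii; rewrite /vsub /setz (negbTE ii) subrr cmod0.
have sqr (x : R) : 0 <= 2^-1 - x -> 0 <= 2^-1 + x -> x ^+ 2 <= 1 / 4.
  by move=> a b; have := mulr_ge0 a b; rewrite expr2; clear; lra.
have rect l : in_rect (complex.Re (p i0) - 2^-1) (complex.Re (p i0) + 2^-1)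
    (complex.Im (p i0) - 2^-1) (complex.Im (p i0) + 2^-1) l -> vnorm (setz p i0 l) <= 24 / 25.
  move=> h; have h1 : cmod (l - p i0) ^+ 2 <= 1 / 2.
    rewrite cmod_sqr ReD ImD ReN ImN.
    have a1 : (complex.Re l - complex.Re (p i0)) ^+ 2 <= 1 / 4.
      by case: h => /andP[a b] _; apply: sqr; clear -a b; lra.
    have a2 : (complex.Im l - complex.Im (p i0)) ^+ 2 <= 1 / 4.
      by case: h => _ /andP[a b]; apply: sqr; clear -a b; lra.
    lra.
  have h2 : cmod (l - p i0) <= 71 / 100.
    have p71 : 0 <= (71 / 100 : R) by lra.
    by rewrite -(@ler_pXn2r _ 2)// ?nnegrE ?cmod_ge0//; apply: le_trans h1 _; rewrite expr2; lra.
  by apply: le_trans (near l) _; lra.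
have S0 : 0 < 2^-1 :> R by rewrite invr_gt0.
apply: (boundary_sup S0) => l.
  move=> /rect l1.
  have E m : vscale 1 (setz (setz p i0 l) i0 m) = setz p i0 m.
    by rewrite vscale1; apply/funext => i; rewrite /setz; case: eqP.
  have -> : F = (fun m => f (vscale 1 (setz (setz p i0 l) i0 m))).
    by apply/funext => m; rewrite E.
  rewrite [l in cdiff _ l](_ : l = setz p i0 l i0); last by rewrite /setz eqxx.
  by apply: holo_setz => //; rewrite vscale1; apply: le_lt_trans l1 _; lra.
move=> [lr lb]; apply: away; apply/andP; split; last first.
  by apply: le_trans (rect _ lr) _; rewrite /rho' le_max lexx orbT.
have h1 : 2^-1 <= cmod (l - p i0).
  have half : `|2^-1| = 2^-1 :> R by rewrite ger0_norm// invr_ge0.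
  case: lb => e; [apply: le_trans (Re_le_cmod _)|apply: le_trans (Re_le_cmod _)|
    apply: le_trans (Im_le_cmod _)|apply: le_trans (Im_le_cmod _)];
    by rewrite ?ReD ?ImD ?ReN ?ImN e addrAC subrr add0r ?normrN half.
have h2 : cmod (p i0) <= vnorm p by exact: cmod_le_vnorm.
have h3 : cmod l <= vnorm (setz p i0 l).
  by have := cmod_le_vnorm (setz p i0 l) i0; rewrite {1}/setz eqxx.
have h4 := cmodD l (- p i0); rewrite cmodN in h4; lra.
Qed.
End HardyEvaluation.

(** * Powers of peak functions with small means *)

Section TestFunctions.
Context {R : realType} {N : nat}.
Local Notation cv := (cvec R N).
Hypothesis N1 : (1 <= N)%N.

Lemma measurable_peak (e : cv) d (T : measurableType d) (g : T -> nat -> R) : vnorm e = 1 ->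
  coord_measurable g -> measurable_fun setT (fun t => cmod (peak e (vec_of (g t)))).
Proof.
move=> e1 mg; apply: (@measurable_cont_vec R N (fun z => cmod (peak e z))) => // z.
exact: peak_cont.
Qed.

Lemma bint_peak_small (al : R) (e : cv) (v : R) (k : nat) : -1 < al -> vnorm e = 1 -> 0 <= v ->
  exists2 m, (k <= m)%N & (bint al (fun z : cv => (v * cmod (peak e z) ^+ m)%:E) <= 1)%E.
Proof.
(* Powers of [peak] are unbounded on the whole space; off the ball, where the weight vanishes, [q]
   is set to 0. *)
move=> al1 e1 v0; pose q (z : cv) := if vnorm z < 1 then cmod (peak e z) else 0.
have q1 z : q z < 1.
  by rewrite /q; case: ifP => // z1; apply: le_lt_trans (peak_le e1 z) _; lra.
have q0 z : 0 <= q z by rewrite /q; case: ifP => // _; exact: cmod_ge0.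
have [z|d T g mg||m km hm] := @bint_pow_small R N N1 al al1 q _ _ _ v k v0.
- by rewrite q0 ltW.
- apply: measurable_fun_ifT => //; last exact: measurable_peak.
  by apply: measurable_fun_ltr => //; exact: measurable_vnorm.
- rewrite -(iint_cst0 (2 * N)); congr (iint _ _); apply/funext => x.
  by rewrite leNgt q1.
exists m => //; apply: le_trans hm; apply: le_bint => // z z1; last by rewrite /q z1.
by rewrite lee_fin mulr_ge0 ?exprn_ge0 ?cmod_ge0.
Qed.

Lemma vnorm_sphere_le (z : cv) : vnorm (vscale (vnorm z)^-1 z) <= 1.
Proof.
rewrite vnorm_vscale ger0_norm ?invr_ge0 ?vnorm_ge0//.
by have [->|z0] := eqVneq (vnorm z) 0; rewrite ?mulr0// mulVf.
Qed.

(** [peak e (r z)] is a convex combination of [2^-1] and [peak e z]. The resulting bound is the same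
    for all [r], so one exponent serves all radii. *)
Lemma peak_ray (e z : cv) (r : R) : 0 < r < 1 ->
  cmod (peak e (vscale r z)) <= Num.max 2^-1 (cmod (peak e z)).
Proof.
move=> /andP[r0 r1].
have -> : peak e (vscale r z) = Complex ((1 - r) * 2^-1) 0 + Complex r 0 * peak e z.
  by rewrite /peak vdotZ; case: (vdot e z) => a b; simpc; congr Complex; ring.
apply: le_trans (cmodD _ _) _; rewrite cmodM !cmodr (ger0_norm (ltW r0)).
rewrite ger0_norm; last by rewrite mulr_ge0 ?invr_ge0// subr_ge0 ltW.
set M := Num.max _ _.
have h1 : 2^-1 <= M by rewrite le_max lexx.
have h2 : cmod (peak e z) <= M by rewrite le_max lexx orbT.
have h3 : (1 - r) * 2^-1 <= (1 - r) * M by rewrite ler_wpM2l// subr_ge0 ltW.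
have h4 : r * cmod (peak e z) <= r * M by rewrite ler_wpM2l// ltW.
by apply: le_trans (lerD h3 h4) _; rewrite -mulrDl subrK mul1r.
Qed.

(** After radial projection [q] does reach 1, but only on the ray through [e], which is null. *)
Lemma sint_peak_small (e : cv) (v : R) (k : nat) : vnorm e = 1 -> 0 <= v ->
  exists2 m, (k <= m)%N & forall r, 0 < r < 1 ->
    (sint (fun z : cv => (v * cmod (peak e (vscale r z)) ^+ m)%:E) <= 1)%E.
Proof.
move=> e1 v0; pose q (z : cv) := Num.max 2^-1 (cmod (peak e (vscale (vnorm z)^-1 z))).
have q0 z : 0 <= q z by rewrite /q le_max invr_ge0 ler0n.
have q1 z : q z <= 1.
  rewrite /q ge_max invf_le1// ler1n/=; apply: le_trans (peak_le e1 _) _.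
  have := vnorm_sphere_le z; lra.
have null : leb_int (fun z : cv => (if 1 <= q z then wt 0 z else 0)%:E) = 0%E.
  have line (x : nat -> R) : 1 <= q (vec_of x) -> exists s,
      x 0%N = s * complex.Re (e (Ordinal N1)) /\ x 1%N = s * complex.Im (e (Ordinal N1)).
    rewrite /q le_max => /orP[h|h]; first by move: h; rewrite leNgt invf_lt1// ltr1n.
    have ze := peak_max e1 (vnorm_sphere_le _) h; move: ze; set z : cv := vec_of x => ze.
    have z0 : vnorm z != 0.
      apply/negP => /eqP z0; move: e1; rewrite -ze vnorm_vscale z0 mulr0 => /eqP.
      by rewrite eq_sym oner_eq0.
    have zE : vscale (vnorm z) e = z by rewrite -ze vscaleM divff// vscale1.
    exists (vnorm z); have := congr1 (fun u : cv => u (Ordinal N1)) zE.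
    by rewrite /z /vscale /vec_of; case: (e _) => a b; simpc => -[-> ->].

  rewrite /leb_int (_ : (2 * N)%N = (2 * N.-1).+2); last lia.
  apply: iint_line_null.
  (* The ray projects to multiples of [e (Ordinal N1)]; its slope is expressed as real part over
     imaginary part, unless the latter is 0. *)
  have [b0|b0] := eqVneq (complex.Im (e (Ordinal N1))) 0; [right|left].
    move=> x x1; case: ifPn => // /line[s [_ x1E]]; move: x1.
    by rewrite x1E b0 mulr0 eqxx.
  exists (complex.Re (e (Ordinal N1)) / complex.Im (e (Ordinal N1))) => x x0.
  case: ifPn => // /line[s [x0E x1E]]; move: x0.
  by rewrite x0E x1E mulrCA -mulrA mulVf// mulr1 eqxx.
have [z|d T g mg|m km hm] := @bint_pow_small R N N1 0 (ltrN10 R) q _ _ null v k v0.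
- by rewrite q0 q1.
- apply: measurable_maxr => //; under eq_fun do rewrite vscale_vec_of.
  apply: measurable_peak => //; apply: measurable_scaled => //.
  by apply: measurable_inv; exact: measurable_vnorm.
exists m => // r r01; apply: le_trans hm; apply: le_bint => // z z1.
  by rewrite lee_fin mulr_ge0 ?exprn_ge0 ?cmod_ge0.
by rewrite lee_fin ler_wpM2l// lerXn2r ?nnegrE ?cmod_ge0 ?peak_ray.
Qed.
End TestFunctions.

(** * Fast growing Orlicz functions *)

Section OrliczFunctions.
Context {R : realType}.
Implicit Types (psi : R -> R) (x y : R).

Lemma orlicz_contract psi t x : orlicz psi -> 0 <= t <= 1 -> 0 <= x -> psi (t * x) <= t * psi x.
Proof.
move=> [p0 pp pc _ _] /andP[]; rewrite le_eqVlt => /orP[/eqP<- _ _|t0]; first by rewrite !mul0r p0.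
rewrite le_eqVlt => /orP[/eqP->|t1 x0]; first by rewrite !mul1r.
have [->|xn0] := eqVneq x 0; first by rewrite mulr0 p0 mulr0.
have t01 : 0 < t < 1 by rewrite t0.
have := pc x 0 t x0 (lexx 0) xn0 t01.
by rewrite p0 !mulr0 !addr0; exact: ltW.
Qed.

Lemma orlicz_mono psi x y : orlicz psi -> 0 <= x -> x <= y -> psi x <= psi y.
Proof.
move=> po x0 xy; have [y0|y0] := eqVneq y 0.
  by rewrite (_ : x = y)//; apply/eqP; rewrite eq_le xy y0 x0.
have yp : 0 < y by rewrite lt_neqAle eq_sym y0 (le_trans x0 xy).
have t01 : 0 <= x / y <= 1 by rewrite divr_ge0 ?(ltW yp)//= ler_pdivrMr// mul1r.
have := orlicz_contract po t01 (ltW yp); rewrite mulfVK// => /le_trans; apply.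
by rewrite ler_piMl ?(andP t01).2//; have [_ pp _ _ _] := po; rewrite pp// ltW.
Qed.

(** Superlinear growth with [M = 1]: beyond some level [psi x > x]. This feeds the truncated mean
    value inequality for an arbitrary Orlicz function. *)
Lemma orlicz_ge_ramp psi : orlicz psi -> exists2 a, 0 <= a & forall x, 0 <= x -> ramp a x <= psi x.
Proof.
move=> [_ pp _ _ pl]; have [A hA] := pl 1; exists (Num.max 0 A); first by rewrite le_max lexx.
move=> x x0; apply: ramp_le; first exact: pp.
have [xA|] := leP x (Num.max 0 A).
  by apply: le_trans (pp x x0); rewrite subr_le0.
rewrite gt_max => /andP[xp /hA]; rewrite ltr_pdivlMr// mul1r => h.
by apply: le_trans (ltW h); rewrite gerBl le_max lexx.
Qed.

Section Growth.
Variable F : nat -> R -> R.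
Hypothesis F0 : forall k v, 0 <= F k v.

(** [x ^+ 2] supplies strict convexity and superlinear growth. The term added at step [k + 1]
    vanishes on [[0, k + 1]], so the value at [k + 1] is final when [F k] turns it into a slope. *)
Fixpoint growth_step n : R -> R :=
  if n is k.+1 then fun x => growth_step k x + F k (growth_step k k.+1%:R) * ramp k.+1%:R x
  else fun x => x ^+ 2.

(** The limit of the steps: those beyond [Num.truncn x] no longer change the value at a nonnegative
    [x]. *)
Definition growth x := growth_step (Num.truncn x) x.

Lemma growth_step_le m n x : (m <= n)%N -> growth_step m x <= growth_step n x.
Proof.
elim: n => [|n IH]; first by rewrite leqn0 => /eqP->.
rewrite leq_eqVlt ltnS => /orP[/eqP->//|/IH h]; apply: le_trans h _ => /=.
by rewrite lerDl mulr_ge0 ?ramp_ge0.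
Qed.

Lemma growth_step_eq m n x : (m <= n)%N -> x <= m.+1%:R -> growth_step n x = growth_step m x.
Proof.
move=> mn xm; elim: n mn => [|n IH]; first by rewrite leqn0 => /eqP->.
rewrite leq_eqVlt ltnS => /orP[/eqP->//|mn] /=; rewrite IH//.
rewrite /ramp max_l ?mulr0 ?addr0// subr_le0; apply: le_trans xm _.
by rewrite ler_nat ltnS.
Qed.

Lemma growthE n x : 0 <= x -> x <= n.+1%:R -> growth x = growth_step n x.
Proof.
move=> x0 xn; rewrite /growth; have /andP[_ /ltW xt] := truncn_itv x0.
by have [nt|/ltnW tn] := leqP n (Num.truncn x); [|symmetry]; exact: growth_step_eq.
Qed.

Lemma growth_step_convex n x y t : 0 <= x -> 0 <= y -> x != y -> 0 < t < 1 ->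
  growth_step n (t * x + (1 - t) * y) < t * growth_step n x + (1 - t) * growth_step n y.
Proof.
move=> x0 y0 xy /andP[t0 t1]; have t1' : 0 < 1 - t by rewrite subr_gt0.
elim: n => [|n IH] /=.
  rewrite -subr_gt0 (_ : _ - _ = t * (1 - t) * (x - y) ^+ 2); last by ring.
  by apply: mulr_gt0; [exact: mulr_gt0|rewrite exprn_even_gt0//= subr_eq0].
set c := F n _; set A := n.+1%:R.
have c0 : 0 <= c by exact: F0.
have h : ramp A (t * x + (1 - t) * y) <= t * ramp A x + (1 - t) * ramp A y.
  apply: ramp_le; first by rewrite addr_ge0// mulr_ge0 ?ramp_ge0// ltW.
  have h1 := ler_wpM2l (ltW t0) (ramp_ge A x); have h2 := ler_wpM2l (ltW t1') (ramp_ge A y).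
  by apply: le_trans (lerD h1 h2); rewrite le_eqVlt; apply/orP; left; apply/eqP; ring.
rewrite [ltRHS](_ : _ = t * growth_step n x + (1 - t) * growth_step n y +
  c * (t * ramp A x + (1 - t) * ramp A y)); last by ring.
by apply: ltr_leD => //; rewrite ler_wpM2l.
Qed.

Lemma growth_ge_sqr x : x ^+ 2 <= growth x.
Proof. exact: (@growth_step_le 0). Qed.

Lemma orlicz_growth : orlicz growth.
Proof.
split.
- by rewrite (@growthE 0)//= expr0n.
- by move=> x _; apply: le_trans (growth_ge_sqr x); exact: sqr_ge0.
- move=> x y t x0 y0 xy t01; pose n := Num.truncn (x + y).
  have /andP[_ /ltW xn] : n%:R <= x + y < n.+1%:R by apply: truncn_itv; rewrite addr_ge0.
  have /andP[t0 t1] := t01; have t1' : 0 < 1 - t by rewrite subr_gt0.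
  have tx : t * x <= x by rewrite ler_piMl// ltW.
  have ty : (1 - t) * y <= y by rewrite ler_piMl// gerBl ltW.
  have tx0 : 0 <= t * x by rewrite mulr_ge0// ltW.
  have ty0 : 0 <= (1 - t) * y by rewrite mulr_ge0// ltW.
  have := @growth_step_convex n x y t x0 y0 xy t01.
  by rewrite !(@growthE n)//; lra.
- move=> e e0; exists (Num.min 1 e); first by rewrite lt_min ltr01.
  move=> x /andP[x0]; rewrite lt_min => /andP[x1 xe]; rewrite (@growthE 0)//=; last exact: ltW.
  by apply: le_lt_trans xe; rewrite expr2 ler_piMl// ltW.
- move=> M; exists (Num.max 0 M) => x; rewrite gt_max => /andP[x0 xM].
  by rewrite ltr_pdivlMr//; apply: lt_le_trans (growth_ge_sqr x); rewrite expr2 ltr_pM2r.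
Qed.

Lemma growth_fast k x : 0 <= x -> F k (growth k.+1%:R) * (x - k.+1%:R) <= growth x.
Proof.
move=> x0; have [xk|xk] := leP x k.+1%:R.
  apply: le_trans (le_trans (sqr_ge0 x) (growth_ge_sqr x)).
  by rewrite mulr_ge0_le0 ?subr_le0.
rewrite (@growthE k k.+1%:R)//.
have kt : (k < Num.truncn x)%N by rewrite truncn_ge_nat// ltW.
apply: le_trans (growth_step_le x kt); rewrite /= ler_wpDl//; last by rewrite ler_wpM2l// ramp_ge.
by apply: le_trans (sqr_ge0 x) _; exact: (@growth_step_le 0).
Qed.
End Growth.
End OrliczFunctions.

(** * Compactness of the composition operator *)

Section Images.
Context {R : realType} {N : nat}.
Local Notation cv := (cvec R N).
Variable phi : cv -> cv.
Hypothesis hphi : holo_self phi.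

Definition strict_image := (ereal_sup [set (vnorm (phi z))%:E | z in @ballN R N] < 1%:E)%E.

Lemma strict_image_bound : strict_image ->
  exists rho, [/\ 0 <= rho, rho < 1 & forall z, vnorm z < 1 -> vnorm (phi z) <= rho].
Proof.
move=> h; have ub z : vnorm z < 1 -> ((vnorm (phi z))%:E <= ereal_sup [set (vnorm (phi z))%:E | z in @ballN R N])%E.
  by move=> z1; apply: ereal_sup_ubound; exists z.
have b0 := ub vzero; rewrite vnorm_vzero ltr01 in b0.
move: h ub (b0 erefl); rewrite /strict_image; case: (ereal_sup _) => [r| |] //.
rewrite lte_fin => r1 ub b; exists r; split => //.
  by move: b; rewrite lee_fin; apply: le_trans; exact: vnorm_ge0.
Qed.

(** Compactness of the closed ball, through an ultrafilter limit of points [phi (z n)] whose norms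
    tend to 1. *)
Lemma escape : ~ strict_image -> exists2 e : cv, vnorm e = 1 &
  forall eps, 0 < eps -> exists2 z, vnorm z < 1 & vnorm (vsub (phi z) e) < eps.
Proof.
move=> h; have hz (n : nat) : exists z, vnorm z < 1 /\ 1 - n.+1%:R^-1 < vnorm (phi z).
  apply: contrapT => hn; apply: h; rewrite /strict_image.
  apply: (@le_lt_trans _ _ (1 - n.+1%:R^-1)%:E); last by rewrite lte_fin gtrBl invr_gt0.
  apply: ge_ereal_sup => _ [z z1 <-]; rewrite lee_fin leNgt; apply/negP => lt.
  by apply: hn; exists z.
have [z hz'] := choice hz.
have [U [UU Uoo]] := ultraFilterLemma (eventually_filter).
have b1 n : vnorm (phi (z n)) <= 1 by have [zn _] := hz' n; exact/ltW/hphi.2.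
have [e he] := ultra_lim_vec UU b1.
have hn eps : 0 < eps -> exists n, vnorm (vsub (phi (z n)) e) < eps /\ 1 - eps <= vnorm (phi (z n)).
  move=> eps0; have [n hn nm] := ultra_ex UU Uoo (Num.truncn eps^-1) (he _ eps0).
  exists n; split => //; apply: le_trans (ltW (hz' n).2); rewrite lerD2l lerN2.
  rewrite -[leRHS]invrK lef_pV2 ?posrE ?invr_gt0//.
  have /andP[_ /ltW h1] : (Num.truncn eps^-1)%:R <= eps^-1 < (Num.truncn eps^-1).+1%:R.
    by apply: truncn_itv; rewrite invr_ge0 ltW.
  by apply: le_trans h1 _; rewrite ler_nat.
exists e; last by move=> eps /hn[n [h1 _]]; exists (z n) => //; case: (hz' n).
apply/eqP; rewrite eq_le; apply/andP; split; apply/ler_addgt0Pr => eps eps0.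
  have [n [h1 _]] := hn _ eps0; have := vnorm_le_vsub e (phi (z n)); rewrite vnorm_vsubC.
  by have := b1 n; lra.
have eps2 : 0 < eps / 2 by rewrite divr_gt0.
have [n [h1 h2]] := hn _ eps2; have := vnorm_le_vsub (phi (z n)) e; lra.
Qed.
End Images.

Section Families.
Context {R : realType} {N : nat}.
Local Notation cv := (cvec R N).
Local Notation functional := ((cv -> \bar R) -> \bar R).

Definition means_le (fam : functional -> Prop) (psi : R -> R) (c B : R) (f : cv -> R[i]) :=
  forall j, fam j -> (j (fun z => (psi (cmod (f z) / c))%:E) <= B%:E)%E.

(** In [means_eval], [K] is quantified before [rho]: in the converse the points run to the sphere
    and only [C] may follow them. Likewise [means_test] asks for one exponent valid for all means at
    once. *)
Record means_family (fam : functional -> Prop) : Prop := MeansFamily {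
  means_mono : forall j (G H : cv -> \bar R), fam j ->
    (forall z, vnorm z < 1 -> (0 <= G z)%E) -> (forall z, vnorm z < 1 -> (G z <= H z)%E) -> (j G <= j H)%E;
  means_one : forall j, fam j -> j (fun=> 1%E) = 1%E;
  means_eval : exists2 K, 0 <= K & forall rho, rho < 1 -> exists2 C, 0 <= C &
    forall (f : cv -> R[i]) A B, holo f -> 0 <= A ->
      (forall j, fam j -> (j (fun z => (ramp A (cmod (f z)))%:E) <= B%:E)%E) ->
      forall p, vnorm p <= rho -> cmod (f p) <= K * A + C * B;
  means_test : forall (e : cv) v (k : nat), vnorm e = 1 -> 0 <= v ->
    exists2 m, (k <= m)%N & forall j, fam j -> (j (fun z => (v * cmod (peak e z) ^+ m)%:E) <= 1)%E }.

(** The strict [M < c] in [norm_means] avoids asking whether the infimum in the Luxemburg norm is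
    attained. *)
Record space_of_means fam (psi : R -> R) (S : (cv -> R[i]) -> Prop)
    (nrm : (cv -> R[i]) -> \bar R) : Prop := SpaceOfMeans {
  space_holo : forall f, S f -> holo f;
  space_means : forall f, S f -> exists c B, 0 < c /\ means_le fam psi c B f;
  means_space : forall f c, 0 < c -> holo f -> means_le fam psi c 1 f -> S f;
  means_norm : forall f c, 0 < c -> means_le fam psi c 1 f -> (nrm f <= c%:E)%E;
  norm_means : forall f M c, 0 < c -> M < c -> (nrm f <= M%:E)%E -> means_le fam psi c 1 f }.

Variable fam : functional -> Prop.
Hypothesis famP : means_family fam.

Section OneSpace.
Variables (psi : R -> R) (S : (cv -> R[i]) -> Prop) (nrm : (cv -> R[i]) -> \bar R).
Hypotheses (po : orlicz psi) (SP : space_of_means fam psi S nrm).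

Let psi0 x : 0 <= x -> 0 <= psi x. Proof. by case: po => _ h _ _ _; exact: h. Qed.
Let dv0 (f : cv -> R[i]) c z : 0 < c -> 0 <= cmod (f z) / c.
Proof. by move=> c0; rewrite divr_ge0 ?cmod_ge0 ?ltW. Qed.

Lemma means_le_eval : exists2 K, 0 <= K & forall rho, rho < 1 -> exists2 C, 0 <= C &
  forall f c B, holo f -> 0 < c -> means_le fam psi c B f ->
    forall p, vnorm p <= rho -> cmod (f p) <= c * (K + C * B).
Proof.
have [a a0 ha] := orlicz_ge_ramp po; have [K K0 hK] := means_eval famP.
exists (K * a) => [|rho r1]; first exact: mulr_ge0.
have [C C0 hC] := hK rho r1; exists C => // f c B hf c0 hB p pr.
have hg : holo (fun z => Complex c^-1 0 * f z) by apply: holoM => //; exact: holo_cst.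
have E z : cmod (Complex c^-1 0 * f z) = cmod (f z) / c.
  by rewrite cmodM cmodr gtr0_norm ?invr_gt0// mulrC.
have := hC _ a B hg a0 _ p pr; rewrite E ler_pdivrMr// mulrC; apply => j fj.
apply: le_trans (hB j fj); apply: (means_mono famP) => // z z1.
  by rewrite lee_fin ramp_ge0.
by rewrite lee_fin E ha// dv0.
Qed.

Lemma means_le_bounded f c m : 0 < c -> (forall z, vnorm z < 1 -> cmod (f z) <= m) ->
  psi (m / c) <= 1 -> means_le fam psi c 1 f.
Proof.
move=> c0 fm pm j fj; rewrite -[leRHS](means_one famP fj).
apply: (means_mono famP) => // z z1; rewrite lee_fin; first exact/psi0/dv0.
by apply: le_trans pm; apply: orlicz_mono => //; [exact: dv0|rewrite ler_pM2r ?invr_gt0 ?fm].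
Qed.

Lemma bounded_space f m : holo f -> (forall z, vnorm z < 1 -> cmod (f z) <= m) -> S f.
Proof.
move=> hf fm; have [_ _ _ ps _] := po; have [d d0 hd] := ps 1 ltr01.
have m0 : 0 <= m by apply: le_trans (fm vzero _); rewrite ?cmod_ge0 ?vnorm_vzero.
have c0 : 0 < 2 * (m + 1) / d by rewrite !mulr_gt0 ?invr_gt0//; lra.
apply: (means_space SP c0 hf); apply: (means_le_bounded c0 fm); apply/ltW/hd.
rewrite divr_ge0 ?(ltW c0)//= ltr_pdivrMr// mulrC mulfVK ?lt0r_neq0//; lra.
Qed.

Lemma compact_of_strict phi : holo_self phi -> strict_image phi -> compact_op S nrm (Cop phi).
Proof.
move=> hphi /strict_image_bound[rho [r0 r1 pr]].
have [K K0 hK] := means_le_eval; split.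
  move=> f Sf; have hf := space_holo SP Sf; have [c [B [c0 hB]]] := space_means SP Sf.
  have [C C0 hC] := hK rho r1.
  apply: (@bounded_space _ (c * (K + C * B))); first exact: holo_comp.
  by move=> z /pr zr; exact: (hC f c B hf c0 hB _ zr).
move=> u M uM; pose c := Num.max 0 M + 1.
have c0 : 0 < c by rewrite /c ltr_wpDl// le_max lexx.
have cM : M < c by rewrite /c ltr_pwDr// le_max lexx orbT.
have hu n : holo (u n) by apply: (space_holo SP); case: (uM n).
have lu n : means_le fam psi c 1 (u n) by apply: (norm_means SP c0 cM); case: (uM n).
have [] := montel hu _ r1.
  by move=> r r'1; have [C C0 hC] := hK r r'1; exists (c * (K + C * 1)) => n z zr; apply: hC.
move=> s [g [s1 hg lim]]; exists s, (fun z => g (phi z)); split => //.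
  have [C C0 hC] := hK rho r1; have [n0 hn0] := lim 1 ltr01.
  apply: (@bounded_space _ (c * (K + C * 1) + 1)); first exact: holo_comp.
  move=> z /pr zr; have h1 := hn0 n0 (leqnn _) _ zr; have h2 := hC _ _ _ (hu (s n0)) c0 (lu _) _ zr.
  have h3 := cmodD (u (s n0) (phi z)) (- (u (s n0) (phi z) - g (phi z))).
  by move: h3; rewrite cmodN opprB addrC subrK; lra.
move=> eps e0; have [_ _ _ ps _] := po; have [d d0 hd] := ps 1 ltr01.
(* As [psi < 1] on [[0, d[], a function bounded by [eps * (d / 2)] has norm at most [eps]. *)
have d2 : 0 < eps * (d / 2) by rewrite mulr_gt0// divr_gt0.
have [n0 hn0] := lim _ d2; exists n0 => n nn0; apply: (means_norm SP e0).
apply: (@means_le_bounded _ _ (eps * (d / 2))) => //.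
  by move=> z /pr zr; apply: hn0.
apply/ltW/hd; rewrite mulrAC divff ?lt0r_neq0// mul1r; lra.
Qed.
End OneSpace.

Lemma bernoulli_ineq (h : R) n : -1 <= h -> 1 + n%:R * h <= (1 + h) ^+ n.
Proof.
move=> h1; elim: n => [|n IH]; first by rewrite mul0r addr0 expr0.
have h0 : 0 <= 1 + h by lra.
rewrite exprS; apply: le_trans (ler_wpM2l h0 IH).
have := mulr_ge0 (ler0n R n) (sqr_ge0 h); rewrite -natr1 expr2; lra.
Qed.

(** Bernoulli gives [1 + m (1 - q) <= (2 - q)^m], and [q (2 - q) <= 1]; an exponent of order
    [(k + 1)^2] therefore beats the factor [k + 1]. *)
Lemma nat_mul_expr_le (q : R) k m : 0 <= q -> q < 1 -> (k.+1 * k.+1 <= m)%N ->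
  k.+1%:R * q ^+ m <= (k.+1%:R * (1 - q))^-1.
Proof.
move=> q0 q1 km; have h0 : 0 < 1 - q by rewrite subr_gt0.
have k0 : 0 < k.+1%:R :> R by [].
rewrite -[leRHS]mul1r ler_pdivlMr ?mulr_gt0//.
have b := @bernoulli_ineq (1 - q) m ltac:(lra).
have h1 : q ^+ m * (1 + m%:R * (1 - q)) <= 1.
  apply: le_trans (ler_wpM2l (exprn_ge0 m q0) b) _; rewrite -exprMn exprn_ile1//.
    by rewrite mulr_ge0//; lra.
  have := sqr_ge0 (1 - q); rewrite expr2; lra.
have h2 : k.+1%:R * k.+1%:R <= m%:R :> R by rewrite -natrM ler_nat.
have h3 := ler_wpM2r (ltW h0) h2.
have h4 := ler_wpM2l (exprn_ge0 m q0) h3.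
apply: le_trans h1; rewrite mulrDr mulr1; have := exprn_ge0 m q0; lra.
Qed.

Lemma nat_mul_expr_small (q a : R) : 0 <= q -> q < 1 -> 0 < a -> exists n0, forall k m,
  (n0 <= k)%N -> (k.+1 * k.+1 <= m)%N -> k.+1%:R * q ^+ m <= a.
Proof.
move=> q0 q1 a0; have h0 : 0 < 1 - q by rewrite subr_gt0.
exists (Num.truncn (a^-1 / (1 - q))) => k m kn km.
apply: le_trans (nat_mul_expr_le q0 q1 km) _.
rewrite -[leRHS]invrK lef_pV2 ?posrE ?invr_gt0 ?mulr_gt0// -ler_pdivrMr//.
have /andP[_ /ltW h3] : (Num.truncn (a^-1 / (1 - q)))%:R <= a^-1 / (1 - q)
    < (Num.truncn (a^-1 / (1 - q))).+1%:R.
  by apply: truncn_itv; rewrite !divr_ge0 ?invr_ge0 ?ltW.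
by apply: le_trans h3 _; rewrite ler_nat ltnS.
Qed.

(** At distance [i = 1 / (m + 1)] from [e], the peak function is at least [1 - i / 2], and Bernoulli
    bounds its power below by [1 - m i / 2]. *)
Lemma escape_peak (phi : cv -> cv) e m : holo_self phi -> vnorm e = 1 ->
  (forall eps, 0 < eps -> exists2 z, vnorm z < 1 & vnorm (vsub (phi z) e) < eps) ->
  exists z, vnorm z < 1 /\ 1 / 2 <= cmod (peak e (phi z)) ^+ m.
Proof.
move=> hphi e1 esc; have n0 : 0 < m.+1%:R^-1 :> R by rewrite invr_gt0.
have [z z1 hz] := esc _ n0; exists z; split => //.
have pz := peak_near e1 (ltW (hphi.2 _ z1)).
have n1 : m.+1%:R^-1 <= 1 :> R by rewrite invf_le1// ler1n.
have nm : m%:R * m.+1%:R^-1 <= 1 :> R by rewrite ler_pdivrMr// mul1r ler_nat.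
move: (m.+1%:R^-1) n0 hz n1 nm => i n0 hz n1 nm.
have x1 : -1 <= - (i / 2) by lra.
apply: le_trans (le_trans (bernoulli_ineq m x1) _); first by lra.
by apply: lerXn2r; rewrite ?nnegrE ?cmod_ge0//; lra.
Qed.

Section Converse.
Variables (space : (R -> R) -> (cv -> R[i]) -> Prop) (norm : (R -> R) -> (cv -> R[i]) -> \bar R).
Variable phi : cv -> cv.
Hypothesis hphi : holo_self phi.
Hypothesis SP : forall psi, orlicz psi -> space_of_means fam psi (space psi) (norm psi).

(* The Orlicz function is chosen to grow so fast between the levels [k + 1] and
   [(k + 1) / eps] that evaluation at the point [z k] separates [C_phi u_k] from 0. *)
Lemma strict_of_compact :
  (forall psi, orlicz psi -> compact_op (space psi) (norm psi) (Cop phi)) -> strict_image phi.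
Proof.
move=> hc; apply: contrapT => /(escape hphi)[e e1 esc].
have [K K0 hK] := means_eval famP.
(* [v] stands for the value at [k + 1] of the Orlicz function yet to be built; a negative [v] gets a
   dummy exponent. *)
have /choice[m hm] : forall kv : nat * R, exists m, (kv.1.+1 * kv.1.+1 <= m)%N /\
    (0 <= kv.2 -> forall j, fam j -> (j (fun z => (kv.2 * cmod (peak e z) ^+ m)%:E) <= 1)%E).
  move=> [k v]; have [v0|v0] := leP 0 v.
    by have [m km hm] := means_test famP (k.+1 * k.+1) e1 v0; exists m.
  by exists (k.+1 * k.+1)%N; split => //=; rewrite leNgt v0.
have /choice[z hz] : forall kv : nat * R, exists z,
    vnorm z < 1 /\ 1 / 2 <= cmod (peak e (phi z)) ^+ m kv.
  by move=> kv; exact: escape_peak.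
have /choice[C hC] : forall kv : nat * R, exists C, 0 <= C /\
    forall (f : cv -> R[i]) A B, holo f -> 0 <= A ->
      (forall j, fam j -> (j (fun z => (ramp A (cmod (f z)))%:E) <= B%:E)%E) ->
      cmod (f (z kv)) <= K * A + C * B.
  move=> kv; have [C C0 hC] := hK _ (hz kv).1; exists C; split => // f A B hf A0 hB.
  exact: hC.
(* The [+ 1] makes the slope exceed [C], so that [C] divided by the slope is below 1. *)
pose F k v := C (k, v) + 1.
have F1 k v : 1 <= F k v by rewrite /F lerDr; case: (hC (k, v)).
have F0 k v : 0 <= F k v by apply: le_trans (F1 k v).
pose psi := growth F; have po : orlicz psi by exact: orlicz_growth.
have SPo := SP po; have pp x : 0 <= x -> 0 <= psi x by case: po => _ h _ _ _; exact: h.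
pose kv k : nat * R := (k, psi k.+1%:R).
pose u k : cv -> R[i] := fun w => Complex k.+1%:R 0 * peak e w ^+ m (kv k).
have cu k w : cmod (u k w) = k.+1%:R * cmod (peak e w) ^+ m (kv k).
  by rewrite cmodM cmodr cmodX ger0_norm.
have hu k : holo (u k) by apply: holoM; [exact: holo_cst|apply: holoX; exact: holo_peak].
have lu k : means_le fam psi 1 1 (u k).
  move=> j fj; have v0 : 0 <= (kv k).2 by exact: pp.
  apply: le_trans ((hm (kv k)).2 v0 j fj); apply: (means_mono famP) => // w w1.
    by rewrite lee_fin pp// divr1 cmod_ge0.
  (* Convexity and [psi 0 = 0] bring the power out of [psi], leaving the multiple [psi (k + 1)] for
     which the exponent was chosen. *)
  rewrite lee_fin divr1 cu mulrC [leRHS]mulrC; apply: orlicz_contract => //.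
  rewrite exprn_ge0 ?cmod_ge0//= exprn_ile1 ?cmod_ge0//.
  apply: le_trans (peak_le e1 w) _; lra.
have [cS cc] := hc psi po.
have uM k : space psi (u k) /\ (norm psi (u k) <= 1%:E)%E.
  by split; [exact: (means_space SPo ltr01)|exact: (means_norm SPo ltr01)].
have [s [g [s1 Sg lim]]] := cc u 1 uM.
have sn n : (n <= s n)%N by elim: n => [|n IH] //; exact: leq_ltn_trans (s1 n).
pose D n := fun w => Cop phi (u (s n)) w - g w.
have hD n : holo (D n).
  have -> : D n = fun w => Cop phi (u (s n)) w + (Complex (-1) 0 * g w).
    by apply/funext => w; rewrite /D; case: (g w) => a b; simpc; case: (Cop _ _ _) => a' b'; simpc; congr Complex; ring.
  apply: holoD; first exact: holo_comp.
  by apply: holoM; [exact: holo_cst|exact: (space_holo SPo)].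
have lD eps : 0 < eps -> exists n0, forall n, (n0 <= n)%N -> means_le fam psi (2 * eps) 1 (D n).
  move=> eps0; have [n0 hn0] := lim _ eps0; exists n0 => n nn.
  apply: (norm_means SPo _ _ (hn0 n nn)); lra.
have g0 w : vnorm w < 1 -> g w = 0.
  (* [D n] tends to 0 at [w] because evaluation is controlled by the norm, and [u (s n) (phi w)]
     does because the exponent at level [k] is at least [(k + 1)^2]. *)
  move=> w1; apply: contrapT => gw0; pose a := cmod (g w).
  have a0 : 0 < a by rewrite lt_neqAle cmod_ge0 andbT eq_sym; apply/negP => /eqP /cmod_eq0.
  have [K' K'0 hK'] := means_le_eval po; have [C' C'0 hC'] := hK' _ w1.
  pose Q := K' + C' * 1; have Q0 : 0 <= Q by rewrite addr_ge0// mulr1.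
  pose q := cmod (peak e (phi w)).
  have q1 : q < 1 by apply: le_lt_trans (peak_le e1 _) _; have := hphi.2 _ w1; lra.
  have [n1 hn1] := nat_mul_expr_small (cmod_ge0 _) q1 (divr_gt0 a0 (ltr0n _ 4)).
  have ep0 : 0 < a / (4 * (Q + 1)) by rewrite divr_gt0//; lra.
  have [n0 hn0] := lD _ ep0; pose n := maxn n0 n1.
  have h1 := hC' _ _ _ (hD n) (_ : 0 < 2 * (a / (4 * (Q + 1)))) (hn0 n (leq_maxl _ _)) w (lexx _).
  have {}h1 : cmod (D n w) <= a / 2.
    apply: le_trans (h1 _) _; first lra.
    rewrite -/Q (_ : _ * Q = a / 2 * (Q / (Q + 1))); last by field; lra.
    by rewrite ler_piMr ?divr_ge0 ?(ltW a0)// ler_pdivrMr; lra.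
  have h2 : cmod (u (s n) (phi w)) <= a / 4.
    rewrite cu; apply: hn1 (hm (kv (s n))).1; apply: leq_trans (sn n); exact: leq_maxr.
  have := cmodD (u (s n) (phi w)) (- D n w); rewrite cmodN (_ : _ - D n w = g w); last first.
    by rewrite /D /Cop subKr.
  rewrite -/a; lra.
(* At the point attached to level [k] the image is at least [(k + 1) / 2], which is
   [2 (K + 1) (k + 1)] after division by [2 * eps]; the evaluation bound allows less than
   [K (k + 1) + 1]. *)
pose eps := (8 * (K + 1))^-1.
have eps0 : 0 < eps by rewrite invr_gt0; lra.
have [n /(_ n (leqnn _)) hn] := lD _ eps0.
pose k := s n; pose f := F k (psi k.+1%:R); pose b := f / (2 * eps).
have f1 : 1 <= f by exact: F1.
have b0 : 0 <= b by rewrite divr_ge0//; lra.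
have [z1 hz1] := hz (kv k); have hC0 := (hC (kv k)).1.
have A0 : 0 <= f * k.+1%:R by rewrite mulr_ge0//; lra.
have hbD : holo (fun w => Complex b 0 * D n w) by apply: holoM; [exact: holo_cst|exact: hD].
have cbD w : cmod (Complex b 0 * D n w) = f * (cmod (D n w) / (2 * eps)).
  by rewrite cmodM cmodr ger0_norm// /b mulrAC mulrA.
have x0 w : 0 <= cmod (D n w) / (2 * eps) by rewrite divr_ge0 ?cmod_ge0//; lra.
(* With [x = cmod (D n w) / (2 * eps)], [growth_fast] says that the truncation of [f * x] at level
   [f * (k + 1)] is at most [psi x]. *)
have {}hn : forall j, fam j ->
    (j (fun w => (ramp (f * k.+1%:R) (cmod (Complex b 0 * D n w)))%:E) <= 1%:E)%E.
  move=> j fj; apply: le_trans (hn j fj); apply: (means_mono famP) => // w w1.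
    by rewrite lee_fin ramp_ge0.
  rewrite lee_fin cbD; apply: ramp_le; first exact: pp.
  by rewrite -mulrBr; exact: growth_fast.
have := (hC (kv k)).2 _ _ _ hbD A0 hn; rewrite cbD mulr1 /D g0// subr0 /Cop cu.
have -> : f = C (kv k) + 1 by [].
rewrite leNgt => /negP; apply.
set p := cmod _ ^+ _ in hz1 *; set c := C (kv k) in hC0 *.
have k0 : 1 <= k.+1%:R :> R by rewrite ler1n.
rewrite (_ : _ / (2 * eps) = k.+1%:R * p * (4 * (K + 1))); last by rewrite /eps; field; lra.
have h1 : k.+1%:R * (1 / 2) <= k.+1%:R * p by rewrite ler_wpM2l.
have h2 : k.+1%:R * (1 / 2) * (4 * (K + 1)) <= k.+1%:R * p * (4 * (K + 1)).
  by rewrite ler_wpM2r//; lra.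
have h3 : (c + 1) * (k.+1%:R * (1 / 2) * (4 * (K + 1))) <= (c + 1) * (k.+1%:R * p * (4 * (K + 1))).
  by rewrite ler_wpM2l//; lra.
apply: lt_le_trans h3.
rewrite [ltRHS](_ : _ = K * ((c + 1) * k.+1%:R) + (c + 1) * k.+1%:R * (K + 2)); last by field.
rewrite ltrD2l; have h4 : (c + 1) * 1 <= (c + 1) * k.+1%:R by rewrite ler_wpM2l//; lra.
have h5 : (c + 1) * k.+1%:R * 1 <= (c + 1) * k.+1%:R * (K + 2) by rewrite ler_wpM2l//; lra.
lra.
Qed.
End Converse.
End Families.

Section Instances.
Context {R : realType} {N : nat}.
Local Notation cv := (cvec R N).
Hypothesis N1 : (1 <= N)%N.

Lemma lux_lt (J : (cv -> \bar R) -> \bar R) psi f M c : M < c -> (lux J psi f <= M%:E)%E ->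
  exists c', [/\ 0 < c', c' < c & (J (fun z => (psi (cmod (f z) / c'))%:E) <= 1)%E].
Proof.
move=> Mc h; have : (lux J psi f < c%:E)%E by apply: le_lt_trans h _; rewrite lte_fin.
by move=> /ereal_inf_lt[_ [c' [c'0 hc'] <-]]; rewrite lte_fin => cc; exists c'.
Qed.

Lemma lux_le (J : (cv -> \bar R) -> \bar R) psi f c : 0 < c ->
  (J (fun z => (psi (cmod (f z) / c))%:E) <= 1)%E -> (lux J psi f <= c%:E)%E.
Proof. by move=> c0 h; apply: ereal_inf_lbound; exists c. Qed.

Lemma orlicz_quotient_le psi (f : cv -> R[i]) c c' z : orlicz psi -> 0 < c' -> c' < c ->
  psi (cmod (f z) / c) <= psi (cmod (f z) / c').
Proof.
move=> po c0 cc; have c1 := lt_trans c0 cc; apply: orlicz_mono => //.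
  by rewrite divr_ge0 ?cmod_ge0 ?ltW.
by rewrite ler_wpM2l ?cmod_ge0// lef_pV2 ?posrE// ltW.
Qed.

Lemma orlicz_quotient_ge0 psi (f : cv -> R[i]) c z : orlicz psi -> 0 < c ->
  0 <= psi (cmod (f z) / c).
Proof. by move=> [_ pp _ _ _] c0; rewrite pp// divr_ge0 ?cmod_ge0 ?ltW. Qed.

Section Bergman.
Variable al : R.
Hypothesis al1 : -1 < al.

Definition bergman_means : ((cv -> \bar R) -> \bar R) -> Prop := eq (bint al).

Lemma bergman_meansP : means_family bergman_means.
Proof.
split.
- by move=> _ G H <-; exact: le_bint.
- by move=> _ <-; exact: bint_cst1.
- exists (16 ^+ N) => [|rho r1]; first exact: exprn_ge0.
  have r'0 : 0 <= Num.max 0 rho by rewrite le_max lexx.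
  have r'1 : Num.max 0 rho < 1 by rewrite gt_max ltr01.
  have [C C0 hC] := bint_eval N1 al1 r'0 r'1; exists C => // f A B hf A0 hB p pr.
  by apply: hC => //; [exact: hB|rewrite le_max pr orbT].
- move=> e v k e1 v0; have [m km hm] := bint_peak_small N1 k al1 e1 v0.
  by exists m => // _ <-.
Qed.

Lemma bergman_space_of_means psi : orlicz psi ->
  space_of_means bergman_means psi (bergman al psi) (bergman_norm al psi).
Proof.
move=> po; split.
- by move=> f [].
- move=> f [_ [c c0 hc]]; exists c, (fine (bint al (fun z => (psi (cmod (f z) / c))%:E))).
  split => // _ <-; rewrite fineK// ge0_fin_numE//.
  by apply: bint_ge0 => z; rewrite lee_fin; exact: (orlicz_quotient_ge0 f).
- by move=> f c c0 hf h; split => //; exists c => //; apply: le_lt_trans (h _ erefl) _; rewrite ltey.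
- by move=> f c c0 h; apply: lux_le => //; exact: h.
- move=> f M c c0 Mc /(lux_lt Mc)[c' [c'0 cc hc']] _ <-; apply: le_trans hc'.
  apply: le_bint => // z _; rewrite lee_fin; first exact: (orlicz_quotient_ge0 f).
  exact: (orlicz_quotient_le f).
Qed.
End Bergman.

Definition hardy_means (j : (cv -> \bar R) -> \bar R) : Prop :=
  exists2 r, 0 < r < 1 & j = fun G => sint (fun z => G (vscale r z)).

Lemma vnorm_radius_lt (r : R) (z : cv) : 0 < r < 1 -> vnorm (vscale r (vscale (vnorm z)^-1 z)) < 1.
Proof.
move=> /andP[r0 r1]; rewrite vnorm_vscale gtr0_norm//; apply: le_lt_trans r1.
by rewrite ler_piMr ?(ltW r0) ?vnorm_sphere_le.
Qed.

Lemma hardy_meansP : means_family hardy_means.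
Proof.
split.
- by move=> _ G H [r r01 ->] G0 GH; apply: le_bint => // z _; [apply: G0|apply: GH]; exact: vnorm_radius_lt.
- by move=> _ [r r01 ->]; exact: (bint_cst1 N1 (ltrN10 R)).
- exists (16 ^+ N.+1) => [|rho r1]; first exact: exprn_ge0.
  have [C C0 hC] := sint_eval N1 r1; exists C => // f A B hf A0 hB p pr.
  by apply: hC => // r r01; apply: (hB (fun G => sint (fun z => G (vscale r z)))); exists r.
- move=> e v k e1 v0; have [m km hm] := sint_peak_small N1 k e1 v0.
  by exists m => // _ [r r01 ->]; exact: hm.
Qed.

Lemma hardy_space_of_means psi : orlicz psi ->
  space_of_means hardy_means psi (hardy psi) (hardy_norm psi).
Proof.
move=> po.
have nm f M c : 0 < c -> M < c -> (hardy_norm psi f <= M%:E)%E -> means_le hardy_means psi c 1 f.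
  move=> c0 Mc h _ [r r01 ->].
  have {}h : (lux (@sint R N) psi (fun z => f (vscale r z)) <= M%:E)%E.
    by apply: le_trans h; apply: ereal_sup_ubound; exists r.
  have [c' [c'0 cc hc']] := lux_lt Mc h; apply: le_trans hc'.
  apply: (le_bint N1 (ltrN10 R)) => // z _; rewrite lee_fin.
    exact: (orlicz_quotient_ge0 f).
  exact: (orlicz_quotient_le f).
have mn f c : 0 < c -> means_le hardy_means psi c 1 f -> (hardy_norm psi f <= c%:E)%E.
  move=> c0 h; apply: ge_ereal_sup => _ [r r01 <-]; apply: lux_le => //.
  by apply: (h (fun G => sint (fun z => G (vscale r z)))); exists r.
split => //.
- by move=> f [].
- move=> f [_ hn]; have [M hM] : exists M : R, (hardy_norm psi f <= M%:E)%E.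
    by move: hn; case: (hardy_norm _ _) => [M| |] // _; [exists M|exists 0; rewrite leNye].
  have c0 : 0 < Num.max 0 M + 1 by rewrite ltr_wpDl// le_max lexx.
  exists (Num.max 0 M + 1), 1; split => //; apply: nm hM => //.
  by rewrite ltr_pwDr// le_max lexx orbT.
- move=> f c c0 hf h; split => //; apply: le_lt_trans (mn _ _ c0 h) _; exact: ltey.
Qed.

Section BoundedFunctions.
Variable phi : cv -> cv.
Hypothesis hphi : holo_self phi.

Lemma hinf_norm_le (f : cv -> R[i]) M :
  (hinf_norm f <= M%:E)%E <-> forall z, vnorm z < 1 -> cmod (f z) <= M.
Proof.
split => [h z z1|h]; last by apply: ge_ereal_sup => _ [z z1 <-]; rewrite lee_fin; exact: h.
by rewrite -lee_fin; apply: le_trans h; apply: ereal_sup_ubound; exists z.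
Qed.

Lemma hinf_compact_of_strict : strict_image phi -> compact_op (@hinf R N) (@hinf_norm R N) (Cop phi).
Proof.
move=> /strict_image_bound[rho [r0 r1 pr]]; split.
  by move=> f [hf [M hM]]; split; [exact: holo_comp|exists M => z z1; apply: hM; exact: hphi.2].
move=> u M uM; have hu n : holo (u n) by case: (uM n) => -[].
have ub n z : vnorm z < 1 -> cmod (u n z) <= M by case: (uM n) => _ /hinf_norm_le; exact.
have [|s [g [s1 hg lim]]] := montel hu _ r1.
  by move=> r r'1; exists M => n z zr; apply: ub; exact: le_lt_trans r'1.
exists s, (fun z => g (phi z)); split => //.
  split; first exact: holo_comp.
  have [n0 hn0] := lim 1 ltr01; exists (M + 1) => z z1.
  have h1 := hn0 n0 (leqnn _) _ (pr _ z1); have h2 := ub (s n0) _ (hphi.2 _ z1).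
  have h3 := cmodD (u (s n0) (phi z)) (- (u (s n0) (phi z) - g (phi z))).
  by move: h3; rewrite cmodN opprB addrC subrK; lra.
move=> eps e0; have [n0 hn0] := lim eps e0; exists n0 => n nn; apply/hinf_norm_le => z z1.
by apply: hn0 => //; exact: pr.
Qed.

(** Powers of the peak function stay in the unit ball and tend to 0 at every [phi w], so the only
    possible limit is 0; yet each of them has modulus at least [1 / 2] somewhere on the image of
    [phi]. *)
Lemma strict_of_hinf_compact : compact_op (@hinf R N) (@hinf_norm R N) (Cop phi) -> strict_image phi.
Proof.
move=> [_ hc]; apply: contrapT => /(escape hphi)[e e1 esc].
pose u n (z : cv) := peak e z ^+ (n.+1 * n.+1).
have u1 n z : vnorm z < 1 -> cmod (u n z) <= 1.
  by move=> z1; rewrite cmodX exprn_ile1 ?cmod_ge0//; apply: le_trans (peak_le e1 z) _; lra.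
have hu n : holo (u n) by apply: holoX; exact: holo_peak.
have uM n : hinf (u n) /\ (hinf_norm (u n) <= 1%:E)%E.
  by split; [split => //; exists 1; exact: u1|apply/hinf_norm_le; exact: u1].
have [s [g [s1 Sg lim]]] := hc u 1 uM.
have sn n : (n <= s n)%N by elim: n => [|n IH] //; exact: leq_ltn_trans (s1 n).
have D eps : 0 < eps -> exists n0, forall n, (n0 <= n)%N -> forall w, vnorm w < 1 ->
    cmod (u (s n) (phi w) - g w) <= eps.
  by move=> /lim[n0 hn0]; exists n0 => n /hn0/hinf_norm_le.
have g0 w : vnorm w < 1 -> g w = 0.
  move=> w1; apply: contrapT => gw0; pose a := cmod (g w).
  have a0 : 0 < a by rewrite lt_neqAle cmod_ge0 andbT eq_sym; apply/negP => /eqP /cmod_eq0.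
  have a4 : 0 < a / 4 by rewrite divr_gt0.
  have q1 : cmod (peak e (phi w)) < 1.
    by apply: le_lt_trans (peak_le e1 _) _; have := hphi.2 _ w1; lra.
  have [n1 hn1] := nat_mul_expr_small (cmod_ge0 _) q1 a4; have [n0 hn0] := D _ a4.
  pose n := maxn n0 n1.
  have h1 := hn0 n (leq_maxl _ _) w w1.
  have h2 : cmod (u (s n) (phi w)) <= a / 4.
    rewrite cmodX; apply: le_trans (hn1 (s n) _ _ (leqnn _)).
      by rewrite ler_peMl ?exprn_ge0 ?cmod_ge0// ler1n.
    by apply: leq_trans (sn n); exact: leq_maxr.
  have := cmodD (u (s n) (phi w)) (- (u (s n) (phi w) - g w)).
  by rewrite cmodN subKr -/a; lra.
have [n0 /(_ n0 (leqnn _)) hn0] := D (1 / 4) ltac:(lra).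
have [z [z1 hz]] := escape_peak ((s n0).+1 * (s n0).+1) hphi e1 esc.
have := hn0 z z1; rewrite g0// subr0 cmodX; lra.
Qed.
End BoundedFunctions.
End Instances.

Theorem theorem3p1 (R : realType) (N : nat) (phi : cvec R N -> cvec R N) :
  (1 <= N)%N -> holo_self phi ->
  [<-> (forall psi : R -> R, orlicz psi ->
          compact_op (hardy psi) (hardy_norm psi) (Cop phi));
       (exists2 alpha : R, -1 < alpha &
          forall psi : R -> R, orlicz psi ->
            compact_op (bergman alpha psi) (bergman_norm alpha psi) (Cop phi));
       compact_op (@hinf R N) (@hinf_norm R N) (Cop phi);
       (ereal_sup [set (vnorm (phi z))%:E | z in @ballN R N] < 1%:E)%E].
Proof.
move=> N1 hphi.
have B al := @bergman_space_of_means R N N1 al; have H := @hardy_space_of_means R N N1.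
split; [|split; [|split]].
(* Each of the first three arrows passes through the strict inclusion of the image, which then gives
   compactness on the next space; here [alpha = 0] is as good as any other exponent. *)
- move=> h; exists 0 => [|psi po]; first exact: ltrN10.
  apply: (compact_of_strict (bergman_meansP N1 (ltrN10 R)) po (B 0 (ltrN10 R) psi po)) => //.
  exact: (strict_of_compact (hardy_meansP N1) hphi H).
- move=> [al al1 h]; apply: hinf_compact_of_strict => //.
  exact: (strict_of_compact (bergman_meansP N1 al1) hphi (B al al1)).
- exact: strict_of_hinf_compact.
- by move=> h psi po; apply: (compact_of_strict (hardy_meansP N1) po (H psi po)).
Qed.
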